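(* Let $q$ be a prime power and let $G=\mathrm{PGL}_3(q)$ act on the set $\mathcal{P}$ of points of the projective plane $\mathrm{PG}_2(q)$. The independent sets of maximal size in the derangement graph $\Gamma_G$ are exactly the cosets (in $G$) of the stabilizer $G_\alpha$ of a point $\alpha\in\mathcal{P}$ and the cosets of the stabilizer $G_\ell$ of a line $\ell$ of $\mathrm{PG}_2(q)$.
   Context: $\mathrm{PG}_2(q)$ has as points the $1$-dimensional subspaces and as lines the $2$-dimensional subspaces of $\mathrm{GF}(q)^3$; $G=\mathrm{PGL}_3(q)$ acts on points and lines in the natural way, and $\alpha^g$ denotes the image of $\alpha$ under $g$. A derangement is an element of $G$ fixing no point of $\mathcal{P}$. The derangement graph $\Gamma_G$ has vertex set $G$, with $g,h$ adjacent iff $gh^{-1}$ is a derangement. An independent set of $\Gamma_G$ is a set of vertices no two of which are adjacent. *)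

(* Defs.v *)
From HB Require Import structures.
From mathcomp Require Import all_boot all_order all_algebra all_fingroup.
Set Implicit Arguments. Unset Strict Implicit. Unset Printing Implicit Defensive.
Import GRing.Theory.
Local Open Scope ring_scope.

Section Proj.
Variable F : finFieldType.

(* k-dimensional subspaces of GF(q)^3, represented canonically (row spaces)
   by the canonical matrix <<A>> of the subspace. *)
Definition subsp (k : nat) := {A : 'M[F]_3 | (\rank A == k) && (<<A>>%MS == A)}.

Definition PGpoint := subsp 1.
Definition PGline := subsp 2.

Definition subact k (U : subsp k) (g : {'GL_3[F]}) : subsp k :=
  insubd U (<<val U *m GLval g>>%MS).

Lemma subact_val k (U : subsp k) g : val (subact U g) = <<val U *m GLval g>>%MS.
Proof.
rewrite /subact val_insubd; case: U => A /= /andP[rA gA].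
rewrite genmx_id eqxx andbT.
rewrite mxrank_gen mxrankMfree ?rA //.
by rewrite row_free_unit; exact: (GL_unit g).
Qed.

Lemma subact1 k : (@subact k)^~ 1%g =1 id.
Proof.
move=> U; apply: val_inj; rewrite subact_val GL_1E mulmx1.
by case: U => A /= /andP[_ /eqP].
Qed.

Lemma subactM k (U : subsp k) : act_morph (@subact k) U.
Proof.
move=> g h; apply: val_inj; rewrite !subact_val GL_MxE mulmxA.
apply/eq_genmx; apply: eqmxMr; apply: eqmx_sym; exact: genmxE.
Qed.

Definition subspAction k := TotalAction (@subact1 k) (@subactM k).

(* PGL_3(q) realised as the permutation group induced by GL_3(q) on the
   point set of PG_2(q) (the kernel of this action is the group of scalars). *)
Definition PGL3 : {group {perm PGpoint}} :=
  (actperm (subspAction 1) @* [set: {'GL_3[F]}])%G.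

Definition point_stab (a : PGpoint) : {set {perm PGpoint}} :=
  [set g in PGL3 | g a == a].

Definition line_stab (l : PGline) : {set {perm PGpoint}} :=
  [set g in PGL3 | [exists u : {'GL_3[F]},
       (actperm (subspAction 1) u == g) && (subact l u == l)]].

Definition derangement (g : {perm PGpoint}) : bool :=
  (g \in PGL3) && [forall a : PGpoint, g a != a].

(* Independent set of the derangement graph Gamma_G (vertices G, g ~ h iff
   g h^-1 is a derangement). *)
Definition indep_set (S : {set {perm PGpoint}}) : bool :=
  (S \subset PGL3) &&
  [forall g in S, forall h in S, ~~ derangement (g * h^-1)%g].

Definition max_indep_set (S : {set {perm PGpoint}}) : bool :=
  indep_set S && [forall T : {set {perm PGpoint}}, indep_set T ==> (#|T| <= #|S|)%N].

End Proj.

(* Main.v *)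
Require Import Defs.
From HB Require Import structures.
From mathcomp Require Import all_boot all_order all_algebra all_fingroup.
From mathcomp Require Import mxabelem ring lra.

(* Everything is lifted to [GL_3(q)], acting on row vectors from the right. A
   Singer cycle is the centralizer of a derangement, has order q^3 - 1, and all
   its nonscalar elements are derangements. Hence an independent set has at most
   |G|/n elements, where n = q^2 + q + 1, and one, S, of this size meets every
   coset of every Singer cycle equally often. Summing over all Singer cycles, the derangements in a translate of S are counted, which
   turns each function h on G into a linear relation for the average of h over S.
   With h the numbers of fixed points and of fixed flags, both also weighted by
   the number of cube roots of the determinant, and a function supported on
   unipotent elements, these relations show for q > 2 that an element of S fixes
   2 points on average, if 1 is in S. This is the equality case of Bessel's
   inequality for the projection on the span of the functions [p^g = p'], so the
   indicator f of S lies in this span. As f vanishes on derangements, its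
   coefficients at p <> p' are of the form u p + u p' + v (pp'), hence
   f g = sum of c_p over fixed points + sum of e_l over fixed lines. Evaluating f
   at an element with the only fixed point p and the only fixed line l gives
   c_p + e_l = 0 or 1, which forces c or e to be constant, and S to be a stabilizer.
   For q = 2 the averages are not determined by the relations; S is then found
   by a search through the choices of one element in some Singer cosets. *)

Set Implicit Arguments. Unset Strict Implicit. Unset Printing Implicit Defensive.
Import Order.TTheory GRing.Theory Num.Theory.
Local Open Scope ring_scope.

(** Taken without weight, the number of fixed points gives a void relation, because |S| = L = (n -
    1) c2 with c2 the order of the stabilizer of two points. This obstacle forces the detour through
    flags, weights and unipotent elements. The weights are there because, for a given determinant,
    the number of derangements in a coset of the homologies with a fixed axis involves a number of
    cube roots, which comes from cubics with a triple root. The unipotent function is chosen so that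
    it is a combination of the fixed flag count, the fixed point count and a constant, up to
    corrections supported on derangements, of which S has none, and on scalars, which all lie in S.
    This closes the system of relations. The relation for the unipotent function carries the factor
    q - 2, hence the separate treatment of q = 2. The target value 2 is the average for a point
    stabilizer, which has two orbits on points. All counts are rational sums of indicators, so that
    exchanges of sums and [ring] replace character theory. *)

Notation ind b := ((b%bool : bool)%:R : rat) (only parsing).

Lemma natr_card (T : finType) (A : {pred T}) : #|A|%:R = \sum_x ind (x \in A).
Proof. by rewrite -sum1_card natr_sum big_mkcond; apply: eq_bigr => x _; case: (x \in A). Qed.

Lemma sum_ind_eq (T : finType) (a : T) (g : T -> rat) : \sum_x ind (x == a) * g x = g a.
Proof.
rewrite (bigD1 a) //= eqxx mul1r big1 ?addr0 // => x /negPf->.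
by rewrite mul0r.
Qed.

Lemma sum_ind1 (T : finType) (a : T) : \sum_x ind (x == a) = 1.
Proof. by rewrite -[RHS](sum_ind_eq a (fun=> 1)); apply: eq_bigr => x _; rewrite mulr1. Qed.

Lemma sum_const_rat (T : finType) (c : rat) : \sum_(x : T) c = #|T|%:R * c.
Proof. by rewrite sumr_const mulr_natl. Qed.

Lemma sum_prod (A B : finType) (g : A * B -> rat) : \sum_x g x = \sum_a \sum_b g (a, b).
Proof. by rewrite pair_bigA; apply: eq_bigr => -[]. Qed.

Lemma indM (a b : bool) : ind (a && b) = ind a * ind b.
Proof. by case: a; case: b; rewrite ?mulr1 ?mulr0. Qed.

Lemma indN (a : bool) : ind (~~ a) = 1 - ind a.
Proof. by case: a; rewrite ?subrr ?subr0. Qed.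

(** * Cubics without roots *)

Section Cubics.
Variable F : finFieldType.
Implicit Types (l m : F) (bc : F * F).
Let q : rat := #|F|%:R.

Definition cubic_root (d : F) bc l := l ^+ 3 == bc.2 * l ^+ 2 + bc.1 * l + d.

(* As a function of the determinant this is the sum of the characters of
   [GL_3(q)/SL_3(q)] of order dividing 3. *)
Definition ncbrt (d : F) : rat := #|[set z : F | z ^+ 3 == d]|%:R.

Variable d : F.
Hypothesis d0 : d != 0.
Let rt := cubic_root d.
Let R bc : rat := \sum_l ind (rt bc l).

Lemma sum_nz : \sum_(l : F) ind (l != 0) = q - 1.
Proof.
under eq_bigr do rewrite indN.
by rewrite sumrB sum_ind1 sum_const_rat mulr1.
Qed.

Lemma rt_nz bc l : rt bc l -> l != 0.
Proof.
move=> r; apply/negP => /eqP l0; move: r; rewrite /rt /cubic_root l0 !expr0n /= !mulr0 !add0r.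
by rewrite eq_sym (negPf d0).
Qed.

Lemma rt_fst bc l : l != 0 -> rt bc l = (bc.1 == l ^+ 2 - bc.2 * l - d / l).
Proof.
move=> l0; rewrite /rt /cubic_root.
rewrite -(inj_eq (mulIf l0) bc.1); apply/eqP/eqP => h.
  have -> : bc.1 * l = l ^+ 3 - bc.2 * l ^+ 2 - d by rewrite h; ring.
  by field.
have -> : bc.1 * l = l ^+ 3 - bc.2 * l ^+ 2 - d by rewrite h; field.
by ring.
Qed.

(* The two coefficients interpolating the roots l and m; the third root is [d / (l m)]. *)
Definition coef2 l m : F * F := (- (l * m + d / m + d / l), l + m + d / (l * m)).

Lemma rt_two bc l m : l != 0 -> m != 0 -> l != m ->
  rt bc l && rt bc m = (bc == coef2 l m).
Proof.
move=> l0 m0 lm; have lm' : l - m != 0 by rewrite subr_eq0.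
rewrite !rt_fst //; case: bc => b c /=.
apply/andP/eqP => [[/eqP h1 /eqP h2]|[-> ->]].
  have hc : c = l + m + d / (l * m).
    apply: (mulfI lm').
    have h3 : l ^+ 2 - c * l - d / l = m ^+ 2 - c * m - d / m by rewrite -h1 -h2.
    have -> : (l - m) * c = l ^+ 2 - d / l - (l ^+ 2 - c * l - d / l) - c * m by ring.
    by rewrite h3; field; rewrite l0 m0.
  by rewrite /coef2; congr pair => //; rewrite h1 hc; field; rewrite l0 m0.
by split; apply/eqP; field; rewrite l0 m0.
Qed.

Lemma rt_third l m n : l != 0 -> m != 0 -> l != m ->
  rt (coef2 l m) n = [|| n == l, n == m | n == d / (l * m)].
Proof.
move=> l0 m0 lm; rewrite /rt /cubic_root /=.
rewrite -subr_eq0 (_ : _ - _ = (n - l) * (n - m) * (n - d / (l * m))); last first.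
  by field; rewrite l0 m0.
by rewrite !mulf_eq0 !subr_eq0 orbA.
Qed.

Let nu l m := d / (l * m).
Let good l m := [&& l != 0, m != 0 & l != m].

Lemma R_two bc l m : good l m -> rt bc l -> rt bc m ->
  R bc = 2 + ind ((nu l m != l) && (nu l m != m)).
Proof.
case/and3P=> l0 m0 lm h1 h2; have /eqP -> : bc == coef2 l m by rewrite -rt_two // h1 h2.
rewrite /R (bigD1 l) //= (bigD1 m) /=; last by rewrite eq_sym.
rewrite (rt_third l l0 m0 lm) (rt_third m l0 m0 lm) !eqxx orbT /= addrA; congr (_ + _).
case: (boolP ((nu l m != l) && (nu l m != m))) => [/andP[n1 n2]|]; last first.
  rewrite negb_and !negbK => h; rewrite big1 // => i /andP[il im].
  rewrite rt_third // (negPf il) (negPf im) /=.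
  case/orP: h => /eqP h; rewrite -/(nu l m) h ?(negPf il) ?(negPf im) //.
rewrite (bigD1 (nu l m)) /=; last by rewrite n1 n2.
rewrite rt_third // eqxx !orbT big1 ?addr0 // => i /andP[/andP[il im] i3].
by rewrite rt_third // (negPf il) (negPf im) (negPf i3).
Qed.

Lemma R_cases bc : [\/ R bc = 0, R bc = 1, R bc = 2 | R bc = 3].
Proof.
have [/existsP[l hl]|/existsPn h] := boolP [exists l, rt bc l]; last first.
  by constructor 1; rewrite /R big1 // => l _; rewrite (negPf (h l)).
have [/existsP[m /andP[lm hm]]|/existsPn h] := boolP [exists m, (l != m) && rt bc m].
  have g : good l m by rewrite /good (rt_nz hl) (rt_nz hm) lm.
  rewrite (R_two g hl hm); case: (_ && _); [constructor 4|constructor 3] => /=; lra.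
constructor 2; rewrite /R (bigD1 l) //= hl big1 ?addr0 // => m ml.
by move: (h m); rewrite eq_sym ml /= => /negPf ->.
Qed.

(** Inclusion-exclusion over the roots: the alternating sum of the binomials of R over k = 0, ..., 3
    is 1 for R = 0 and 0 for R = 1, 2, 3. Counting cubics without roots thus reduces to the first
    three factorial moments of R. *)
Lemma noroot_ind bc : 6 * ind [forall l, ~~ rt bc l] =
  6 - 6 * R bc + 3 * (R bc * (R bc - 1)) - R bc * (R bc - 1) * (R bc - 2).
Proof.
case: forallP => h.
  have -> : R bc = 0 by rewrite /R big1 // => l _; rewrite (negPf (h l)).
  by rewrite /=; lra.
have R0 : R bc <> 0.
  move=> R0; apply: h => l; apply/negP => hl.
  have : R bc >= 1.
    rewrite /R (bigD1 l) //= hl lerDl; apply: sumr_ge0 => i _; exact: ler0n.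
  by rewrite R0; lra.
by case: (R_cases bc) => h1; rewrite h1 in R0 *; try lra.
Qed.

Lemma sumR : \sum_bc R bc = (q - 1) * q.
Proof.
rewrite exchange_big /= -sum_nz mulr_suml; apply: eq_bigr => l _.
have [->|l0] := eqVneq l 0.
  by rewrite mul0r big1 // => bc _; have [/rt_nz|//] := boolP (rt bc 0); rewrite eqxx.
rewrite mul1r (eq_bigr (fun bc => ind (bc.1 == l ^+ 2 - bc.2 * l - d / l))) /=; last first.
  by move=> bc _; rewrite rt_fst.
rewrite -(pair_big xpredT xpredT (fun b c => ind (b == l ^+ 2 - c * l - d / l))) /=.
rewrite exchange_big /= (eq_bigr (fun=> 1)); first by rewrite sum_const_rat mulr1.
by move=> c _; rewrite sum_ind1.
Qed.

Lemma R_pairs bc : R bc * (R bc - 1) = \sum_l \sum_m ind (l != m) * ind (rt bc l && rt bc m).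
Proof.
rewrite /R mulr_suml; apply: eq_bigr => l _.
rewrite mulrBr mulr1 mulr_sumr -/(R bc).
rewrite [RHS](eq_bigr (fun m => ind (rt bc l && rt bc m) - ind (m == l) * ind (rt bc l))); last first.
  by move=> m _; rewrite eq_sym; case: eqVneq => [->|]; rewrite ?mul1r ?mul0r ?subr0 // andbb subrr.
rewrite sumrB sum_ind_eq; congr (_ - _); apply: eq_bigr => m _; exact/esym/indM.
Qed.

(** Two distinct nonzero roots are shared by exactly one cubic with the given constant term, so
    summing over cubics and pairs of roots amounts to summing over pairs. *)
Lemma sum_pairs (g : F -> F -> rat) :
  \sum_bc \sum_l \sum_m ind (l != m) * ind (rt bc l && rt bc m) * g l m
  = \sum_l \sum_m ind (good l m) * g l m.
Proof.
rewrite exchange_big; apply: eq_bigr => l _; rewrite exchange_big; apply: eq_bigr => m _ /=.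
rewrite -mulr_suml; congr (_ * _); rewrite -mulr_sumr /good.
have [->|l0] := eqVneq l 0.
  rewrite big1 ?mulr0 // => bc _; case: andP => [[/rt_nz]|//]; by rewrite eqxx.
have [->|m0] := eqVneq m 0.
  rewrite big1 ?mulr0 // => bc _; case: andP => [[_ /rt_nz]|//]; by rewrite eqxx.
have [->|lm] := eqVneq l m; first by rewrite mul0r.
by rewrite mul1r (eq_bigr (fun bc => ind (bc == coef2 l m))) ?sum_ind1 // => bc _; rewrite rt_two.
Qed.

Lemma sum_good : \sum_(l : F) \sum_(m : F) ind (good l m) = (q - 1) * (q - 2).
Proof.
rewrite -[X in X * _]sum_nz mulr_suml; apply: eq_bigr => l _; rewrite /good.
have [->|l0] := eqVneq l 0; first by rewrite mul0r big1.
rewrite mul1r (eq_bigr (fun m => ind (m != 0) - ind (m == l))) => [|m _].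
  by rewrite sumrB sum_nz sum_ind1; ring.
by rewrite [l == m]eq_sym; case: (eqVneq m l) => [->|]; rewrite ?l0 ?andbT ?andbF ?subr0 ?subrr.
Qed.

Lemma sum_third : \sum_(l : F) \sum_(m : F) ind (good l m) * ind ((nu l m != l) && (nu l m != m))
  = (q - 1) ^+ 2 - 3 * (q - 1) + 2 * ncbrt d.
Proof.
pose nz l := ind (l != 0).
have nzq x : x != 0 -> (0 == d / x ^+ 2) = false.
  by move=> x0; rewrite eq_sym mulf_eq0 invr_eq0 expf_eq0 (negPf d0) (negPf x0).
(* From all pairs of nonzero l, m the coincidences m = l, third root = l and third root = m are
   removed. Any two of them imply the third and mean l = m with l^3 = d; such pairs are removed
   three times, so they are added back twice. *)
rewrite (eq_bigr (fun l => \sum_m (nz l * nz m - nz l * ind (m == l)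
   - nz l * ind (m == d / l ^+ 2) - nz m * ind (l == d / m ^+ 2)
   + 2 * (ind (m == l) * ind (l ^+ 3 == d))))) => [|l _]; last first.
  apply: eq_bigr => m _; rewrite /good /nz /nu.
  have [->|l0] := eqVneq l 0.
    have -> : (0 : F) ^+ 3 == d = false by rewrite expr0n eq_sym (negPf d0).
    have [->|m0] := eqVneq m 0; first by rewrite !mul0r !mulr0; ring.
    rewrite (nzq m m0) /=; ring.
  have [->|m0] := eqVneq m 0.
    rewrite (nzq l l0) [0 == l]eq_sym (negPf l0) /=; ring.
  rewrite (_ : d / (l * m) == l = (m == d / l ^+ 2)); last first.
    by apply/eqP/eqP => h; [rewrite -[in RHS](divfK (_ : l * m != 0) d) ?mulf_neq0 // h|rewrite h];
      field; rewrite ?l0 ?m0 ?d0.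
  rewrite (_ : d / (l * m) == m = (l == d / m ^+ 2)); last first.
    by apply/eqP/eqP => h; [rewrite -[in RHS](divfK (_ : l * m != 0) d) ?mulf_neq0 // h|rewrite h];
      field; rewrite ?l0 ?m0 ?d0.
  rewrite (_ : l ^+ 3 == d = (l == d / l ^+ 2)); last first.
    apply/eqP/eqP => h; first by rewrite -h; field.
    by rewrite exprS [X in X * _]h divfK // expf_neq0.
  rewrite [l == m]eq_sym.
  have [->|ml] := eqVneq m l; first by case: (l == _) => /=; ring.
  have [e1|] := eqVneq m (d / l ^+ 2); last by case: (l == _) => /= _; ring.
  have [e2|] := eqVneq l (d / m ^+ 2); last by move=> _ /=; ring.
  case/eqP: ml; have h1 : m * l ^+ 2 = d by rewrite e1; field.
  have h2 : l * m ^+ 2 = d by rewrite {1}e2; field.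
  have lm0 : l * m != 0 by rewrite mulf_neq0.
  apply: (mulfI lm0); transitivity d; first by rewrite -h2; ring.
  by rewrite -h1; ring.
have s1 l : \sum_m (nz l * nz m - nz l * ind (m == l)
   - nz l * ind (m == d / l ^+ 2) - nz m * ind (l == d / m ^+ 2)
   + 2 * (ind (m == l) * ind (l ^+ 3 == d))) =
   nz l * (q - 1) - 2 * nz l - \sum_m nz m * ind (l == d / m ^+ 2) + 2 * ind (l ^+ 3 == d).
  rewrite big_split !sumrB /= -!mulr_sumr sum_nz !sum_ind1 sum_ind_eq; ring.
rewrite (eq_bigr _ (fun l _ => s1 l)) big_split !sumrB /= -mulr_suml -!mulr_sumr sum_nz.
rewrite exchange_big /= (eq_bigr nz) => [|m _]; last by rewrite -mulr_sumr sum_ind1 mulr1.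
rewrite sum_nz (_ : \sum_i _ = ncbrt d); first by ring.
by rewrite /ncbrt natr_card; apply: eq_bigr => i _; rewrite inE.
Qed.

Lemma cubic_count :
  3 * \sum_bc ind [forall l, ~~ cubic_root d bc l] = q ^+ 2 + q + 1 - ncbrt d.
Proof.
have h bc : R bc * (R bc - 1) * (R bc - 2) =
   \sum_l \sum_m ind (l != m) * ind (rt bc l && rt bc m) * ind ((nu l m != l) && (nu l m != m)).
  rewrite R_pairs mulr_suml; apply: eq_bigr => l _; rewrite mulr_suml; apply: eq_bigr => m _.
  case: (eqVneq l m) => [|lm]; first by rewrite !mul0r.
  case: andP => [[hl hm]|]; last by rewrite !(mulr0, mul0r).
  rewrite !mul1r (@R_two bc l m) ?hl ?hm //; first by ring.
  by rewrite /good (rt_nz hl) (rt_nz hm) lm.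
have E2 : \sum_bc R bc * (R bc - 1) = (q - 1) * (q - 2).
  rewrite -sum_good -[RHS](eq_bigr _ (fun l _ => eq_bigr _ (fun m _ => mulr1 _))) -sum_pairs.
  apply: eq_bigr => bc _; rewrite R_pairs.
  by do 2!apply: eq_bigr => ? _; rewrite mulr1.
have E3 : \sum_bc R bc * (R bc - 1) * (R bc - 2) = (q - 1) ^+ 2 - 3 * (q - 1) + 2 * ncbrt d.
  by rewrite (eq_bigr _ (fun bc _ => h bc)) sum_pairs sum_third.
have E : 6 * \sum_bc ind [forall l, ~~ rt bc l] =
    6 * q ^+ 2 - 6 * ((q - 1) * q) + 3 * ((q - 1) * (q - 2))
    - ((q - 1) ^+ 2 - 3 * (q - 1) + 2 * ncbrt d).
  rewrite -sumR -E2 -E3 !mulr_sumr (eq_bigr _ (fun bc _ => noroot_ind bc)) !(sumrB, big_split) /=.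
  by rewrite sum_const_rat card_prod natrM; ring.
rewrite -/rt; apply: (mulfI (_ : (2 : rat) != 0)) => //.
rewrite mulrA (_ : 2 * 3 = 6) // E; ring.
Qed.

End Cubics.

(** * Incidence and transitivity in the projective plane *)

Definition on (F : finFieldType) (p : PGpoint F) (l : PGline F) : bool :=
  (val p <= val l)%MS.

Notation "U '*^' g" := (Defs.subact U g) (at level 20, left associativity).

Section Plane.
Variable F : finFieldType.
Local Notation gT := {'GL_3[F]}.
Local Notation pt := (PGpoint F).
Local Notation ln := (PGline F).
Implicit Types (p a b : pt) (l : ln) (g : gT).
Let q : rat := #|F|%:R.
Let n : rat := q ^+ 2 + q + 1.

Lemma q_gt1 : 1 < q.
Proof. by rewrite (ltr_nat rat 1); exact: card_finNzRing_gt1. Qed.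

Lemma q_neq0 : q != 0.
Proof. by rewrite gt_eqF // (lt_trans ltr01 q_gt1). Qed.

Lemma rank_subsp (k : nat) (U : subsp F k) : \rank (val U) = k.
Proof. by case: U => A /= /andP[/eqP]. Qed.

Lemma subsp_of (k m : nat) (A : 'M[F]_(m, 3)) : \rank A = k -> {U : subsp F k | (val U :=: A)%MS}.
Proof.
move=> rA; have h : (\rank (<<A>>%MS) == k) && (<<(<<A>>)>>%MS == <<A>>%MS).
  by rewrite genmx_id eqxx andbT mxrank_gen rA.
by exists (Sub (<<A>>%MS) h); rewrite SubK; exact: genmxE.
Qed.

Lemma subsp_inj (k : nat) (U V : subsp F k) : (val U <= val V)%MS -> U = V.
Proof.
move=> UV; apply: val_inj; case/andP: (valP U) => _ /eqP <-; case/andP: (valP V) => _ /eqP <-.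
apply: eq_genmx; apply/eqmxP; rewrite UV -(geq_leqif (mxrank_leqif_sup UV)).
by rewrite /= !rank_subsp.
Qed.

Lemma subsp_eqE (k : nat) (U V : subsp F k) : (U == V) = (val U <= val V)%MS.
Proof. by apply/eqP/idP => [->|/subsp_inj]; rewrite ?submx_refl. Qed.

Lemma val_subact (k : nat) (U : subsp F k) g : (val (U *^ g) :=: val U *m GLval g)%MS.
Proof. by rewrite Defs.subact_val; exact: genmxE. Qed.

Lemma subact_eqE (k : nat) (U V : subsp F k) g : (U *^ g == V) = (val U *m GLval g <= val V)%MS.
Proof. by rewrite subsp_eqE val_subact. Qed.

Lemma subact_id (k : nat) (U : subsp F k) : U *^ 1%g = U. Proof. exact: Defs.subact1. Qed.

Lemma subact_mul (k : nat) (U : subsp F k) g h : U *^ (g * h)%g = U *^ g *^ h.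
Proof. exact: Defs.subactM. Qed.

Lemma subactK (k : nat) (U : subsp F k) g : U *^ g *^ g^-1%g = U.
Proof. by rewrite -subact_mul mulgV subact_id. Qed.

Lemma subactKV (k : nat) (U : subsp F k) g : U *^ g^-1%g *^ g = U.
Proof. by rewrite -subact_mul mulVg subact_id. Qed.

Lemma subact_inj (k : nat) g : injective (fun U : subsp F k => U *^ g).
Proof. by move=> U V /= e; rewrite -(subactK U g) e subactK. Qed.

Lemma subact_eqV (k : nat) (U V : subsp F k) g : (U *^ g == V) = (U == V *^ g^-1%g).
Proof. by apply/eqP/eqP => [<-|->]; rewrite ?subactK ?subactKV. Qed.

Lemma on_act p l g : on (p *^ g) (l *^ g) = on p l.
Proof.
have h p' l' g' : on p' l' -> on (p' *^ g') (l' *^ g').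
  by rewrite /on !val_subact => h; apply: submxMr.
by apply/idP/idP => [/h-/(_ g^-1%g)|/h //]; rewrite !subactK.
Qed.

Lemma on_actV p l g : on p (l *^ g) = on (p *^ g^-1%g) l.
Proof. by rewrite -[in RHS](on_act _ _ g) subactKV. Qed.

Lemma point_of (v : 'rV[F]_3) : v != 0 -> {p : pt | (val p :=: v)%MS}.
Proof. by move=> v0; apply: subsp_of; rewrite rank_rV v0. Qed.

Lemma vec_of p : {v : 'rV[F]_3 | v != 0 & (val p :=: v)%MS}.
Proof.
have rp := rank_subsp p; have p0 : val p != 0 by rewrite -mxrank_eq0 rp.
exists (nz_row (val p)); first by rewrite nz_row_eq0.
apply/eqmx_sym/eqmxP; rewrite nz_row_sub -(geq_leqif (mxrank_leqif_sup (nz_row_sub _))).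
by rewrite rp rank_rV nz_row_eq0 p0.
Qed.

Lemma point_sub_eq p (v : 'rV[F]_3) : v != 0 -> (v <= val p)%MS -> (val p :=: v)%MS.
Proof.
move=> v0 vp; apply/eqmx_sym/eqmxP; rewrite vp -(geq_leqif (mxrank_leqif_sup vp)).
by rewrite rank_subsp rank_rV v0.
Qed.

Lemma line_sub_eq l m (A : 'M[F]_(m, 3)) : \rank A = 2 -> (A <= val l)%MS -> (val l :=: A)%MS.
Proof.
move=> v0 vp; apply/eqmx_sym/eqmxP; rewrite vp -(geq_leqif (mxrank_leqif_sup vp)).
by rewrite rank_subsp v0.
Qed.

Lemma sum_point_vec (v : 'rV[F]_3) : v != 0 -> \sum_(p : pt) ind (v <= val p)%MS = 1.
Proof.
move=> v0; have [p0 e0] := point_of v0.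
rewrite -[RHS](sum_ind1 p0); apply: eq_bigr => p _; congr ((_ : bool)%:R).
by rewrite eq_sym subsp_eqE e0.
Qed.

(** Double counting of nonzero vectors: each one in W spans exactly one point, and each point
    carries q - 1 of them. *)
Lemma sum_points m (W : 'M[F]_(m, 3)) :
  (\sum_(p : pt) ind (val p <= W)%MS) * (q - 1) = q ^+ \rank W - 1.
Proof.
have cW k (V : 'M[F]_(k, 3)) : \sum_(v : 'rV[F]_3) ind ((v != 0) && (v <= V)%MS) = q ^+ \rank V - 1.
  rewrite -natrX -card_rowg.
  have -> : #|rowg V| = #|[pred v : 'rV[F]_3 | (v <= V)%MS]|.
    by apply: eq_card => v; rewrite !inE.
  rewrite natr_card [X in _ = X - _](bigD1 0) //= inE sub0mx.
  rewrite [LHS](bigD1 0) //= eqxx /= add0r addrAC subrr add0r.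
  by apply: eq_bigr => v v0; rewrite inE v0.
rewrite -cW mulr_suml.
rewrite (eq_bigr (fun v : 'rV[F]_3 => \sum_(p : pt) ind ((v != 0) && (v <= val p)%MS) * ind (val p <= W)%MS)).
  rewrite exchange_big; apply: eq_bigr => p _ /=.
  by rewrite -mulr_suml cW rank_subsp expr1 mulrC.
move=> v _; have [->|v0] := eqVneq v 0; first by rewrite big1 // => p _; rewrite mul0r.
rewrite /= -[LHS]mul1r -[X in X * _ = _](sum_point_vec v0) mulr_suml; apply: eq_bigr => p _.
case: (boolP (v <= val p)%MS) => [vp|]; last by rewrite !mul0r.
by rewrite (point_sub_eq v0 vp).
Qed.

Lemma q1_neq0 : q - 1 != 0.
Proof. by have := q_gt1; rewrite subr_eq0 => h; apply/eqP=> e; move: h; rewrite e ltxx. Qed.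

Lemma card_pt : #|{: pt}|%:R = n.
Proof.
have := sum_points (1%:M : 'M[F]_3); rewrite mxrank1.
rewrite (eq_bigr (fun=> 1)) => [|p _]; last by rewrite submx1.
rewrite sum_const_rat mulr1 => h; apply: (mulIf q1_neq0); rewrite h /n; ring.
Qed.

Lemma sum_on_line l : \sum_(p : pt) ind (on p l) = q + 1.
Proof.
apply: (mulIf q1_neq0); rewrite sum_points rank_subsp; ring.
Qed.

Lemma rank_join a b : a != b -> \rank (val a + val b)%MS = 2.
Proof.
rewrite subsp_eqE => ab.
have := mxrank_sum_cap (val a) (val b); rewrite !rank_subsp.
suff -> : \rank (val a :&: val b)%MS = 0%N by rewrite addn0.
have := mxrankS (capmxSl (val a) (val b)); rewrite rank_subsp leq_eqVlt ltnS leqn0.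
case/orP=> [/eqP e|/eqP //]; case/negP: ab.
apply: submx_trans (capmxSr (val a) (val b)).
by rewrite -(geq_leqif (mxrank_leqif_sup (capmxSl _ _))) rank_subsp e.
Qed.

Lemma line_through a b : a != b ->
  {l : ln | [/\ on a l, on b l & forall l', on a l' -> on b l' -> l' = l]}.
Proof.
move=> ab; have [l el] := subsp_of (rank_join ab); exists l.
split; [by rewrite /on el addsmxSl|by rewrite /on el addsmxSr|move=> l' al' bl'; apply/esym/subsp_inj].
by rewrite el addsmx_sub; apply/andP; split.
Qed.

Lemma line_meet l l' : l != l' ->
  {p : pt | [/\ on p l, on p l' & forall p', on p' l -> on p' l' -> p' = p]}.
Proof.
rewrite subsp_eqE => ll.
have := mxrank_sum_cap (val l) (val l'); rewrite !rank_subsp.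
have r3 : (\rank (val l + val l')%MS <= 3)%N by exact: rank_leq_col.
have r2 : (2 < \rank (val l + val l')%MS)%N.
  rewrite ltnNge; apply: contra ll => r2.
  have := mxrank_leqif_sup (addsmxSr (val l) (val l')); rewrite rank_subsp => /geq_leqif.
  rewrite r2 => /esym; exact: submx_trans (addsmxSl _ _).
have -> : \rank (val l + val l')%MS = 3%N by apply/eqP; rewrite eqn_leq r3 r2.
rewrite -[(2 + 2)%N]/(3 + 1)%N => /addnI /subsp_of [p ep].
exists p; split.
- by rewrite /on ep capmxSl.
- by rewrite /on ep capmxSr.
by move=> p' h1 h2; apply: subsp_inj; rewrite ep sub_capmx; apply/andP.
Qed.

Lemma sum_lines_through2 a b : a != b -> \sum_(l : ln) ind (on a l) * ind (on b l) = 1.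
Proof.
case/line_through=> l0 [h1 h2 h3]; rewrite -[RHS](sum_ind1 l0); apply: eq_bigr => l _.
rewrite -indM; congr ((_ : bool)%:R); apply/andP/eqP => [[]|->]; [exact: h3|by []].
Qed.

Lemma sum_meet l l' : l != l' -> \sum_(p : pt) ind (on p l) * ind (on p l') = 1.
Proof.
case/line_meet=> p0 [h1 h2 h3]; rewrite -[RHS](sum_ind1 p0); apply: eq_bigr => p _.
rewrite -indM; congr ((_ : bool)%:R); apply/andP/eqP => [[]|->]; [exact: h3|by []].
Qed.

Lemma sum_neq (T : finType) (x : T) (g : T -> rat) :
  \sum_y ind (y != x) * g y = \sum_y g y - g x.
Proof.
rewrite -[X in _ - X](sum_ind_eq x g) -sumrB; apply: eq_bigr => y _; rewrite indN; ring.
Qed.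

Lemma sum_thru p : \sum_(l : ln) ind (on p l) = q + 1.
Proof.
have q0 := q_neq0.
apply: (mulIf q0); rewrite mulr_suml.
rewrite (eq_bigr (fun l => \sum_a ind (a != p) * (ind (on p l) * ind (on a l)))); last first.
  move=> l _; rewrite sum_neq -mulr_sumr sum_on_line.
  by case: (on p l); rewrite /=; ring.
rewrite exchange_big /= (eq_bigr (fun a => ind (a != p) * 1)) => [|a _].
  rewrite sum_neq sum_const_rat card_pt /n; ring.
rewrite -mulr_sumr; case: eqVneq => [|ap]; first by rewrite !mul0r.
by rewrite sum_lines_through2 // eq_sym.
Qed.

Lemma card_ln : #|{: ln}|%:R = n.
Proof.
have q0 : q + 1 != 0 by have := q_gt1; case: eqP => // h; lra.
apply: (mulIf q0); rewrite -sum_const_rat.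
rewrite (eq_bigr (fun l => \sum_(p : pt) ind (on p l))) => [|l _]; last by rewrite sum_on_line.
by rewrite exchange_big /= (eq_bigr _ (fun p _ => sum_thru p)) sum_const_rat card_pt.
Qed.

Lemma sum_lines2 a b : \sum_(l : ln) ind (on a l) * ind (on b l) = 1 + q * ind (a == b).
Proof.
case: eqVneq => [->|ab]; last by rewrite sum_lines_through2 // mulr0 addr0.
rewrite (eq_bigr (fun l => ind (on b l))) ?sum_thru; first by rewrite /=; ring.
by move=> l _; case: (on b l); rewrite ?mulr1 ?mulr0.
Qed.

Lemma sum_meet2 l l' : \sum_p ind (on p l) * ind (on p l') = 1 + q * ind (l == l').
Proof.
case: eqVneq => [->|ab]; last by rewrite sum_meet // mulr0 addr0.
rewrite (eq_bigr (fun p => ind (on p l'))) ?sum_on_line; first by rewrite /=; ring.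
by move=> p _; case: (on p l'); rewrite ?mulr1 ?mulr0.
Qed.

Definition row3 (u v w : 'rV[F]_3) : 'M[F]_3 := col_mx u (col_mx v w).

Lemma row3_mul u v w (A : 'M[F]_3) : row3 u v w *m A = row3 (u *m A) (v *m A) (w *m A).
Proof. by rewrite /row3 (@mul_col_mx _ 1 2) (@mul_col_mx _ 1 1). Qed.

Lemma row3_inj u v w u' v' w' : row3 u v w = row3 u' v' w' -> [/\ u = u', v = v' & w = w'].
Proof. by move/(@eq_col_mx _ 1 2) => [-> /(@eq_col_mx _ 1 1)[-> ->]]. Qed.

Lemma row3_unit u v w : (row3 u v w \in unitmx) = (\rank (u + (v + w))%MS == 3%N).
Proof.
have e : (u + (v + w) :=: row3 u v w)%MS.
  exact: eqmx_trans (adds_eqmx (eqmx_refl u) (addsmxE v w)) (addsmxE u _).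
by rewrite -row_free_unit /row_free e.
Qed.

Lemma row3_unit_ext (u v w : 'rV[F]_3) : \rank (u + v)%MS = 2 -> ~~ (w <= u + v)%MS ->
  row3 u v w \in unitmx.
Proof.
move=> r2 hi; rewrite row3_unit eqn_leq rank_leq_col /=.
suff : (\rank (u + v)%MS < \rank (u + (v + w))%MS)%N by rewrite r2.
have h : (u + v <= u + (v + w))%MS by rewrite addsmxS // addsmxSl.
rewrite (ltn_leqif (mxrank_leqif_sup h)); apply: contra hi => h'.
by apply: submx_trans h'; rewrite (submx_trans _ (addsmxSr _ _)) // addsmxSr.
Qed.

Lemma frame_ext (u v : 'rV[F]_3) : \rank (u + v)%MS = 2 -> exists w, row3 u v w \in unitmx.
Proof.
move=> r2; have /row_subPn[i hi] : ~~ ((1%:M : 'M[F]_3) <= u + v)%MS.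
  by apply/negP => /mxrankS; rewrite mxrank1 r2.
by exists (row i 1%:M); exact: row3_unit_ext.
Qed.

Lemma GL_of (M : 'M[F]_3) : M \in unitmx -> {g : gT | GLval g = M}.
Proof. by move=> uM; exists (FinRing.unit _ uM). Qed.

Lemma GL_unitmx g : GLval g \in unitmx. Proof. exact: GL_unit. Qed.

Lemma frame_transport u v w u' v' w' : row3 u v w \in unitmx -> row3 u' v' w' \in unitmx ->
  exists g, [/\ u *m GLval g = u', v *m GLval g = v' & w *m GLval g = w'].
Proof.
move=> U U'; have UU : invmx (row3 u v w) *m row3 u' v' w' \in unitmx.
  by rewrite unitmx_mul unitmx_inv U.
have [g eg] := GL_of UU; exists g; apply: row3_inj.
by rewrite -row3_mul eg mulKVmx.
Qed.

Lemma subact_vec p p' g (v : 'rV[F]_3) : (val p :=: v)%MS -> (val p' :=: v *m GLval g)%MS ->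
  p *^ g = p'.
Proof.
by move=> e e'; apply: subsp_inj; rewrite val_subact e' (eqmxMr _ e) submx_refl.
Qed.

Lemma rank2_vec a b (u v : 'rV[F]_3) : a != b -> (val a :=: u)%MS -> (val b :=: v)%MS ->
  \rank (u + v)%MS = 2.
Proof. by move=> ab ea eb; rewrite -(rank_join ab); rewrite (adds_eqmx ea eb). Qed.

Lemma trans2 a b a' b' : a != b -> a' != b' -> exists g, a *^ g = a' /\ b *^ g = b'.
Proof.
have [u u0 eu] := vec_of a; have [v v0 ev] := vec_of b.
have [u' u0' eu'] := vec_of a'; have [v' v0' ev'] := vec_of b'.
move=> ab ab'; have [w W] := frame_ext (rank2_vec ab eu ev).
have [w' W'] := frame_ext (rank2_vec ab' eu' ev').
have [g [gu gv gw]] := frame_transport W W'; exists g.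
by split; [apply: (subact_vec eu); rewrite gu | apply: (subact_vec ev); rewrite gv].
Qed.

(** Rescaling the two spanning vectors puts the third point of the line at their sum. This normal
    form makes the group transitive on collinear triples of distinct points. *)
Lemma frame3 a b p l : a != b -> p != a -> p != b -> on a l -> on b l -> on p l ->
  exists u v : 'rV[F]_3, [/\ (val a :=: u)%MS, (val b :=: v)%MS & (val p :=: (u + v)%R)%MS].
Proof.
move=> ab pa pb al bl pl.
have [u u0 eu] := vec_of a; have [v v0 ev] := vec_of b; have [w w0 ew] := vec_of p.
have r2 := rank2_vec ab eu ev.
have el : (val l :=: u + v)%MS.
  by apply: line_sub_eq => //; rewrite addsmx_sub -eu -ev; apply/andP.
have : (w <= u + v)%MS by rewrite -el -ew.
case/sub_addsmxP=> -[x y] /=; rewrite [x]mx11_scalar [y]mx11_scalar !mul_scalar_mx => ewx.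
have sc (c : F) (z : 'rV[F]_3) : c != 0 -> (c *: z :=: z)%MS by move=> c0; apply: eqmx_scale.
have x0 : x 0 0 != 0.
  apply: contra pb => /eqP x0; rewrite subsp_eqE ew ev ewx x0 scale0r add0r scalemx_sub //.
have y0 : y 0 0 != 0.
  by apply: contra pa => /eqP y0; rewrite subsp_eqE ew eu ewx y0 scale0r addr0 scalemx_sub.
exists (x 0 0 *: u), (y 0 0 *: v); split.
- exact: eqmx_trans eu (eqmx_sym (sc _ _ x0)).
- exact: eqmx_trans ev (eqmx_sym (sc _ _ y0)).
by rewrite -ewx.
Qed.

Lemma trans3 a b p l a' b' p' l' :
  a != b -> p != a -> p != b -> on a l -> on b l -> on p l ->
  a' != b' -> p' != a' -> p' != b' -> on a' l' -> on b' l' -> on p' l' ->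
  exists g, [/\ a *^ g = a', b *^ g = b' & p *^ g = p'].
Proof.
move=> ab pa pb al bl pl ab' pa' pb' al' bl' pl'.
have [u [v [eu ev ew]]] := frame3 ab pa pb al bl pl.
have [u' [v' [eu' ev' ew']]] := frame3 ab' pa' pb' al' bl' pl'.
have [w W] := frame_ext (rank2_vec ab eu ev).
have [w' W'] := frame_ext (rank2_vec ab' eu' ev').
have [g [gu gv _]] := frame_transport W W'; exists g.
split; [apply: (subact_vec eu); rewrite gu | apply: (subact_vec ev); rewrite gv|] => //.
by apply: (subact_vec ew); rewrite mulmxDl gu gv.
Qed.

Definition gG : rat := #|{: gT}|%:R.

(** The fibres of g -> [act x g] over an orbit X are right translates of each other, hence equally
    large, and they partition the group. X is a set rather than a type because pairs and triples
    have to be distinct and triples collinear. *)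
Lemma sum_trans (T : finType) (act : T -> gT -> T) (X : {set T}) x y :
  (forall z g h, act z (g * h)%g = act (act z g) h) ->
  (forall z, act z 1%g = z) ->
  (forall z g, z \in X -> act z g \in X) ->
  (forall z z', z \in X -> z' \in X -> exists g, act z g = z') ->
  x \in X -> y \in X -> (\sum_g ind (act x g == y)) * #|X|%:R = gG.
Proof.
move=> aM a1 aX tr xX yX.
have E y' : y' \in X -> \sum_g ind (act x g == y') = \sum_g ind (act x g == y).
  move=> y'X; have [h hy] := tr _ _ yX y'X.
  rewrite (reindex_inj (mulIg h)); apply: eq_bigr => g _; congr ((_ : bool)%:R).
  rewrite aM -hy; apply/eqP/eqP => [e|-> //].
  by rewrite -[LHS]a1 -[RHS]a1 -(mulgV h) !aM e.
rewrite /gG -[RHS]mulr1 -sum_const_rat.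
rewrite [RHS](eq_bigr (fun g => \sum_(y' in X) ind (act x g == y'))); last first.
  move=> g _; rewrite (bigD1 (act x g)) /=; last exact: aX.
  rewrite eqxx big1 ?addr0 // => z /andP[_ zx]; rewrite eq_sym (negPf zx) //.
rewrite [RHS]exchange_big [RHS](eq_bigr (fun=> \sum_g ind (act x g == y))); last by move=> z zX; exact: E.
by rewrite sumr_const mulr_natr.
Qed.

Lemma sum_map1 a b : (\sum_g ind (a *^ g == b)) * n = gG.
Proof.
have := @sum_trans _ (@Defs.subact F 1) [set: pt] a b; rewrite cardsT card_pt; apply => //.
- exact: subact_mul.
- exact: subact_id.
move=> z z' _ _; pose other z := [exists y : pt, y != z].
have ex z0 : exists y, y != z0 :> pt.
  apply/existsP; apply: contraT; rewrite negb_exists => /forallP h; exfalso.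
  have : \sum_y ind (y != z0) * 1 = 0 by rewrite big1 // => y _; rewrite (negPf (h y)) mul0r.
  rewrite sum_neq sum_const_rat card_pt /n => h1.
  have := q_gt1; have : q * (q + 1) = 0 by move: h1; lra.
  by move/eqP; rewrite mulf_eq0 => /orP[] /eqP => h2; lra.
have [y yz] := ex z; have [y' yz'] := ex z'.
by have [g []] := trans2 yz yz'; exists g.
Qed.

Lemma sum_map2 a b a' b' : a != b -> a' != b' ->
  (\sum_g ind (a *^ g == a') * ind (b *^ g == b')) * (n * (n - 1)) = gG.
Proof.
move=> ab ab'; pose act (x : pt * pt) g := (x.1 *^ g, x.2 *^ g).
pose X := [set x : pt * pt | x.1 != x.2].
have cX : #|X|%:R = n * (n - 1).
  rewrite natr_card sum_prod -[X in _ = X * _]card_pt -sum_const_rat; apply: eq_bigr => x _.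
  rewrite (eq_bigr (fun y => ind (y != x) * 1)) ?sum_neq ?sum_const_rat ?card_pt ?mulr1 // => y _.
  by rewrite mulr1 inE /= eq_sym.
rewrite -cX -(@sum_trans _ act X (a, b) (a', b')) ?inE //.
- by congr (_ * _); apply: eq_bigr => g _; rewrite -indM.
- by move=> z g h; rewrite /act !subact_mul.
- by case=> z z'; rewrite /act !subact_id.
- by case=> z z' g; rewrite !inE /= (inj_eq (@subact_inj _ _)).
case=> z1 z2 [y1 y2]; rewrite !inE /= => h1 h2.
by have [g [g1 g2]] := trans2 h1 h2; exists g; rewrite /act /= g1 g2.
Qed.

Lemma sum_map3 a b p l a' b' p' l' :
  a != b -> p != a -> p != b -> on a l -> on b l -> on p l ->
  a' != b' -> p' != a' -> p' != b' -> on a' l' -> on b' l' -> on p' l' ->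
  (\sum_g ind (a *^ g == a') * ind (b *^ g == b') * ind (p *^ g == p')) * (n * (n - 1) * (q - 1)) = gG.
Proof.
move=> ab pa pb al bl pl ab' pa' pb' al' bl' pl'.
pose act (x : pt * pt * pt) g := (x.1.1 *^ g, x.1.2 *^ g, x.2 *^ g).
pose X := [set x : pt * pt * pt | [&& x.1.1 != x.1.2, x.2 != x.1.1, x.2 != x.1.2 &
  [exists l, [&& on x.1.1 l, on x.1.2 l & on x.2 l]]]].
have inX x y z l0 : x != y -> z != x -> z != y -> on x l0 -> on y l0 -> on z l0 -> (x, y, z) \in X.
  by move=> h1 h2 h3 h4 h5 h6; rewrite inE /= h1 h2 h3; apply/existsP; exists l0; rewrite h4 h5 h6.
have cX : #|X|%:R = n * (n - 1) * (q - 1).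
  rewrite natr_card sum_prod sum_prod.
  rewrite -[X in X * (X - 1) * _]card_pt -mulrA -sum_const_rat; apply: eq_bigr => x _.
  transitivity (\sum_y ind (y != x) * (q - 1)); last first.
    by rewrite sum_neq sum_const_rat; ring.
  apply: eq_bigr => y _; have [->|yx] := eqVneq y x.
    by rewrite mul0r big1 // => z _; rewrite inE /= eqxx.
  have [l0 [xl yl ul]] := line_through yx.
  rewrite mul1r (eq_bigr (fun z => ind (z != x) * (ind (z != y) * ind (on z l0)))).
    by rewrite sum_neq sum_neq sum_on_line xl yl eq_sym yx /=; ring.
  move=> z _; rewrite -!indM inE /= eq_sym yx /=; congr ((_ : bool)%:R); do 2!congr (_ && _).
  apply/existsP/idP => [[l1 /and3P[h1 h2 h3]]|h]; first by rewrite -(ul l1).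
  by exists l0; rewrite yl xl.
rewrite -cX -(@sum_trans _ act X (a, b, p) (a', b', p')).
- by congr (_ * _); apply: eq_bigr => g _; rewrite -!indM.
- by move=> z g h; rewrite /act !subact_mul.
- by case=> -[z z'] z''; rewrite /act !subact_id.
- case=> -[x y] z g; rewrite !inE /= !(inj_eq (@subact_inj _ _)) => /and4P[-> -> -> /existsP[l0 h]] /=.
  by apply/existsP; exists (l0 *^ g); rewrite !on_act.
- case=> -[x y] z [[x' y'] z']; rewrite !inE /= => /and4P[h1 h2 h3 /existsP[l0 /and3P[h4 h5 h6]]].
  case/and4P=> h1' h2' h3' /existsP[l0' /and3P[h4' h5' h6']].
  have [g [g1 g2 g3]] := trans3 h1 h2 h3 h4 h5 h6 h1' h2' h3' h4' h5' h6'.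
  by exists g; rewrite /act /= g1 g2 g3.
- exact: (inX _ _ _ l).
- exact: (inX _ _ _ l').
Qed.

Lemma gG_val : gG = q ^+ 3 * (q - 1) * (q ^+ 2 - 1) * (q ^+ 3 - 1).
Proof.
have qg := card_finNzRing_gt1 F.
rewrite /gG -cardsT card_GL // 2?big_nat_recr //= big_nat1 (_ : 'C(3, 2) = 3%N) //.
by rewrite !natrM !natrB ?expn_gt0 ?(ltnW qg) // !natrX -/q; ring.
Qed.

End Plane.

(** * Homologies and derangements *)

Section Homologies.
Variable F : finFieldType.
Local Notation gT := {'GL_3[F]}.
Local Notation pt := (PGpoint F).
Local Notation ln := (PGline F).
Implicit Types (p a b : pt) (l : ln) (g : gT).
Let q : rat := #|F|%:R.
Let n : rat := q ^+ 2 + q + 1.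

Definition der : {set gT} := [set g | [forall p : pt, p *^ g != p]].

(** The perspectivities with axis l, normalized to act on l as the identity matrix; every
    determinant still occurs. *)
Definition homol l : {set gT} := [set t : gT | val l *m GLval t == val l].

(** By [homol_der], exactly the condition under which the coset of g modulo [homol l] contains a
    derangement. *)
Definition generic l g : bool := (l *^ g != l) && [forall p : pt, on p l ==> (p *^ g != p)].

Definition nfix g : rat := \sum_(p : pt) ind (p *^ g == p).

(** Double counting of the pairs (p, l) with p and its image both on l. By lines this gives n plus q
    for each fixed line, by points n plus q for each fixed point. *)
Lemma nfix_lines g : nfix g = \sum_(l : ln) ind (l *^ g == l).
Proof.
have q0 := q_neq0 F.
have : \sum_(l : ln) \sum_(p : pt) ind (on p l) * ind (on (p *^ g) l)
     = \sum_(p : pt) \sum_(l : ln) ind (on p l) * ind (on (p *^ g) l) by rewrite exchange_big.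
under [RHS]eq_bigr do rewrite sum_lines2.
rewrite (eq_bigr (fun l => 1 + q * ind (l *^ g == l))) => [|l _]; last first.
  under eq_bigr do rewrite -[g]invgK -on_actV invgK.
  by rewrite sum_meet2 subact_eqV.
rewrite !big_split -!mulr_sumr !sum_const_rat card_ln card_pt /= => /addrI/(mulfI q0) ->.
by apply: eq_bigr => p _; rewrite eq_sym.
Qed.

Lemma der_no_line l g : g \in der -> l *^ g != l.
Proof.
rewrite inE => /forallP gD; have := nfix_lines g; rewrite /nfix big1 => [h|p _].
  apply/negP => lg; have : ind (l *^ g == l) <= 0.
    rewrite h (bigD1 l) //= lerDl; apply: sumr_ge0 => i _; exact: ler0n.
  by rewrite lg.
by rewrite (negPf (gD p)).
Qed.

Lemma fixes_vec p g (v : 'rV[F]_3) : (val p :=: v)%MS ->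
  reflect (exists c, v *m GLval g = c *: v) (p *^ g == p).
Proof.
move=> e; rewrite subact_eqE (eqmxMr _ e) e.
exact: sub_rVP.
Qed.

Lemma derP g : reflect (forall (v : 'rV[F]_3) c, v != 0 -> v *m GLval g <> c *: v) (g \in der).
Proof.
rewrite inE; apply: (iffP forallP) => h.
  move=> v c v0 e; have [p ep] := point_of v0; case/negP: (h p).
  by apply/(fixes_vec _ ep); exists c.
move=> p; have [v v0 ev] := vec_of p; apply/negP => /(fixes_vec _ ev)[c]; exact: h.
Qed.

Lemma derJ g h : (g ^ h \in der)%g = (g \in der).
Proof.
have H k k' : k \in der -> (k ^ k' \in der)%g.
  rewrite !inE => /forallP hk; apply/forallP => p.
  rewrite /conjg !subact_mul; apply: contra (hk (p *^ k'^-1%g)) => /eqP e.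
  by rewrite -{2}e subactK.
by apply/idP/idP => [/(H _ h^-1%g)|/H //]; rewrite conjgK.
Qed.

Lemma derC g h : ((g * h)%g \in der) = ((h * g)%g \in der).
Proof. by rewrite -(derJ (g * h) g) conjgE !mulgA mulVg mul1g. Qed.

Definition vec3 (x y z : F) : 'rV[F]_3 := \row_(j < 3) [:: x; y; z]`_j.

Lemma vec3_ex (v : 'rV[F]_3) : exists x y z, v = vec3 x y z.
Proof.
exists (v 0 0), (v 0 1), (v 0 2%:R); apply/rowP => j; rewrite !mxE.
by case: j => -[|[|[|//]]] h /=; congr (v 0 _); apply: val_inj.
Qed.

Lemma vec3_inj x y z x' y' z' : vec3 x y z = vec3 x' y' z' -> [/\ x = x', y = y' & z = z'].
Proof.
move/rowP => h; move: (h 0) (h 1) (h 2%:R).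
by rewrite !mxE.
Qed.

Lemma scale_vec3 c x y z : c *: vec3 x y z = vec3 (c * x) (c * y) (c * z).
Proof. by apply/rowP => j; rewrite !mxE; case: j => -[|[|[|//]]]. Qed.

Lemma vec3_neq0 x y z : vec3 x y z != 0 -> [|| x != 0, y != 0 | z != 0].
Proof.
apply: contraR; rewrite !negb_or !negbK => /and3P[/eqP-> /eqP-> /eqP->].
by apply/eqP/rowP => j; rewrite !mxE; case: j => -[|[|[|//]]].
Qed.

Lemma row3E (u v w : 'rV[F]_3) : row3 u v w = \matrix_(i, j) (nth 0 [:: u; v; w] i) 0 j.
Proof.
apply/matrixP => i j; rewrite !mxE; case: splitP => k ek; rewrite ?mxE ek.
  by rewrite (ord1 k).
by case: splitP => k' ek' /=; rewrite (ord1 k') in ek' *; rewrite ek'.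
Qed.

Lemma mulmx_row3 x y z (u v w : 'rV[F]_3) :
  vec3 x y z *m row3 u v w = x *: u + y *: v + z *: w.
Proof.
apply/rowP => j; rewrite !mxE row3E !big_ord_recl big_ord0 !mxE /= addr0 addrA.
by [].
Qed.

Lemma det_row3 (a b c d e f g h i : F) :
  \det (row3 (vec3 a b c) (vec3 d e f) (vec3 g h i)) =
  a * (e * i - f * h) - b * (d * i - f * g) + c * (d * h - e * g).
Proof.
rewrite row3E (expand_det_row _ 0) !big_ord_recl big_ord0 /cofactor.
rewrite !(expand_det_row _ 0) !big_ord_recl !big_ord0 /cofactor !det_mx11 !mxE /=.
by rewrite /bump /= !expr0 !expr1 ; ring.
Qed.

Lemma add_vec3 x y z x' y' z' : vec3 x y z + vec3 x' y' z' = vec3 (x + x') (y + y') (z + z').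
Proof. by apply/rowP => j; rewrite !mxE; case: j => -[|[|[|//]]]. Qed.

Lemma conj_noeig g (M C : 'M[F]_3) : M \in unitmx -> M *m GLval g = C *m M ->
  (g \in der) <-> (forall x y z c, [|| x != 0, y != 0 | z != 0] -> vec3 x y z *m C <> c *: vec3 x y z).
Proof.
move=> U e; split.
  move/derP => h x y z c v0 ec; apply: (h (vec3 x y z *m M) c).
    apply: contraTneq v0 => /(congr1 (mulmx^~ (invmx M))); rewrite mulmxK // mul0mx => e0.
    have := e0; rewrite (_ : 0 = vec3 0 0 0); last first.
      by apply/rowP => j; rewrite !mxE; case: j => -[|[|[|//]]].
    by case/vec3_inj => -> -> ->; rewrite !eqxx.
  by rewrite -mulmxA e mulmxA ec -scalemxAl.
move=> h; apply/derP => v c v0 ec.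
have [x [y [z ev]]] := vec3_ex (v *m invmx M).
have ev' : v = vec3 x y z *m M by rewrite -ev mulmxKV.
apply: (h x y z c).
  by apply: vec3_neq0; apply: contraNneq v0 => e0; rewrite ev' e0 mul0mx.
apply: (can_inj (mulmxK U)); rewrite -mulmxA -e mulmxA -ev' ec -scalemxAl -ev' //.
Qed.

Definition companion (d : F) (bc : F * F) : 'M[F]_3 :=
  row3 (vec3 0 1 0) (vec3 0 0 1) (vec3 d bc.1 bc.2).

Lemma det_companion d bc : \det (companion d bc) = d.
Proof. by rewrite det_row3; ring. Qed.

Lemma companion_noeig d bc : d != 0 ->
  (forall x y z c, [|| x != 0, y != 0 | z != 0] -> vec3 x y z *m companion d bc <> c *: vec3 x y z)
  <-> [forall l, ~~ cubic_root d bc l].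
Proof.
case: bc => b c d0; rewrite /companion /=.
have E x y z : vec3 x y z *m row3 (vec3 0 1 0) (vec3 0 0 1) (vec3 d b c)
   = vec3 (z * d) (x + z * b) (y + z * c).
  by rewrite mulmx_row3 !scale_vec3 !add_vec3 !(mulr0, mulr1, addr0, add0r).
split=> [h|/forallP h x y z l v0].
  apply/forallP => l; apply/negP => /eqP /= hl.
  (* With last coordinate 1 the eigenvector equations determine the other coordinates from the last
     one backwards; they are the coefficients of the cubic divided by X - l. *)
  apply: (h (l ^+ 2 - c * l - b) (l - c) 1 l); first by rewrite oner_neq0 !orbT.
  rewrite E scale_vec3; congr vec3; [|ring|ring].
  by rewrite mul1r; transitivity (l ^+ 3 - c * l ^+ 2 - b * l); [rewrite hl|]; ring.
rewrite E scale_vec3 => /vec3_inj[e1 e2 e3].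
have [z0|z0] := eqVneq z 0.
  move: e1 e2 e3; rewrite z0 !(mul0r, mulr0, addr0) => e1 ex ey.
  by move: v0; rewrite ex ey z0 mulr0 eqxx.
case/negP: (h l); apply/eqP => /=; apply: (mulfI z0).
have ey : y = l * z - z * c by rewrite -e3; ring.
have ex : x = l * y - z * b by rewrite -e2; ring.
have : z * d = l * (l * (l * z - z * c) - z * b) by rewrite e1 ex ey.
move=> e4; have -> : z * (c * l ^+ 2 + b * l + d) = z * d + z * (c * l ^+ 2 + b * l) by ring.
by rewrite e4; ring.
Qed.

Lemma in_homol l (u v : 'rV[F]_3) t : (val l :=: u + v)%MS ->
  (t \in homol l) = (u *m GLval t == u) && (v *m GLval t == v).
Proof.
have h m (A : 'M[F]_(m, 3)) : (A *m GLval t == A) = (A <= kermx (GLval t - 1%:M))%MS.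
  by rewrite (sameP sub_kermxP eqP) mulmxBr mulmx1 subr_eq0.
by move=> e; rewrite inE !h e addsmx_sub.
Qed.

Lemma homol_fix l t (v : 'rV[F]_3) : t \in homol l -> (v <= val l)%MS -> v *m GLval t = v.
Proof. by rewrite inE => /eqP e /submxP[x ->]; rewrite -mulmxA e. Qed.

Lemma homol_line l t : t \in homol l -> l *^ t = l.
Proof.
by move=> tH; apply: subsp_inj; rewrite val_subact; move: tH; rewrite inE => /eqP ->.
Qed.

Lemma homol_point l t p : t \in homol l -> on p l -> p *^ t = p.
Proof.
move=> tH pl; have [v v0 ev] := vec_of p; apply: (subact_vec ev).
by rewrite (homol_fix tH) // -ev.
Qed.

(** Let o be the meet of l and its image. The vector v spans the preimage of o, which lies on l and
    differs from o since A fixes no point of l. If vA^2 were on l, the image of o would be on l and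
    on the image of l, hence equal to o. *)
Lemma generic_frame l A : generic l A -> exists v : 'rV[F]_3,
  (val l :=: v + v *m GLval A)%MS /\ row3 v (v *m GLval A) (v *m GLval A *m GLval A) \in unitmx.
Proof.
case/andP => lA /forallP gA; have [o [ol olA _]] := line_meet lA.
have om : o *^ A != o by have := gA o; rewrite olA.
have ol' : on (o *^ A^-1%g) l by rewrite -on_actV.
have [v v0 ev] := vec_of (o *^ A^-1%g).
have eo : (val o :=: v *m GLval A)%MS.
  by rewrite -[in X in (X :=: _)%MS](subactKV o A); apply: eqmx_trans (val_subact _ _) (eqmxMr _ ev).
have r2 : \rank (v + v *m GLval A)%MS = 2.
  apply: rank2_vec ev eo; apply: contra om => /eqP e.
  by rewrite -{1}e subactKV.
exists v; have el : (val l :=: v + v *m GLval A)%MS.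
  by apply: line_sub_eq => //; rewrite addsmx_sub -ev -eo; apply/andP.
split => //; apply: row3_unit_ext => //; rewrite -el; apply: contra om => h.
have [p0 [_ _ up0]] := line_meet lA.
have h1 : on (o *^ A) l by rewrite /on val_subact (eqmxMr _ eo).
have h2 : on (o *^ A) (l *^ A) by rewrite on_act.
by rewrite (up0 _ h2 h1) (up0 _ ol olA).
Qed.

(* In a basis [v, vA, vA^2] with [v] and [vA] spanning l, the products [tA] with t
   fixing l vectorwise are the companion matrices; their eigenvalues are roots
   of cubics, which [cubic_count] enumerates. *)
Lemma homol_param l A c : generic l A -> c != 0 -> exists phi : F * F -> gT,
  (forall t, ind ((t \in homol l) && (\det (GLval t) == c)) = \sum_bc ind (t == phi bc)) /\
  (forall bc, ((phi bc * A)%g \in der) = [forall x, ~~ cubic_root (c * \det (GLval A)) bc x]).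
Proof.
move=> gA c0; have [v [el UM]] := generic_frame gA.
set M := row3 _ _ _ in UM; set d := c * \det (GLval A).
have dA : \det (GLval A) != 0 by rewrite -unitfE -unitmxE GL_unitmx.
have d0 : d != 0 by rewrite mulf_neq0.
have UA := GL_unitmx A.
have Uphi bc : invmx M *m companion d bc *m M *m invmx (GLval A) \in unitmx.
  by rewrite !unitmx_mul !unitmx_inv UM UA andbT /= andbT unitmxE det_companion unitfE.
pose phi bc := sval (GL_of (Uphi bc)).
have ephi bc : GLval (phi bc) = invmx M *m companion d bc *m M *m invmx (GLval A).
  exact: svalP (GL_of (Uphi bc)).
have ephiA bc : M *m GLval (phi bc * A)%g = companion d bc *m M.
  by rewrite GL_MxE ephi mulmxKV // -!mulmxA mulKVmx.
have inj bc bc' : phi bc = phi bc' -> bc = bc'.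
  move=> e; have := ephiA bc; rewrite e ephiA => /(can_inj (mulmxK UM)).
  case/row3_inj => _ _ /vec3_inj[_]; case: bc {e} => b1 c1; case: bc' => b2 c2 /=.
  by move=> -> ->.
exists phi; split; last first.
  move=> bc; apply/idP/idP => h.
    by apply/(companion_noeig bc d0); apply/(conj_noeig UM (ephiA bc)).
  by apply/(conj_noeig UM (ephiA bc)); apply/(companion_noeig bc d0).
move=> t; have [/existsP[bc /eqP ->]|/existsPn h] := boolP [exists bc, t == phi bc].
  rewrite (bigD1 bc) //= eqxx big1 ?addr0 => [|bc' nbc]; last first.
    by case: eqP => // /inj e; rewrite e eqxx in nbc.
  have := ephiA bc; rewrite /M GL_MxE mulmxA row3_mul row3_mul /companion row3_mul.
  rewrite !mulmx_row3 !(scale0r, scale1r, addr0, add0r) => /row3_inj[e1 e2 _].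
  rewrite (in_homol _ el) (can_inj (mulmxK UA) e1) (can_inj (mulmxK UA) e2) !eqxx /=.
  rewrite ephi !det_mulmx !det_inv det_companion /d.
  have M0 : \det M != 0 by rewrite -unitfE -unitmxE.
  have -> : (\det M)^-1 * (c * \det (GLval A)) * \det M / \det (GLval A) = c.
    by field; rewrite dA M0.
  by rewrite eqxx.
rewrite big1 => [|bc _]; last by rewrite (negPf (h bc)).
case: andP => // -[tH /eqP tc].
pose x := v *m GLval A *m GLval A *m GLval t *m GLval A *m invmx M.
have [x0 [y0 [z0 ex]]] := vec3_ex x.
have eC : M *m GLval (t * A)%g = row3 (vec3 0 1 0) (vec3 0 0 1) x *m M.
  rewrite GL_MxE mulmxA /M !row3_mul -/M /x mulmxKV // !mulmx_row3.
  rewrite !(scale0r, scale1r, addr0, add0r).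
  have h1 : v *m GLval t = v by apply: (homol_fix tH); rewrite el addsmxSl.
  have h2 : v *m GLval A *m GLval t = v *m GLval A by apply: (homol_fix tH); rewrite el addsmxSr.
  by rewrite h1 h2.
have x0d : x0 = d.
  have := congr1 determinant eC; rewrite GL_MxE !det_mulmx ex det_row3 tc -/d.
  have M0 : \det M != 0 by rewrite -unitfE -unitmxE.
  rewrite mulrC => /(mulIf M0) ->; ring.
case/eqP: (h (y0, z0)); apply: val_inj.
apply: (can_inj (mulmxK UA)); apply: (can_inj (mulKmx UM)).
have := ephiA (y0, z0); rewrite GL_MxE => ->; move: eC; rewrite GL_MxE => ->.
by rewrite ex x0d.
Qed.

Lemma homol_der l A c : c != 0 ->
  3 * \sum_(t : gT) ind ((t \in homol l) && (\det (GLval t) == c)) * ind ((t * A)%g \in der)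
  = ind (generic l A) * (n - ncbrt (c * \det (GLval A))).
Proof.
move=> c0; have dA : \det (GLval A) != 0 by rewrite -unitfE -unitmxE GL_unitmx.
have [gA|gA] := boolP (generic l A).
  have [phi [e1 e2]] := homol_param gA c0.
  rewrite mul1r -cubic_count ?mulf_neq0 //; congr (_ * _).
  under eq_bigr do rewrite e1 mulr_suml; rewrite exchange_big; apply: eq_bigr => bc _ /=.
  by rewrite sum_ind_eq e2.
(* If g is not generic, then l itself or a point of l is fixed by A, hence by every tA, and no tA is
   a derangement. *)
rewrite mul0r big1 ?mulr0 // => t _; case: andP => [[tH _]|]; last by rewrite mul0r.
rewrite mul1r; case: (boolP (_ \in der)) => // tA; case/negP: gA.
apply/andP; split; last first.
  apply/forallP => p; apply/implyP => pl; move: tA; rewrite inE => /forallP/(_ p).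
  by rewrite subact_mul (homol_point tH pl).
by have := der_no_line l tA; rewrite subact_mul (homol_line tH).
Qed.

Lemma on_ex l : exists a, on a l.
Proof.
apply/existsP; apply: contraT; rewrite negb_exists => /forallP h; exfalso.
have := sum_on_line l; rewrite big1 => [|p _]; last by rewrite (negPf (h p)).
by have := q_gt1 F; rewrite -/q; lra.
Qed.

Lemma line_frame l : exists u v w : 'rV[F]_3, (val l :=: u + v)%MS /\ row3 u v w \in unitmx.
Proof.
have [a al] := on_ex l.
have [b /andP[bl ba]] : exists b : pt, on b l && (b != a).
  apply/existsP; apply: contraT; rewrite negb_exists => /forallP h; exfalso.
  have : \sum_b ind (b != a) * ind (on b l) = 0.
    by rewrite big1 // => b _; rewrite -indM andbC (negPf (h b)).
  by rewrite sum_neq sum_on_line al; have := q_gt1 F; rewrite -/q /=; lra.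
have [u u0 eu] := vec_of a; have [v v0 ev] := vec_of b.
have r2 : \rank (u + v)%MS = 2 by apply: rank2_vec eu ev; rewrite eq_sym.
have [w W] := frame_ext r2; exists u, v, w; split => //.
by apply: line_sub_eq => //; rewrite addsmx_sub -eu -ev; apply/andP.
Qed.

(** A cyclic permutation of a basis whose first two vectors span l is an example. Such an element is
    wanted only as a base point for parametrizing [homol l]. *)
Lemma generic_ex l : exists g, generic l g.
Proof.
have [u [v [w [el UM]]]] := line_frame l.
have U1 : companion 1 (0, 0) \in unitmx by rewrite unitmxE det_companion unitr1.
have Ug : invmx (row3 u v w) *m companion 1 (0, 0) *m row3 u v w \in unitmx.
  by rewrite !unitmx_mul unitmx_inv UM U1.
have [g eg] := GL_of Ug; exists g.
have eM : row3 u v w *m GLval g = companion 1 (0, 0) *m row3 u v w.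
  by rewrite eg -!mulmxA mulKVmx.
have vg x y z : vec3 x y z *m row3 u v w *m GLval g = vec3 z x y *m row3 u v w.
  rewrite -mulmxA eM mulmxA; congr (_ *m _).
  by rewrite /companion mulmx_row3 !scale_vec3 !add_vec3 !(mulr0, mulr1, addr0, add0r).
have inl (x : 'rV[F]_3) : (x <= u + v)%MS -> exists y z : F, x = vec3 y z 0 *m row3 u v w.
  move=> /sub_addsmxP[[a b] /= ->].
  exists (a 0 0), (b 0 0); rewrite mulmx_row3 scale0r addr0.
  by rewrite [a in LHS]mx11_scalar [b in LHS]mx11_scalar !mul_scalar_mx.
have ri := can_inj (mulmxK UM).
apply/andP; split.
  rewrite subact_eqE (eqmxMr _ el) el addsmxMr addsmx_sub negb_and; apply/orP; right.
  have evg : v *m GLval g = w.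
    by have := vg 0 1 0; rewrite !mulmx_row3 !(scale0r, scale1r, addr0, add0r).
  have ew : w = vec3 0 0 1 *m row3 u v w by rewrite mulmx_row3 !scale0r scale1r !add0r.
  apply/negP; rewrite evg => /inl[y [z]]; rewrite {1}ew => /ri /vec3_inj[_ _].
  by move/eqP; rewrite oner_eq0.
apply/forallP => p; apply/implyP => pl; have [x x0 ex] := vec_of p.
apply/negP => /(fixes_vec _ ex)[c].
have [|y [z exv]] := inl x; first by rewrite -el -ex.
rewrite exv vg scalemxAl => /ri; rewrite scale_vec3 mulr0 => /vec3_inj[e1 e2 e3].
move: x0; rewrite exv e2 e3 mulr0.
by rewrite mulmx_row3 !scale0r !addr0 eqxx.
Qed.

Lemma sum_homol_det l c : c != 0 ->
  \sum_(t : gT) ind ((t \in homol l) && (\det (GLval t) == c)) = q ^+ 2.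
Proof.
move=> c0; have [A gA] := generic_ex l; have [phi [e1 _]] := homol_param gA c0.
rewrite (eq_bigr _ (fun t _ => e1 t)) exchange_big /= (eq_bigr (fun=> 1)) => [|bc _].
  by rewrite sum_const_rat card_prod natrM -/q; ring.
by rewrite sum_ind1.
Qed.

Lemma sum_det (t : gT) (h : F -> rat) :
  \sum_(c | c != 0) ind (\det (GLval t) == c) * h c = h (\det (GLval t)).
Proof.
have dA : \det (GLval t) != 0 by rewrite -unitfE -unitmxE GL_unitmx.
rewrite (bigD1 (\det (GLval t))) //= eqxx mul1r big1 ?addr0 // => c /andP[_ ct].
by rewrite eq_sym (negPf ct) mul0r.
Qed.

Lemma sum_homol l : \sum_(t : gT) ind (t \in homol l) = q ^+ 2 * (q - 1).
Proof.
rewrite (eq_bigr (fun t => \sum_(c : F | c != 0) ind ((t \in homol l) && (\det (GLval t) == c)))).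
  rewrite exchange_big /= (eq_bigr (fun=> q ^+ 2 * 1)) => [|c c0]; last by rewrite mulr1 sum_homol_det.
  rewrite -mulr_sumr -[q - 1](sum_nz F) [in LHS]big_mkcond; congr (_ * _).
  by apply: eq_bigr => c _; case: (c != 0).
move=> t _; rewrite -[LHS](sum_det t (fun=> ind (t \in homol l))).
by apply: eq_bigr => c _; rewrite indM mulrC.
Qed.

End Homologies.

(** * Counting elements that stabilize a line *)

Section Averages.
Variable F : finFieldType.
Local Notation gT := {'GL_3[F]}.
Local Notation pt := (PGpoint F).
Local Notation ln := (PGline F).
Local Notation der := (der F).
Implicit Types (p a b : pt) (l : ln) (g s x : gT).
Let q : rat := #|F|%:R.
Let n : rat := q ^+ 2 + q + 1.

(* The order of the stabilizer in [GL_3(q)] of a point, or of a line. *)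
Definition line_order : rat := q ^+ 3 * (q - 1) ^+ 3 * (q + 1).
Let L := line_order.
Let c2 : rat := q ^+ 2 * (q - 1) ^+ 3.

Lemma n_neq0 : n != 0.
Proof. by rewrite /n; have := q_gt1 F; rewrite -/q => h; rewrite gt_eqF //; nra. Qed.

Lemma n1_neq0 : n - 1 != 0.
Proof. by rewrite /n; have := q_gt1 F; rewrite -/q => h; rewrite gt_eqF //; nra. Qed.

Lemma line_order_neq0 : L != 0.
Proof.
have h := q_gt1 F; rewrite /L /line_order !mulf_neq0 ?expf_neq0 ?q_neq0 ?q1_neq0 //.
by rewrite -/q in h; rewrite gt_eqF //; lra.
Qed.

Lemma gG_line : gG F = n * L.
Proof. rewrite gG_val -/q /L /line_order /n; ring. Qed.

Lemma map1 a b : \sum_g ind (a *^ g == b) = L.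
Proof.
apply: (mulIf n_neq0); rewrite sum_map1 gG_line; ring.
Qed.

Lemma map2 a b a' b' : a != b -> a' != b' ->
  \sum_g ind (a *^ g == a') * ind (b *^ g == b') = c2.
Proof.
move=> h h'; apply: (mulIf n_neq0); apply: (mulIf n1_neq0).
rewrite -mulrA sum_map2 // gG_line /L /line_order /c2 /n; ring.
Qed.

Lemma map3 a b p l a' b' p' l' :
  a != b -> p != a -> p != b -> on a l -> on b l -> on p l ->
  a' != b' -> p' != a' -> p' != b' -> on a' l' -> on b' l' -> on p' l' ->
  \sum_g ind (a *^ g == a') * ind (b *^ g == b') * ind (p *^ g == p') = q ^+ 2 * (q - 1) ^+ 2.
Proof.
move=> *; apply: (mulIf (q1_neq0 F)); apply: (mulIf n_neq0); apply: (mulIf n1_neq0).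
transitivity (gG F); last by rewrite gG_line /L /line_order /n; ring.
rewrite -(@sum_map3 _ a b p l a' b' p' l') // -/q -/n; ring.
Qed.

Definition fixl l g : rat := \sum_p ind (on p l) * ind (p *^ g == p).

Definition stabl l g : rat := ind (l *^ g == l).

Lemma other_on l o : on o l -> exists2 p, on p l & p != o.
Proof.
move=> ol; suff /existsP[p /andP[]] : [exists p, on p l && (p != o)] by exists p.
apply: contraT; rewrite negb_exists => /forallP h; exfalso.
have : \sum_b ind (b != o) * ind (on b l) = 0.
  by rewrite big1 // => b _; rewrite -indM andbC (negPf (h b)).
by rewrite sum_neq sum_on_line ol; have := q_gt1 F; rewrite -/q /=; lra.
Qed.

Lemma stabl_on l g p : l *^ g = l -> on (p *^ g) l = on p l.
Proof. by move=> h; rewrite -{1}h on_act. Qed.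

Lemma two_points_line l l' a b : a != b -> on a l -> on b l -> on a l' -> on b l' -> l = l'.
Proof.
by move=> ab h1 h2 h3 h4; have [l0 [_ _ u]] := line_through ab; rewrite (u l) // (u l').
Qed.

Lemma map2_stab l a b a' b' : a != b -> a' != b' -> on a l -> on b l -> on a' l -> on b' l ->
  \sum_g stabl l g * (ind (a *^ g == a') * ind (b *^ g == b')) = c2.
Proof.
move=> ab ab' al bl al' bl'; rewrite -(map2 ab ab'); apply: eq_bigr => g _.
rewrite -!indM; congr ((_ : bool)%:R); apply: andb_idl => /andP[/eqP e1 /eqP e2].
apply/eqP; apply: (@two_points_line _ _ a' b') => //; first by rewrite -e1 on_act.
by rewrite -e2 on_act.
Qed.

Lemma map1_stab l o o' : on o l -> on o' l -> \sum_g stabl l g * ind (o *^ g == o') = q * c2.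
Proof.
move=> ol ol'; have [p pl po] := other_on ol.
rewrite (eq_bigr (fun g => \sum_p' ind (p' != o') *
  (ind (on p' l) * (stabl l g * (ind (o *^ g == o') * ind (p *^ g == p')))))); last first.
  move=> g _; rewrite /stabl; case: eqVneq => [lg|]; last first.
    by rewrite mul0r big1 // => i _; rewrite !(mul0r, mulr0).
  case: eqVneq => [og|]; last by rewrite mulr0 big1 // => i _; rewrite !(mul0r, mulr0).
  rewrite (bigD1 (p *^ g)) //= eqxx stabl_on // pl -og (inj_eq (@subact_inj _ _ g)) po.
  rewrite big1 => [|i ip]; first by rewrite /=; ring.
  by rewrite [_ == i]eq_sym (negPf ip) !mulr0.
rewrite exchange_big /= (eq_bigr (fun p' => ind (p' != o') * (ind (on p' l) * c2))); last first.
  move=> p' _; rewrite -!mulr_sumr; have [->|po'] := eqVneq p' o'; first by rewrite !mul0r.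
  by case: (boolP (on p' l)) => p'l; rewrite ?mul0r // map2_stab // eq_sym.
rewrite sum_neq -mulr_suml sum_on_line ol' -/q /=; ring.
Qed.

Lemma sum_stabl l : \sum_g stabl l g = L.
Proof.
have [o ol] := on_ex l.
rewrite (eq_bigr (fun g => \sum_o' ind (on o' l) * (stabl l g * ind (o *^ g == o')))).
  rewrite exchange_big /= (eq_bigr (fun o' => ind (on o' l) * (q * c2))).
    by rewrite -mulr_suml sum_on_line -/q /c2 /L /line_order; ring.
  by move=> o' _; rewrite -mulr_sumr; case: (boolP (on o' l)) => h; rewrite ?mul0r // map1_stab.
move=> g _; rewrite /stabl; case: eqVneq => [lg|_]; last by rewrite big1 // => i _; rewrite !(mul0r, mulr0).
rewrite (bigD1 (o *^ g)) //= eqxx stabl_on // ol big1 ?addr0 // => i ip.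
by rewrite [_ == i]eq_sym (negPf ip) !mulr0.
Qed.

(** For o = o' the point o contributes q c2 and each of the q other points of l contributes c2. For
    o and o' distinct neither can be fixed, which leaves q - 1 points with c2 each. *)
Lemma map1_stab_fix l o o' : on o l -> on o' l ->
  \sum_g stabl l g * fixl l g * ind (o *^ g == o') = if o == o' then 2 * q * c2 else (q - 1) * c2.
Proof.
move=> ol ol'; rewrite /fixl.
rewrite (eq_bigr (fun g => \sum_p ind (on p l) * (stabl l g * (ind (p *^ g == p) * ind (o *^ g == o'))))).
  rewrite exchange_big /=.
  rewrite (eq_bigr (fun p => ind (p == o) * (ind (o == o') * (q * c2)) +
     ind (p != o) * (ind (p != o') * (ind (on p l) * c2)))).
    rewrite big_split /= sum_ind_eq sum_neq sum_neq ol.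
    rewrite -mulr_suml sum_on_line ol' -/q; case: (o == o') => /=; ring.
  move=> p _; rewrite -mulr_sumr; have [->|po] := eqVneq p o.
    rewrite ol mul0r addr0 !mul1r.
    have [e|no] := eqVneq o o'.
      rewrite -e mul1r -(map1_stab ol ol); apply: eq_bigr => g _.
      by case: (o *^ g == o); rewrite ?mulr1 ?mulr0.
    rewrite mul0r big1 // => g _; rewrite -indM; case: andP => [[/eqP-> /eqP e]|]; last by rewrite mulr0.
    by rewrite e eqxx in no.
  rewrite mul0r add0r mul1r; case: (boolP (on p l)) => pl; last by rewrite !(mul0r, mulr0).
  rewrite !mul1r; have [e|no] := eqVneq p o'; last by rewrite mul1r map2_stab.
  rewrite mul0r big1 // => g _; rewrite -indM; case: andP => [[/eqP h /eqP e']|]; last by rewrite mulr0.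
  by case/eqP: po; apply: (@subact_inj _ _ g); rewrite h e' e.
move=> g _; rewrite mulrC mulrA [ind _ * stabl l g]mulrC mulr_sumr; apply: eq_bigr => p _; ring.
Qed.

Lemma sum_stab_fix l : \sum_g stabl l g * fixl l g = L.
Proof.
rewrite /fixl (eq_bigr (fun g => \sum_p ind (on p l) * (stabl l g * ind (p *^ g == p)))).
  rewrite exchange_big /= (eq_bigr (fun p => ind (on p l) * (q * c2))).
    by rewrite -mulr_suml sum_on_line -/q /c2 /L /line_order; ring.
  by move=> p _; rewrite -mulr_sumr; case: (boolP (on p l)) => h; rewrite ?mul0r // map1_stab.
by move=> g _; rewrite mulr_sumr; apply: eq_bigr => p _; ring.
Qed.

(* A non-fixed line contains at most one fixed point. *)
Lemma genericE l g : ind (generic l g) = ind (l *^ g != l) * (1 - fixl l g).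
Proof.
rewrite /generic; case: (boolP (l *^ g != l)) => lg; last by rewrite mul0r.
rewrite mul1r /fixl /=; case: forallP => h.
  rewrite big1 ?subr0 // => p _; have := h p; case: (on p l); rewrite ?mul0r //= => /negPf ->.
  by rewrite mulr0.
have /existsP[p0 /andP[pl /eqP pg]] : [exists p, on p l && (p *^ g == p)].
  apply: contraT; rewrite negb_exists => /forallP h'; case: h => p; apply/implyP => pl.
  by have := h' p; rewrite pl.
rewrite (bigD1 p0) //= pl pg eqxx big1 ?mulr1 ?addr0 ?subrr // => p pp.
rewrite -indM; case: andP => // -[pl' /eqP pg']; case/eqP: lg.
by apply: (@two_points_line _ _ p p0) => //; [rewrite -pg' on_act|rewrite -pg on_act].
Qed.

Section Generic.
Variables (l : ln) (h : gT -> rat) (Qd Qn : rat).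
Hypothesis h_stab : forall x, l *^ x != l -> h x = 0.
Hypothesis h_map : forall o o', on o l -> on o' l ->
  \sum_x h x * ind (o *^ x == o') = if o == o' then Qd else Qn.

(** If x stabilizes l and s moves it, a point of l fixed by x s lies on both l and its image under
    s, so it is their meet o. Hence x s fails to be generic exactly if x maps o to its preimage
    under s, which [h_map] counts; the preimage is o itself iff s fixes a point of l. *)
Lemma sum_generic s :
  \sum_x h x * ind (generic l (x * s)%g) =
  ind (l *^ s != l) * (\sum_x h x - Qn - fixl l s * (Qd - Qn)).
Proof.
rewrite (eq_bigr (fun x => ind (l *^ s != l) * (h x - \sum_p ind (on p l) *
   (h x * ind (p *^ x == p *^ s^-1%g))))); last first.
  move=> x _; rewrite genericE subact_mul; have [lx|/h_stab->] := eqVneq (l *^ x) l; last first.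
    by rewrite big1 ?mul0r ?subr0 ?mulr0 // => p _; rewrite !(mul0r,mulr0).
  rewrite lx mulrCA; congr (_ * _); rewrite mulrBr mulr1 /fixl mulr_sumr; congr (_ - _).
  by apply: eq_bigr => p _; rewrite subact_mul subact_eqV; ring.
rewrite -mulr_sumr; case: eqVneq => ls; rewrite ?mul0r // !mul1r.
rewrite sumrB -addrA; congr (_ + _); rewrite exchange_big /=.
have ls' : l != l *^ s by rewrite eq_sym.
have [o [ol ols uo]] := line_meet ls'.
rewrite (bigD1 o) //= ol [X in _ + X]big1; last first.
  move=> p po; case: (boolP (on p l)) => pl; last by rewrite big1 // => x _; rewrite !mul0r.
  rewrite big1 // => x _; rewrite mul1r.
  have [lx|/h_stab->] := eqVneq (l *^ x) l; last by rewrite mul0r.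
  case: eqP => [e|]; last by rewrite mulr0.
  by case/eqP: po; apply: uo => //; rewrite on_actV -e stabl_on.
rewrite addr0 -mulr_sumr mul1r h_map -?on_actV //.
have -> : fixl l s = ind (o == o *^ s^-1%g).
  rewrite /fixl (bigD1 o) //= ol mul1r subact_eqV big1 ?addr0 // => p po.
  rewrite -indM; case: andP => // -[pl /eqP ps]; case/eqP: po; apply: uo => //.
  by rewrite -ps on_act.
by case: (o == _) => /=; ring.
Qed.

End Generic.

End Averages.

(** * Test functions and averages over homologies *)

Section TestFunctions.
Variable F : finFieldType.
Local Notation gT := {'GL_3[F]}.
Local Notation pt := (PGpoint F).
Local Notation ln := (PGline F).
Local Notation der := (der F).
Implicit Types (p a b : pt) (l : ln) (g s x t : gT).
Let q : rat := #|F|%:R.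
Let n : rat := q ^+ 2 + q + 1.
Let L := line_order F.
Let c2 : rat := q ^+ 2 * (q - 1) ^+ 3.

Lemma ncbrtE (d : F) : ncbrt d = \sum_(z : F) ind (z ^+ 3 == d).
Proof. by rewrite /ncbrt natr_card; apply: eq_bigr => z _; rewrite inE. Qed.

(** Each nonzero z is a cube root of c b for exactly one c, so [ncbrt] has mean 1 over the nonzero
    elements. *)
Lemma sum_ncbrt (b : F) : b != 0 -> \sum_(c : F | c != 0) ncbrt (c * b) = q - 1.
Proof.
move=> b0; under eq_bigr do rewrite ncbrtE; rewrite exchange_big /= -sum_nz.
apply: eq_bigr => z _; have [->|z0] := eqVneq z 0.
  by rewrite big1 // => c c0; rewrite expr0n /= eq_sym mulf_eq0 (negPf c0) (negPf b0).
rewrite (bigD1 (z ^+ 3 / b)) /=; last by rewrite mulf_neq0 ?invr_neq0 ?expf_neq0.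
rewrite divfK // eqxx big1 ?addr0 // => c /andP[c0 cz]; case: eqP => // e.
by rewrite e mulfK // eqxx in cz.
Qed.

Lemma ncbrt_cube (c d : F) : c != 0 -> ncbrt (c ^+ 3 * d) = ncbrt d.
Proof.
move=> c0; rewrite !ncbrtE (reindex_inj (mulfI c0)); apply: eq_bigr => z _.
by rewrite exprMn (inj_eq (mulfI (expf_neq0 3 c0))).
Qed.

(** Up to a factor, [ncbrt] is idempotent for multiplicative convolution: writing c = z^3, the cube
    drops out of the second factor. *)
Lemma sum_ncbrt2 (b : F) : b != 0 -> \sum_(c : F | c != 0) ncbrt c * ncbrt (c * b) = (q - 1) * ncbrt b.
Proof.
move=> b0; rewrite -sum_nz mulr_suml.
rewrite (eq_bigr (fun c => \sum_(z : F) ind (z ^+ 3 == c) * ncbrt (c * b))); last first.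
  by move=> c _; rewrite [X in X * _]ncbrtE mulr_suml.
rewrite exchange_big; apply: eq_bigr => z _ /=; have [->|z0] := eqVneq z 0.
  by rewrite mul0r big1 // => c c0; rewrite expr0n /= eq_sym (negPf c0) mul0r.
rewrite (bigD1 (z ^+ 3)) ?expf_neq0 //= eqxx ncbrt_cube // big1 ?addr0 // => c /andP[c0 cz].
by rewrite eq_sym (negPf cz) mul0r.
Qed.

(* The property of the weights [eta = 1] and [eta = ncbrt] that makes averaging
   over the homologies with a given axis computable. *)
Definition balanced (eta : F -> rat) : Prop := forall b : F, b != 0 ->
  \sum_(c | c != 0) eta c * (n - ncbrt (c * b)) = (q - 1) * (n - eta b).

Lemma sum_nz_const (c : rat) : \sum_(z : F | z != 0) c = (q - 1) * c.
Proof. by rewrite -sum_nz mulr_suml big_mkcond; apply: eq_bigr => z _; case: (z != 0); rewrite ?mul1r ?mul0r. Qed.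

Lemma balanced_one : balanced (fun=> 1).
Proof.
move=> b b0; under eq_bigr do rewrite mul1r.
by rewrite sumrB sum_ncbrt // sum_nz_const; ring.
Qed.

Lemma balanced_ncbrt : balanced (@ncbrt F).
Proof.
move=> b b0; under eq_bigr do rewrite mulrBr.
rewrite sumrB sum_ncbrt2 // -mulr_suml.
rewrite (eq_bigr (fun c => ncbrt (c * 1))) => [|c _]; last by rewrite mulr1.
by rewrite sum_ncbrt ?oner_neq0 //; ring.
Qed.

Lemma detGL_neq0 g : \det (GLval g) != 0.
Proof. by rewrite -unitfE -unitmxE GL_unitmx. Qed.

Section Average.
Variables (l : ln) (eta : F -> rat) (h : gT -> rat).
Hypothesis eta_bal : balanced eta.
Hypothesis h_inv : forall t x, t \in homol l -> h (t * x)%g = h x.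

(** Replace x by t x and average over the q^2 (q - 1) elements t of [homol l]. This leaves h
    unchanged, lets the determinant run uniformly over the nonzero scalars, and [homol_der] counts
    the derangements for each determinant; [eta_bal] evaluates the remaining sum over
    determinants. *)
Lemma avg_homol s :
  3 * q ^+ 2 * \sum_x eta (\det (GLval x)) * h x * ind ((x * s)%g \in der) =
  (n - eta (\det (GLval s))) * \sum_x h x * ind (generic l (x * s)%g).
Proof.
apply: (mulIf (q1_neq0 F)); rewrite -/q.
set A := \sum_x _; transitivity (3 * (q ^+ 2 * (q - 1) * A)); first by ring.
rewrite {}/A -(sum_homol l) mulr_suml.
rewrite (eq_bigr (fun t => \sum_x h x * (eta (\det (GLval t) * \det (GLval x)) *
   ind (t \in homol l) * ind ((t * (x * s))%g \in der)))); last first.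
  move=> t _; case: (boolP (t \in homol l)) => tH; last first.
    by rewrite mul0r big1 // => x _; rewrite !(mul0r, mulr0).
  rewrite mul1r (reindex_inj (mulgI t)); apply: eq_bigr => x _.
  by rewrite h_inv // GL_MxE det_mulmx -mulgA (_ : ind true = 1) //; ring.
rewrite exchange_big [LHS]mulr_sumr [RHS]mulrAC [RHS]mulr_sumr; apply: eq_bigr => x _.
rewrite -mulr_sumr mulrCA [RHS]mulrCA; congr (_ * _).
set g := (x * s)%g; have x0 := detGL_neq0 x.
rewrite (eq_bigr (fun t => \sum_(c | c != 0) eta (c * \det (GLval x)) *
   (ind ((t \in homol l) && (\det (GLval t) == c)) * ind ((t * g)%g \in der)))); last first.
  move=> t _; rewrite -[LHS](sum_det t (fun c => eta (c * \det (GLval x)) * ind (t \in homol l) * ind ((t * g)%g \in der))).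
  by apply: eq_bigr => c _; rewrite indM; ring.
rewrite exchange_big mulr_sumr.
rewrite (eq_bigr (fun c => ind (generic l g) * (eta (c * \det (GLval x)) *
    (n - ncbrt (c * \det (GLval x) * \det (GLval s)))))); last first.
  move=> c c0; rewrite -mulr_sumr mulrCA homol_der // -/q -/n /g GL_MxE det_mulmx [c * (_ * _)]mulrA; ring.
rewrite -mulr_sumr [RHS]mulrC; congr (_ * _); rewrite [RHS]mulrC -eta_bal ?detGL_neq0 //.
rewrite [RHS](reindex_inj (mulIf x0)) /=; apply: eq_bigl => c.
by rewrite mulf_eq0 (negPf x0) orbF.
Qed.
End Average.

(** Variant for h invariant only under homologies of determinant 1. It serves the unipotent test
    function, whose support is cut out by a condition on the determinant. *)
Lemma avg_homol_det1 l (h : gT -> rat) s :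
  (forall t x, t \in homol l -> \det (GLval t) = 1 -> h (t * x)%g = h x) ->
  3 * q ^+ 2 * \sum_x h x * ind ((x * s)%g \in der) =
  \sum_x h x * ind (generic l (x * s)%g) * (n - ncbrt (\det (GLval x) * \det (GLval s))).
Proof.
move=> h_inv.
rewrite -mulrA -(sum_homol_det l (oner_neq0 F)) mulr_suml.
rewrite (eq_bigr (fun t => \sum_x h x * (ind ((t \in homol l) && (\det (GLval t) == 1)) *
   ind ((t * (x * s))%g \in der)))); last first.
  move=> t _; case: andP => [[tH /eqP t1]|_]; last first.
    by rewrite mul0r big1 // => x _; rewrite !(mul0r, mulr0).
  rewrite mul1r (reindex_inj (mulgI t)); apply: eq_bigr => x _.
  by rewrite h_inv // -mulgA (_ : ind true = 1) //; ring.
rewrite exchange_big mulr_sumr; apply: eq_bigr => x _.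
by rewrite -mulr_sumr mulrCA homol_der ?oner_neq0 // mul1r GL_MxE det_mulmx mulrA.
Qed.

Definition nflag g : rat := \sum_(l : ln) stabl l g * fixl l g.

Lemma sum_fixl g : \sum_l fixl l g = (q + 1) * nfix g.
Proof.
rewrite /fixl exchange_big /= /nfix mulr_sumr; apply: eq_bigr => p _.
by rewrite -mulr_suml sum_thru.
Qed.

Lemma sum_unfixed g : \sum_(l : ln) ind (l *^ g != l) = n - nfix g.
Proof.
under eq_bigr do rewrite indN.
by rewrite sumrB sum_const_rat card_ln mulr1 nfix_lines.
Qed.

Lemma sum_unfixed_fixl g : \sum_(l : ln) ind (l *^ g != l) * fixl l g = (q + 1) * nfix g - nflag g.
Proof.
under eq_bigr do rewrite indN mulrBl mul1r.
by rewrite sumrB sum_fixl.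
Qed.

Lemma stabl_homol l t x : t \in homol l -> stabl l (t * x)%g = stabl l x.
Proof. by move=> tH; rewrite /stabl subact_mul (homol_line tH). Qed.

Lemma fixl_homol l t x : t \in homol l -> fixl l (t * x)%g = fixl l x.
Proof.
move=> tH; apply: eq_bigr => p _; case: (boolP (on p l)) => pl; last by rewrite !mul0r.
by rewrite subact_mul (homol_point tH).
Qed.

Lemma stabl0 l x : l *^ x != l -> stabl l x = 0.
Proof. by rewrite /stabl => /negPf ->. Qed.

(** Fixed points are counted as fixed lines, because the summand belonging to l is then invariant
    under [homol l]. *)
Lemma test_nfix (eta : F -> rat) s : balanced eta ->
  3 * \sum_x eta (\det (GLval x)) * nfix x * ind ((x * s)%g \in der) =
  (n - eta (\det (GLval s))) * (n - nfix s) * c2.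
Proof.
move=> eb; have q20 : q ^+ 2 != 0 by rewrite expf_neq0 ?q_neq0.
apply: (mulfI q20).
rewrite (eq_bigr (fun x => \sum_l eta (\det (GLval x)) * stabl l x * ind ((x * s)%g \in der))).
  rewrite exchange_big [LHS]mulrA [LHS]mulr_sumr.
  rewrite (eq_bigr (fun l => (n - eta (\det (GLval s))) * (ind (l *^ s != l) * (q ^+ 2 * c2)))).
    by rewrite -mulr_sumr -mulr_suml sum_unfixed; ring.
  move=> l _; rewrite [q ^+ 2 * 3]mulrC (avg_homol eb (fun t x => @stabl_homol l t x)).
  rewrite (@sum_generic _ _ _ (q * c2) (q * c2)).
  - by rewrite sum_stabl /line_order -/q /c2; ring.
  - exact: stabl0.
  by move=> o o' ol ol'; rewrite map1_stab //; case: ifP.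
move=> x _; rewrite -mulr_suml -mulr_sumr; congr (_ * _ * _); exact: nfix_lines.
Qed.

(** The coefficients come from [sum_generic]: in units of c2, the total minus the off-diagonal value
    is q (q + 1) - (q - 1) = q^2 + 1, and the diagonal minus the off-diagonal value is 2 q - (q - 1)
    = q + 1. *)
Lemma test_nflag (eta : F -> rat) s : balanced eta ->
  3 * q ^+ 2 * \sum_x eta (\det (GLval x)) * nflag x * ind ((x * s)%g \in der) =
  (n - eta (\det (GLval s))) * c2 *
    ((q ^+ 2 + 1) * (n - nfix s) - (q + 1) * ((q + 1) * nfix s - nflag s)).
Proof.
move=> eb.
rewrite (eq_bigr (fun x => \sum_l eta (\det (GLval x)) * (stabl l x * fixl l x) * ind ((x * s)%g \in der))).
  rewrite exchange_big mulr_sumr.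
  rewrite (eq_bigr (fun l => (n - eta (\det (GLval s))) * c2 * ((q ^+ 2 + 1) * ind (l *^ s != l)
     - (q + 1) * (ind (l *^ s != l) * fixl l s)))).
    by rewrite -mulr_sumr sumrB -!mulr_sumr sum_unfixed sum_unfixed_fixl.
  move=> l _; have inv t x : t \in homol l -> stabl l (t * x)%g * fixl l (t * x)%g = stabl l x * fixl l x.
    by move=> tH; rewrite stabl_homol // fixl_homol.
  rewrite (avg_homol eb inv).
  rewrite (@sum_generic _ _ _ (2 * q * c2) ((q - 1) * c2)).
  - by rewrite sum_stab_fix /line_order -/q /c2; ring.
  - by move=> x /stabl0 ->; rewrite mul0r.
  exact: map1_stab_fix.
by move=> x _; rewrite /nflag mulr_sumr mulr_suml.
Qed.

Lemma sum_generic_all l : \sum_x ind (generic l x) = q ^+ 2 * L.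
Proof.
rewrite (eq_bigr (fun x => 1 - stabl l x - fixl l x + stabl l x * fixl l x)); last first.
  by move=> x _; rewrite genericE indN /stabl; ring.
rewrite big_split !sumrB /= sum_const_rat mulr1 sum_stabl sum_stab_fix.
rewrite exchange_big /= (eq_bigr (fun p => ind (on p l) * L)) => [|p _].
  by rewrite -mulr_suml sum_on_line -/(gG F) gG_line /L -/q -/n /n; ring.
by rewrite -mulr_sumr map1.
Qed.

Lemma card_der : 3 * \sum_x ind (x \in der) = (n - 1) * L.
Proof.
have [l _ ] : exists l : ln, true.
  apply/existsP; apply: contraT; rewrite negb_exists => /forallP h.
  by have := n_neq0 F; rewrite -(card_ln F) -sum1_card big1 ?eqxx // => l _; have := h l.
have q20 : q ^+ 2 != 0 by rewrite expf_neq0 ?q_neq0.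
apply: (mulfI q20).
have := @avg_homol l (fun=> 1) (fun=> 1) balanced_one (fun _ _ _ => erefl) 1%g.
rewrite (eq_bigr (fun x => ind (x \in der))) => [|x _]; last by rewrite !mul1r mulg1.
rewrite [X in _ = _ * X](eq_bigr (fun x => ind (generic l x))) => [|x _]; last by rewrite !mul1r mulg1.
rewrite sum_generic_all => e; rewrite [LHS]mulrA [q ^+ 2 * 3]mulrC e; ring.
Qed.

End TestFunctions.

(** * Unipotent test function *)

Section Unipotent.
Variable F : finFieldType.
Local Notation gT := {'GL_3[F]}.
Local Notation pt := (PGpoint F).
Local Notation ln := (PGline F).
Local Notation der := (der F).
Implicit Types (p o : pt) (l : ln) (g s x t : gT).
Let q : rat := #|F|%:R.
Let n : rat := q ^+ 2 + q + 1.
Let c2 : rat := q ^+ 2 * (q - 1) ^+ 3.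

(* Up to a scalar c, [x] is unipotent on the flag (p, l); the condition on the
   determinant says that c is also the eigenvalue on the quotient by l. *)
Definition unip p l x : bool := on p l && [exists c : F,
  [&& val p *m GLval x == c *: val p, (val l *m GLval x - c *: val l <= val p)%MS
    & \det (GLval x) == c ^+ 3]].

(** Up to the scalar c, these are the elations with axis l and the identity. *)
Definition kern l x : bool := [exists c : F,
  (val l *m GLval x == c *: val l) && (\det (GLval x) == c ^+ 3)].

Lemma scalP m k (U : 'M[F]_(m, 3)) (W : 'M[F]_(k, 3)) (A : 'M[F]_3) (c : F) :
  (U :=: W)%MS -> (U *m A == c *: U) = (W *m A == c *: W).
Proof.
have h m' (V : 'M[F]_(m', 3)) : (V *m A == c *: V) = (V <= kermx (A - c%:M))%MS.
  by rewrite (sameP sub_kermxP eqP) mulmxBr mul_mx_scalar subr_eq0.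
by move=> e; rewrite !h e.
Qed.

Lemma sub_scal m (U : 'M[F]_(m, 3)) (A : 'M[F]_3) (c : F) :
  U *m A - c *: U = U *m (A - c%:M).
Proof. by rewrite mulmxBr mul_mx_scalar. Qed.

Lemma unipP p l x (u v : 'rV[F]_3) : on p l -> (val p :=: u)%MS -> (val l :=: u + v)%MS ->
  reflect (exists c a, [/\ u *m GLval x = c *: u, v *m GLval x = a *: u + c *: v
     & \det (GLval x) = c ^+ 3]) (unip p l x).
Proof.
move=> pl eu el; rewrite /unip pl; apply: (iffP existsP) => [[c /and3P[h1 h2 /eqP h3]]|].
  exists c; move: h1 h2; rewrite (scalP _ _ eu) => /eqP h1.
  rewrite sub_scal (eqmxMr _ el) addsmxMr addsmx_sub -!sub_scal => /andP[_]; rewrite eu => /sub_rVP[a h2].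
  by exists a; split => //; rewrite -h2 subrK.
case=> c [a [h1 h2 h3]]; exists c; rewrite (scalP _ _ eu) h1 h3 !eqxx andbT /=.
rewrite sub_scal (eqmxMr _ el) addsmxMr addsmx_sub -!sub_scal h1 h2 subrr addrK sub0mx eu.
exact: scalemx_sub.
Qed.

Lemma kernP l x (u v : 'rV[F]_3) : (val l :=: u + v)%MS ->
  reflect (exists c, [/\ u *m GLval x = c *: u, v *m GLval x = c *: v & \det (GLval x) = c ^+ 3])
    (kern l x).
Proof.
move=> el.
have h m' (V : 'M[F]_(m', 3)) c : (V *m GLval x == c *: V) = (V <= kermx (GLval x - c%:M))%MS.
  by rewrite (sameP sub_kermxP eqP) mulmxBr mul_mx_scalar subr_eq0.
apply: (iffP existsP) => [[c]|[c [/eqP h1 /eqP h2 /eqP h3]]].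
  by rewrite h el addsmx_sub -!h => /andP[/andP[/eqP ? /eqP ?] /eqP ?]; exists c.
by exists c; rewrite h el addsmx_sub -!h h1 h2 h3.
Qed.

Lemma scal_neq0 x (u : 'rV[F]_3) c : u != 0 -> u *m GLval x = c *: u -> c != 0.
Proof.
move=> u0; apply: contra_eq_neq => ->; rewrite scale0r.
by apply: contraNneq u0 => /(congr1 (mulmx^~ (invmx (GLval x)))); rewrite mulmxK ?GL_unitmx // mul0mx => ->.
Qed.

Lemma unip_fix p l x : unip p l x -> p *^ x = p.
Proof.
case/andP=> _ /existsP[c /and3P[/eqP h _ _]]; apply: subsp_inj.
by rewrite val_subact h scalemx_sub.
Qed.

Lemma unip_line p l x : unip p l x -> l *^ x = l.
Proof.
case/andP=> pl /existsP[c /and3P[_ h _]]; apply: subsp_inj; rewrite val_subact.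
rewrite -(subrK (c *: val l) (_ *m _)); apply: addmx_sub; last exact: scalemx_sub.
exact: submx_trans h pl.
Qed.

Lemma kern_fix p l x : kern l x -> on p l -> p *^ x = p.
Proof.
case/existsP=> c /andP[/eqP h _] /submxP[y e]; apply: subsp_inj.
by rewrite val_subact e -mulmxA h -scalemxAr scalemx_sub.
Qed.

Lemma kern_line l x : kern l x -> l *^ x = l.
Proof.
by case/existsP=> c /andP[/eqP h _]; apply: subsp_inj; rewrite val_subact h scalemx_sub.
Qed.

Lemma unip_homol p l t x : t \in homol l -> \det (GLval t) = 1 -> unip p l (t * x)%g = unip p l x.
Proof.
move=> tH dt; rewrite /unip; case: (boolP (on p l)) => //; rewrite !andTb => /submxP[y e].
have lt : val l *m GLval t = val l by move: tH; rewrite inE => /eqP.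
have pt : val p *m GLval t = val p by rewrite e -mulmxA lt.
by apply: eq_existsb => c; rewrite GL_MxE det_mulmx dt mul1r !mulmxA lt pt.
Qed.

Lemma kern_homol l t x : t \in homol l -> \det (GLval t) = 1 -> kern l (t * x)%g = kern l x.
Proof.
move=> tH dt; apply: eq_existsb => c; rewrite GL_MxE det_mulmx dt mul1r !mulmxA.
by move: tH; rewrite inE => /eqP ->.
Qed.

Lemma vec_on (a b p : pt) l (u v : 'rV[F]_3) : a != b -> on a l -> on b l -> on p l -> p != a ->
  (val a :=: u)%MS -> (val b :=: v)%MS -> exists y : F, (val p :=: (y *: u + v)%R)%MS.
Proof.
move=> ab al bl pl pa ea eb; have r2 := rank2_vec ab ea eb.
have [w w0 ew] := vec_of p.
have el : (val l :=: u + v)%MS.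
  by apply: line_sub_eq => //; rewrite addsmx_sub -ea -eb; apply/andP.
have : (w <= u + v)%MS by rewrite -el -ew.
case/sub_addsmxP=> -[y z] /=; rewrite [y]mx11_scalar [z]mx11_scalar !mul_scalar_mx => e.
have z0 : z 0 0 != 0.
  by apply: contra pa => /eqP z0; rewrite subsp_eqE ew ea e z0 scale0r addr0 scalemx_sub.
exists ((z 0 0)^-1 * y 0 0); apply: eqmx_trans ew _.
have -> : ((z 0 0)^-1 * y 0 0) *: u + v = (z 0 0)^-1 *: w.
  by rewrite e scalerDr !scalerA mulVf // scale1r.
by apply/eqmx_sym/eqmx_scale; rewrite invr_neq0.
Qed.

(** For each eigenvalue c, the elements in question form one coset of the homologies with axis l and
    determinant 1: q - 1 cosets of q^2 elements each. *)
Lemma unip_map p l o o' : on p l -> on o l -> on o' l -> o != p -> o' != p ->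
  \sum_x ind (unip p l x) * ind (o *^ x == o') = (q - 1) * q ^+ 2.
Proof.
move=> pl ol ol' op op'; have [u u0 eu] := vec_of p; have [v v0 ev] := vec_of o.
have po : p != o by rewrite eq_sym.
have [t et] := vec_on po pl ol ol' op' eu ev.
have r2 := rank2_vec po eu ev; have [w UM] := frame_ext r2; set M := row3 u v w in UM.
have el : (val l :=: u + v)%MS.
  by apply: line_sub_eq => //; rewrite addsmx_sub -eu -ev; apply/andP.
(* In the basis u, v, w, a representative for the eigenvalue c: it maps v to c (t u + v), a vector
   spanning o'. *)
pose T c := row3 (vec3 c 0 0) (vec3 (c * t) c 0) (vec3 0 0 c).
have dT c : \det (T c) = c ^+ 3 by rewrite det_row3; ring.
have UT c : c != 0 -> invmx M *m T c *m M \in unitmx.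
  by move=> c0; rewrite !unitmx_mul unitmx_inv UM unitmxE dT unitfE expf_neq0.
have ex c : exists x : gT, c != 0 -> [/\ u *m GLval x = c *: u,
    v *m GLval x = c *: (t *: u + v) & \det (GLval x) = c ^+ 3].
  (* The value at c = 0 is a dummy that makes X a total function. *)
  have [->|c0] := eqVneq c 0; first by exists 1%g.
  have [x xE] := GL_of (UT c c0); exists x => _.
  have : M *m GLval x = T c *m M by rewrite xE -!mulmxA mulKVmx.
  rewrite /M /T !row3_mul !mulmx_row3 !scale0r !addr0 => /row3_inj[e1 e2 _].
  split=> //; first by rewrite e2 scalerDr scalerA.
  rewrite xE !det_mulmx det_inv dT mulrAC mulVf ?mul1r //.
  by rewrite -unitfE -unitmxE.
have [X XE] := fin_all_exists ex.
have key c x : c != 0 -> ((x * (X c)^-1)%g \in homol l) && (\det (GLval (x * (X c)^-1)%g) == 1)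
   = [&& u *m GLval x == c *: u, v *m GLval x == c *: (t *: u + v) & \det (GLval x) == c ^+ 3].
  move=> c0; have [e1 e2 e3] := XE c c0.
  have h (y z : 'rV[F]_3) : y *m GLval (X c) = z -> (y *m GLval (x * (X c)^-1)%g == y) = (y *m GLval x == z).
    move=> e; rewrite GL_MxE mulmxA -(inj_eq (can_inj (mulmxK (GL_unitmx (X c))))) e.
    by rewrite GL_VxE mulmxKV ?GL_unitmx.
  rewrite (in_homol _ el) (h _ _ e1) (h _ _ e2) -andbA; congr [&& _, _ & _].
  rewrite GL_MxE det_mulmx GL_VxE det_inv e3 -(inj_eq (mulIf (expf_neq0 3 c0))) mul1r.
  by rewrite divfK // expf_neq0.
have uniq c c' x : u *m GLval x == c *: u -> u *m GLval x == c' *: u -> c = c'.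
  move=> /eqP -> /eqP/(congr1 (fun z => z - c' *: u)); rewrite subrr -scalerBl => /eqP.
  by rewrite scalemx_eq0 (negPf u0) orbF subr_eq0 => /eqP.
have E x : ind (unip p l x) * ind (o *^ x == o') =
   \sum_(c | c != 0) ind (((x * (X c)^-1)%g \in homol l) && (\det (GLval (x * (X c)^-1)%g) == 1)).
  rewrite -indM; case: andP => [[/(unipP _ pl eu el)[c [d [e1 e2 e3]]] /eqP eo]|h].
    have c0 := scal_neq0 u0 e1.
    rewrite (bigD1 c) //= key // e1 e2 e3 !eqxx /=.
    have : (val (o *^ x) <= val o')%MS by rewrite eo.
    rewrite val_subact (eqmxMr _ ev) et => /sub_rVP[c']; rewrite e2 scalerDr scalerA => ec.
    have UR := can_inj (mulmxK UM).
    have : vec3 d c 0 *m M = vec3 (c' * t) c' 0 *m M by rewrite !mulmx_row3 !scale0r !addr0.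
    case/UR/vec3_inj => ed ecc _; rewrite ed -ecc scalerDr scalerA eqxx big1 ?addr0 //.
    move=> c1 /andP[c10 c1c]; rewrite key //; case: andP => // -[h1 _].
    by case/eqP: c1c; exact: esym (uniq c c1 x (introT eqP e1) h1).
  rewrite big1 // => c c0; rewrite key //; case: and3P => // -[/eqP e1 /eqP e2 /eqP e3]; case: h.
  split; first by apply/(unipP _ pl eu el); exists c, (c * t); rewrite -scalerA -scalerDr.
  by rewrite subact_eqE (eqmxMr _ ev) e2 et scalemx_sub.
rewrite (eq_bigr _ (fun x _ => E x)) exchange_big -sum_nz_const; apply: eq_bigr => c c0.
rewrite (reindex_inj (mulIg (X c))) -(sum_homol_det l (oner_neq0 F)); apply: eq_bigr => x _.
by rewrite mulgK.
Qed.

(** On the flag, v is mapped to d u + c v; the second point o, spanned by v, is fixed only for d =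
    0. *)
Lemma kern_unip p l o x : on p l -> on o l -> o != p -> kern l x = unip p l x && (o *^ x == o).
Proof.
move=> pl ol op; have [u u0 eu] := vec_of p; have [v v0 ev] := vec_of o.
have po : p != o by rewrite eq_sym.
have r2 := rank2_vec po eu ev.
have el : (val l :=: u + v)%MS.
  by apply: line_sub_eq => //; rewrite addsmx_sub -eu -ev; apply/andP.
apply/(kernP _ el)/andP => [[c [e1 e2 e3]]|[/(unipP _ pl eu el)[c [d [e1 e2 e3]]]]].
  split; last by apply/(fixes_vec _ ev); exists c.
  by apply/(unipP _ pl eu el); exists c, 0; rewrite scale0r add0r.
case/(fixes_vec _ ev) => c' e4; exists c; split => //; rewrite e2.
have [w UM] := frame_ext r2; have UR := can_inj (mulmxK UM).
have : vec3 d c 0 *m row3 u v w = vec3 0 c' 0 *m row3 u v w.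
  by rewrite !mulmx_row3 -e2 e4 !scale0r !addr0 add0r.
by case/UR/vec3_inj => -> _ _; rewrite scale0r add0r.
Qed.

Lemma sum_kern l : \sum_x ind (kern l x) = (q - 1) * q ^+ 2.
Proof.
have [p pl] := on_ex l; have [o ol op] := other_on pl.
rewrite -(unip_map pl ol ol op op); apply: eq_bigr => x _.
by rewrite (@kern_unip p l o) // indM.
Qed.

Lemma unip_sum p l : on p l -> \sum_x ind (unip p l x) = (q - 1) * q ^+ 3.
Proof.
move=> pl; have [o ol op] := other_on pl.
rewrite (eq_bigr (fun x => \sum_o' ind (o' != p) * (ind (on o' l) * (ind (unip p l x) * ind (o *^ x == o'))))).
  rewrite exchange_big /=.
  rewrite (eq_bigr (fun o' => ind (o' != p) * (ind (on o' l) * ((q - 1) * q ^+ 2)))).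
    by rewrite sum_neq -mulr_suml sum_on_line pl -/q /=; ring.
  move=> o' _; rewrite -!mulr_sumr; have [->|op'] := eqVneq o' p; first by rewrite !mul0r.
  by case: (boolP (on o' l)) => ol'; rewrite ?mul0r // unip_map.
move=> x _; case: (boolP (unip p l x)) => ux; last by rewrite big1 // => i _; rewrite !(mul0r, mulr0).
rewrite (bigD1 (o *^ x)) //= eqxx (stabl_on _ (unip_line ux)) ol big1 => [|i ip]; last first.
  by rewrite [_ == i]eq_sym (negPf ip) !mulr0.
by rewrite -{1}(unip_fix ux) (inj_eq (@subact_inj _ _ x)) op /=; ring.
Qed.

(** The coefficient 3 q is dictated by [class_identity]. An elation with axis l fixes q + 1 points
    and has a single line in [kern], where 3 q = 3 (q + 1) - 3 turns the flag count into flags minus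
    three times points plus 3. *)
Definition unip_test l x : rat := \sum_p ind (unip p l x) - 3 * q * ind (kern l x).

Lemma unip_test_stab l x : l *^ x != l -> unip_test l x = 0.
Proof.
move=> lx; rewrite /unip_test big1 => [|p _]; last first.
  by case: (boolP (unip p l x)) => // /unip_line e; rewrite e eqxx in lx.
by case: (boolP (kern l x)) => [/kern_line e|_]; [rewrite e eqxx in lx|rewrite mulr0 subrr].
Qed.

Lemma unip_test_map l o o' : on o l -> on o' l -> \sum_x unip_test l x * ind (o *^ x == o') =
  if o == o' then - (q - 1) * q ^+ 3 else (q - 1) ^+ 2 * q ^+ 2.
Proof.
move=> ol ol'.
have K : \sum_x ind (kern l x) * ind (o *^ x == o') = ind (o == o') * ((q - 1) * q ^+ 2).
  rewrite -(sum_kern l) mulr_sumr; apply: eq_bigr => x _.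
  by case: (boolP (kern l x)) => [kx|_]; rewrite ?mul0r ?mulr0 // (kern_fix kx ol) mulrC.
rewrite (eq_bigr (fun x => \sum_p ind (unip p l x) * ind (o *^ x == o')
    - 3 * q * (ind (kern l x) * ind (o *^ x == o')))); last first.
  by move=> x _; rewrite /unip_test mulrBl mulr_suml mulrA.
rewrite sumrB exchange_big /= -mulr_sumr K.
(* A flag point p equal to o forces o = o'. A flag point p different from o must differ from o' too,
   being fixed; then [unip_map] applies. *)
rewrite (eq_bigr (fun p => ind (p == o) * (ind (o == o') * ((q - 1) * q ^+ 3)) +
     ind (p != o) * (ind (p != o') * (ind (on p l) * ((q - 1) * q ^+ 2))))).
  rewrite big_split /= sum_ind_eq sum_neq sum_neq ol.
  by rewrite -mulr_suml sum_on_line ol' -/q; case: (o == o') => /=; ring.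
move=> p _; have [->|po] := eqVneq p o.
  rewrite mul0r addr0 mul1r -(unip_sum ol) mulr_sumr; apply: eq_bigr => x _.
  by case: (boolP (unip o l x)) => [/unip_fix->|_]; rewrite ?mul0r ?mulr0 // mulrC.
rewrite mul0r add0r mul1r; case: (boolP (on p l)) => pl; last first.
  by rewrite !(mul0r, mulr0) big1 // => x _; rewrite /unip (negPf pl) mul0r.
have [e|po'] := eqVneq p o'.
  rewrite mul0r big1 // => x _; case: (boolP (unip p l x)) => [/unip_fix px|_]; last by rewrite mul0r.
  by rewrite -e -[X in _ == X]px (inj_eq (@subact_inj _ _ x)) [o == p]eq_sym (negPf po) mulr0.
by rewrite !mul1r unip_map // eq_sym.
Qed.

Lemma unip_test_sum l : \sum_x unip_test l x = (q - 1) * q ^+ 3 * (q - 2).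
Proof.
rewrite sumrB -mulr_sumr sum_kern exchange_big /=.
rewrite (eq_bigr (fun p => ind (on p l) * ((q - 1) * q ^+ 3))).
  by rewrite -mulr_suml sum_on_line -/q; ring.
move=> p _; case: (boolP (on p l)) => pl; first by rewrite mul1r unip_sum.
by rewrite mul0r big1 // => x _; rewrite /unip (negPf pl).
Qed.

Lemma unip_test_det l x : unip_test l x != 0 -> exists2 c, c != 0 & \det (GLval x) = c ^+ 3.
Proof.
have dx := detGL_neq0 x.
have h (c : F) : \det (GLval x) = c ^+ 3 -> exists2 c, c != 0 & \det (GLval x) = c ^+ 3.
  by move=> e; exists c => //; apply: contra dx; rewrite e => /eqP ->; rewrite expr0n.
case: (boolP (kern l x)) => [/existsP[c /andP[_ /eqP /h] //]|k0].
rewrite /unip_test (negPf k0) mulr0 subr0.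
have [/existsP[p /andP[_ /existsP[c /and3P[_ _ /eqP /h]]]] //|/existsPn h0] := boolP [exists p, unip p l x].
by rewrite big1 ?eqxx // => p _; rewrite (negPf (h0 p)).
Qed.

(** On the support of the test function the determinant is a cube, so the number of cube roots
    depends on s alone. The coefficients come from [sum_generic], after division by (q - 1) q^2: q
    (q - 2) - (q - 1) = q^2 - 3 q + 1 and - q - (q - 1) = - (2 q - 1). *)
Lemma test_unip s :
  3 * \sum_x (\sum_l unip_test l x) * ind ((x * s)%g \in der) =
  (n - ncbrt (\det (GLval s))) * (q - 1) *
    ((q ^+ 2 - 3 * q + 1) * (n - nfix s) + (2 * q - 1) * ((q + 1) * nfix s - nflag s)).
Proof.
have q20 : q ^+ 2 != 0 by rewrite expf_neq0 ?q_neq0.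
apply: (mulfI q20).
rewrite (eq_bigr (fun x => \sum_l unip_test l x * ind ((x * s)%g \in der))); last first.
  by move=> x _; rewrite mulr_suml.
rewrite exchange_big [LHS]mulrA [LHS]mulr_sumr [q ^+ 2 * 3]mulrC.
set r := n - ncbrt _.
rewrite (eq_bigr (fun l => r * (q - 1) * q ^+ 2 * ((q ^+ 2 - 3 * q + 1) * ind (l *^ s != l)
   + (2 * q - 1) * (ind (l *^ s != l) * fixl l s)))).
  by rewrite -mulr_sumr big_split -!mulr_sumr /= sum_unfixed sum_unfixed_fixl -/q -/n; ring.
move=> l _.
have inv t x : t \in homol l -> \det (GLval t) = 1 -> unip_test l (t * x)%g = unip_test l x.
  move=> tH dt; rewrite /unip_test kern_homol //; congr (_ - _); apply: eq_bigr => p _.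
  by rewrite unip_homol.
rewrite (avg_homol_det1 s inv).
rewrite (eq_bigr (fun x => r * (unip_test l x * ind (generic l (x * s)%g)))); last first.
  move=> x _; have [->|/unip_test_det[c c0 ->]] := eqVneq (unip_test l x) 0; first by rewrite !mul0r mulr0.
  by rewrite ncbrt_cube // -/q -/n -/r mulrC.
rewrite -mulr_sumr (sum_generic (@unip_test_stab l) (@unip_test_map l)) unip_test_sum; ring.
Qed.

End Unipotent.

(** * A linear identity between class functions *)

Section ClassIdentity.
Variable F : finFieldType.
Local Notation gT := {'GL_3[F]}.
Local Notation pt := (PGpoint F).
Local Notation ln := (PGline F).
Local Notation der := (der F).
Implicit Types (p o : pt) (l m : ln) (g s x t : gT).
Let q : rat := #|F|%:R.
Let n : rat := q ^+ 2 + q + 1.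

Definition scalar g : bool := [exists c, GLval g == c%:M].

(** The kernels of the powers of N are stationary from the third one on, as the dimension is 3.
    Iterated in [fitting_antiflag] to pass from N^6 to N^3. *)
Lemma nil_step (N : 'M[F]_3) (u : 'rV[F]_3) :
  u *m N *m N *m N *m N = 0 -> u *m N *m N *m N = 0.
Proof.
move=> x4; apply/eqP; apply: contraT => x3; exfalso.
(* Applying N repeatedly isolates the coefficients one by one. With e = 0 this shows u, uN, uN^2 to
   be independent; with e = 1 it shows that uN^3 cannot be a nontrivial combination of them. *)
have key a b c e : a *: u + b *: (u *m N) + c *: (u *m N *m N) = e *: (u *m N *m N *m N) ->
    [/\ a = 0, b = 0 & c = 0].
  move=> h; have h1 := congr1 (mulmx^~ N) h; have h2 := congr1 (mulmx^~ N) h1.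
  have h3 := congr1 (mulmx^~ N) h2; move: h1 h2 h3 => /=.
  rewrite !mulmxDl -!scalemxAl x4.
  rewrite !(scaler0, mul0mx, addr0) => h1 h2 /eqP.
  rewrite scalemx_eq0 (negPf x3) orbF => /eqP a0; move: h2 h1; rewrite a0 !scale0r !add0r.
  move/eqP; rewrite scalemx_eq0 (negPf x3) orbF => /eqP -> /eqP.
  by rewrite scale0r add0r scalemx_eq0 (negPf x3) orbF => /eqP ->.
have UM : row3 u (u *m N) (u *m N *m N) \in unitmx.
  rewrite -row_free_unit -kermx_eq0; apply/rowV0P => v /sub_kermxP.
  have [a [b [c ->]]] := vec3_ex v; rewrite mulmx_row3 => e.
  have [|-> -> ->] := @key a b c 0; first by rewrite scale0r.
  by apply/rowP => j; rewrite !mxE; case: j => -[|[|[|//]]].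
have [a [b [c e]]] := vec3_ex (u *m N *m N *m N *m invmx (row3 u (u *m N) (u *m N *m N))).
have e' : u *m N *m N *m N = a *: u + b *: (u *m N) + c *: (u *m N *m N).
  by rewrite -mulmx_row3 -e mulmxKV.
have [|a0 b0 c0] := @key a b c 1; first by rewrite scale1r.
by case/eqP: x3; rewrite e' a0 b0 c0 !scale0r !addr0.
Qed.

(** The line m carries all fixed points but p. Each of the other nfix - 1 fixed lines passes through
    p and carries two fixed points, p and its meet with m. This gives (nfix - 1) + 2 (nfix - 1)
    flags. *)
Lemma antiflag_count p m g : p *^ g = p -> m *^ g = m -> ~~ on p m ->
  (forall p', p' *^ g = p' -> p' = p \/ on p' m) ->
  (forall l, l *^ g = l -> l = m \/ on p l) -> nflag g = 3 * (nfix g - 1).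
Proof.
move=> pg mg pm fp fl.
have e1 : nfix g = 1 + fixl m g.
  rewrite /nfix /fixl (bigD1 p) //= pg eqxx [in RHS](bigD1 p) //= (negPf pm) mul0r add0r.
  congr (_ + _); apply: eq_bigr => p' pp'; rewrite -indM; congr ((_ : bool)%:R).
  apply/idP/andP => [h|[]] //; move/eqP: (h) => h'; case: (fp _ h') => e; last by split.
  by rewrite e eqxx in pp'.
have e2 : nfix g = 1 + \sum_l ind (on p l) * stabl l g.
  rewrite nfix_lines (bigD1 m) //= mg eqxx [in RHS](bigD1 m) //= (negPf pm) mul0r add0r.
  congr (_ + _); apply: eq_bigr => l lm; rewrite -indM; congr ((_ : bool)%:R).
  apply/idP/andP => [h|[]] //; move/eqP: (h) => h'; case: (fl _ h') => e; last by split.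
  by rewrite e eqxx in lm.
rewrite /nflag (bigD1 m) //= {1}/stabl mg eqxx mul1r.
rewrite (eq_bigr (fun l => 2 * (ind (on p l) * stabl l g))).
  rewrite -mulr_sumr; have -> : \sum_(l | l != m) ind (on p l) * stabl l g = nfix g - 1.
    by rewrite e2 [in RHS](bigD1 m) //= (negPf pm) mul0r add0r addrAC subrr add0r.
  rewrite e1; ring.
move=> l lm; rewrite /stabl; case: eqVneq => [lg|_]; last by rewrite mul0r !mulr0.
have [e|pl] := fl _ lg; first by rewrite e eqxx in lm.
have [o [ol om uo]] := line_meet lm.
have og : o *^ g = o by apply: uo; rewrite -1?lg -1?mg on_act.
have op : o != p by apply: contraNneq pm => <-.
rewrite /fixl (bigD1 p) //= (bigD1 o) //= pl pg ol og !eqxx big1 => [|p' /andP[h1 h2]].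
  by rewrite /=; ring.
rewrite -indM; case: andP => // -[h3 /eqP h4]; case: (fp _ h4) => e; first by rewrite e eqxx in h1.
by rewrite (uo _ h3 e) eqxx in h2.
Qed.

Lemma eigen_nil g c d (v : 'rV[F]_3) : v != 0 -> v *m GLval g = d *: v ->
  (forall u : 'rV[F]_3, u *m (GLval g - c%:M) *m (GLval g - c%:M) *m (GLval g - c%:M) = 0) -> d = c.
Proof.
move=> v0 e /(_ v).
have h : v *m (GLval g - c%:M) = (d - c) *: v by rewrite -sub_scal e scalerBl.
rewrite h -!scalemxAl h -!scalemxAl h !scalerA => /eqP.
by rewrite scalemx_eq0 (negPf v0) orbF !mulf_eq0 !orbb subr_eq0 => /eqP.
Qed.

Definition nilp g c : Prop := forall u : 'rV[F]_3,
  u *m (GLval g - c%:M) *m (GLval g - c%:M) *m (GLval g - c%:M) = 0.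

Lemma unip_nilp p l g : unip p l g -> exists c, nilp g c.
Proof.
move=> ug; have pl : on p l by case/andP: ug.
have [u u0 eu] := vec_of p; have [o ol op] := other_on pl; have [v v0 ev] := vec_of o.
have po : p != o by rewrite eq_sym.
have r2 := rank2_vec po eu ev; have [w UM] := frame_ext r2.
have el : (val l :=: u + v)%MS.
  by apply: line_sub_eq => //; rewrite addsmx_sub -eu -ev; apply/andP.
move/(unipP _ pl eu el): ug => [c [d [e1 e2 e3]]]; exists c.
have c0 := scal_neq0 u0 e1.
have [a [b [f ew]]] := vec3_ex (w *m GLval g *m invmx (row3 u v w)).
have ew' : w *m GLval g = a *: u + b *: v + f *: w by rewrite -mulmx_row3 -ew mulmxKV.
have M0 : \det (row3 u v w) != 0 by rewrite -unitfE -unitmxE.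
(* The matrix of g is triangular with diagonal c, c, f, and [unip] prescribes the determinant
   c^3. *)
have fc : f = c.
  have : row3 u v w *m GLval g = row3 (vec3 c 0 0) (vec3 d c 0) (vec3 a b f) *m row3 u v w.
    by rewrite !row3_mul !mulmx_row3 !scale0r !addr0 e1 e2 ew'.
  move/(congr1 determinant); rewrite !det_mulmx mulrC => /(mulIf M0).
  rewrite det_row3 e3 => h; apply: (mulfI (mulf_neq0 c0 c0)).
  by transitivity (c ^+ 3); [rewrite h|]; ring.
pose N := GLval g - c%:M.
have uN : u *m N = 0 by rewrite -sub_scal e1 subrr.
have vN : v *m N = d *: u by rewrite -sub_scal e2 addrK.
have wN : w *m N = a *: u + b *: v by rewrite -sub_scal ew' fc addrK.
move=> x; have [x1 [x2 [x3 ex]]] := vec3_ex (x *m invmx (row3 u v w)).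
have -> : x = x1 *: u + x2 *: v + x3 *: w by rewrite -mulmx_row3 -ex mulmxKV.
rewrite -/N !(mulmxDl, =^~ scalemxAl, uN, vN, wN, scaler0, add0r, addr0).
by rewrite !(mul0mx, scaler0, addr0).
Qed.

Lemma kern_unip_ex l g : kern l g -> exists p, unip p l g.
Proof.
have [p pl] := on_ex l; have [o ol op] := other_on pl.
by rewrite (kern_unip _ pl ol op) => /andP[h _]; exists p.
Qed.

Lemma scalar_unip g : scalar g -> exists c, nilp g c.
Proof.
by case/existsP=> c /eqP e; exists c => u; rewrite e subrr !mulmx0.
Qed.

Lemma unip_test_eq0 g : (forall c, ~ nilp g c) -> \sum_l unip_test l g = 0.
Proof.
move=> h; have hu p l : unip p l g = false by apply/negP => /unip_nilp[c /h].
rewrite big1 // => l _; rewrite /unip_test big1 => [|p _]; last by rewrite hu.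
suff -> : kern l g = false by rewrite mulr0 subrr.
by case: (boolP (kern l g)) => // /kern_unip_ex[p]; rewrite hu.
Qed.

Lemma identity_der g : g \in der -> \sum_l unip_test l g = 0 /\ ~~ scalar g.
Proof.
move=> gD; have h c : ~ nilp g c.
  move=> gc; have [u u0 e] : exists2 u : 'rV[F]_3, u != 0 & u *m GLval g = c *: u.
    have zero (A : 'M[F]_3) : (forall u : 'rV[F]_3, u *m A = 0 -> u = 0) -> A \in unitmx.
      move=> hA; rewrite -row_free_unit -kermx_eq0; apply/rowV0P => v /sub_kermxP; exact: hA.
    case: (boolP (GLval g - c%:M \in unitmx)) => U.
      have := gc (delta_mx 0 0); do 3!move/(congr1 (mulmx^~ (invmx (GLval g - c%:M)))); rewrite !mul0mx !mulmxK //.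
      by move/rowP/(_ 0)/eqP; rewrite !mxE !eqxx oner_eq0.
    move: U; rewrite -row_free_unit -kermx_eq0 => /rowV0Pn[u /sub_kermxP e u0]; exists u => //.
    by apply/eqP; rewrite -subr_eq0 sub_scal e.
  by move/derP: gD => /(_ u c u0).
split; first exact: unip_test_eq0.
by case: (boolP (scalar g)) => // /scalar_unip[c /h].
Qed.

Lemma nilpE g c (Q := (GLval g - c%:M) *m (GLval g - c%:M) *m (GLval g - c%:M)) :
  nilp g c <-> Q = 0.
Proof.
split=> [h|Q0 u]; last by rewrite -!mulmxA [X in u *m X]mulmxA -/Q Q0 mulmx0.
apply/row_matrixP => i; rewrite rowE row0 /Q !mulmxA; exact: h.
Qed.

(* Fitting decomposition with respect to the eigenvalue c. *)
Lemma fitting_antiflag g c (v : 'rV[F]_3) : v != 0 -> v *m GLval g = c *: v -> ~ nilp g c ->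
  exists p m, [/\ p *^ g = p, m *^ g = m, ~~ on p m,
    forall p', p' *^ g = p' -> p' = p \/ on p' m &
    forall l, l *^ g = l -> l = m \/ on p l].
Proof.
move=> v0 ev; set A := GLval g in ev *; pose N := A - c%:M; pose Q := N *m N *m N.
move/(nilpE g c) => /eqP Q0; rewrite -/A -/N -/Q in Q0.
have NA : N *m A = A *m N by rewrite mulmxBl mulmxBr mul_mx_scalar mul_scalar_mx.
have QA : Q *m A = A *m Q by rewrite /Q -!mulmxA NA !mulmxA -[N *m N *m A]mulmxA NA !mulmxA NA.
have vN : v *m N = 0 by rewrite -sub_scal ev subrr.
have vQ : v *m Q = 0 by rewrite /Q !mulmxA vN !mul0mx.
have rQ : (\rank Q < 3)%N.
  rewrite ltn_neqAle rank_leq_col andbT; apply: contra v0 => /eqP rQ.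
  have U : Q \in unitmx by rewrite -row_free_unit /row_free rQ.
  by rewrite -[v](mulmxK U) vQ mul0mx.
(* With Q = N^3, three applications of [nil_step] take the exponent from 6 to 3; hence the kernel
   and the image of Q meet trivially. *)
have QQ (u : 'rV[F]_3) : u *m Q *m Q = 0 -> u *m Q = 0.
  by rewrite /Q !mulmxA => h; apply: nil_step; apply: nil_step; apply: nil_step.
have QQm k (u : 'M[F]_(k, 3)) : u *m Q *m Q = 0 -> u *m Q = 0.
  move=> h; apply/row_matrixP => i; rewrite row0 row_mul; apply: QQ.
  by rewrite -!row_mul h row0.
have kA : (kermx Q *m A <= kermx Q)%MS.
  by apply/sub_kermxP; rewrite -mulmxA -QA mulmxA mulmx_ker mul0mx.
have iA : (Q *m A <= Q)%MS by rewrite QA submxMl.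
have fixW (w : 'rV[F]_3) d : w *m A = d *: w -> (w <= kermx Q)%MS \/ (w <= Q)%MS.
  move=> ew; have wN : w *m N = (d - c) *: w by rewrite -sub_scal ew scalerBl.
  have wQ : w *m Q = (d - c) ^+ 3 *: w.
    by rewrite /Q !mulmxA wN -!scalemxAl wN -!scalemxAl wN !scalerA; congr (_ *: _); ring.
  have [dc|dc] := eqVneq (d - c) 0; first by left; apply/sub_kermxP; rewrite wQ dc expr0n scale0r.
  right; have -> : w = ((d - c) ^+ 3)^-1 *: (w *m Q).
    by rewrite wQ scalerA mulVf ?scale1r // expf_neq0.
  by rewrite scalemx_sub // submxMl.
have lineN l : l *^ g = l -> (val l *m Q <= val l)%MS.
  move=> lg; have lA : (val l *m A <= val l)%MS by rewrite -val_subact lg.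
  have lN (V : 'M[F]_3) : (V <= val l)%MS -> (V *m N <= val l)%MS.
    move=> Vl; rewrite -sub_scal addmx_sub ?eqmx_opp ?scalemx_sub //.
    exact: submx_trans (submxMr _ Vl) lA.
  by rewrite /Q !mulmxA; exact: lN (lN _ (lN _ (submx_refl _))).
have rk : (\rank Q + \rank (kermx Q) = 3)%N by rewrite mxrank_ker subnKC // rank_leq_row.
have pfix (U : 'M[F]_3) k (V : subsp F k) : (val V :=: U)%MS -> (U *m A <= U)%MS -> V *^ g = V.
  by move=> e h; apply: subsp_inj; rewrite val_subact e (eqmxMr _ e).
have r0 : (0 < \rank Q)%N by rewrite lt0n mxrank_eq0.
(* The antiflag consists of the kernel and the image of Q; the rank of Q decides which of the two is
   the point. *)
have [r1|r2] : \rank Q = 1%N \/ \rank Q = 2%N by move: (\rank Q) r0 rQ => [|[|[|]]] // _ _; [left|right].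
- have rk1 : \rank (kermx Q) = 2 by move: rk; rewrite r1 => /eqP; rewrite eqn_add2l => /eqP.
  have [p ep] := subsp_of r1; have [m em] := subsp_of rk1; exists p, m; split.
  + exact: pfix ep iA.
  + exact: pfix em kA.
  + apply/negP; rewrite /on ep em => /sub_kermxP h; case/eqP: Q0.
    by rewrite -[Q]mul1mx; apply: QQm; rewrite mul1mx.
  + move=> p' pg; have [w w0 ew] := vec_of p'.
    have /(fixes_vec _ ew)[d /fixW[h|h]] : p' *^ g == p' by apply/eqP.
      by right; rewrite /on em ew.
    by left; apply: subsp_inj; rewrite ep ew.
  move=> l lg; have [->|lm] := eqVneq l m; [by left|right].
  have lQ0 : val l *m Q != 0.
    by apply: contra lm => /eqP/sub_kermxP h; rewrite subsp_eqE em.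
  have h : (val l *m Q <= val p)%MS by rewrite ep submxMl.
  apply: submx_trans (lineN _ lg); rewrite -(geq_leqif (mxrank_leqif_sup h)).
  by rewrite rank_subsp lt0n mxrank_eq0.
have rk1 : \rank (kermx Q) = 1%N by move: rk; rewrite r2 => /eqP; rewrite (eqn_add2l 2 _ 1) => /eqP.
have [p ep] := subsp_of rk1; have [m em] := subsp_of r2; exists p, m; split.
- exact: pfix ep kA.
- exact: pfix em iA.
- have [w w0 ew] := vec_of p; apply/negP; rewrite /on em ew => /submxP[u eu].
  have : (w <= kermx Q)%MS by rewrite -ep ew.
  by move/sub_kermxP; rewrite eu => /QQ e; rewrite eu e eqxx in w0.
- move=> p' pg; have [w w0 ew] := vec_of p'.
  have /(fixes_vec _ ew)[d /fixW[h|h]] : p' *^ g == p' by apply/eqP.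
    by left; apply: subsp_inj; rewrite ep ew.
  by right; rewrite /on em ew.
move=> l lg; have [pl|pl] := boolP (on p l); [by right|left].
have h : (val l *m Q <= val m)%MS by rewrite em submxMl.
apply/esym/subsp_inj; apply: submx_trans (lineN _ lg).
rewrite -(geq_leqif (mxrank_leqif_sup h)) rank_subsp.
suff e0 : \rank (val l :&: kermx Q)%MS = 0%N.
  by have := mxrank_mul_ker (val l) Q; rewrite e0 addn0 rank_subsp => ->.
have := mxrankS (capmxSr (val l) (kermx Q)); rewrite rk1.
rewrite leq_eqVlt ltnS leqn0 => /orP[/eqP e|/eqP //]; case/negP: pl.
rewrite /on ep; apply: submx_trans (capmxSl (val l) (kermx Q)).
by rewrite -(geq_leqif (mxrank_leqif_sup (capmxSr _ _))) rk1 e.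
Qed.

Lemma sum_lines_in k (W : 'M[F]_(k, 3)) : \sum_(l : ln) ind (val l <= W)%MS =
  if \rank W == 3%N then n else ind (\rank W == 2%N).
Proof.
case: eqP => [r3|r3].
  rewrite (eq_bigr (fun=> 1)) ?sum_const_rat ?card_ln ?mulr1 // => l _.
  suff -> : (val l <= W)%MS by [].
  have fW : row_full W by rewrite /row_full r3.
  exact: submx_full.
case: eqP => [r2|r2].
  have [l0 e0] := subsp_of r2; rewrite -[RHS](sum_ind1 l0); apply: eq_bigr => l _.
  by rewrite subsp_eqE e0.
rewrite big1 // => l _; case: (boolP (val l <= W)%MS) => // /mxrankS; rewrite rank_subsp.
by move: (rank_leq_col W) r2 r3; case: (\rank W) => [|[|[|[|]]]].
Qed.

(** With the single eigenvalue c, every fixed flag is unipotent, and [kern] holds for the lines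
    inside the kernel of N = g - c. The three possible ranks 0, 1, 2 of N then give n, q + 1, 1
    fixed points and n, 1, 0 such lines. *)
Lemma identity_nilp g c : nilp g c ->
  \sum_l unip_test l g = nflag g - 3 * nfix g + 3 - 3 * q ^+ 3 * ind (scalar g) /\ g \notin der.
Proof.
move=> gc; pose N := GLval g - c%:M; have /(nilpE g c) Q0 := gc.
have eig d (v : 'rV[F]_3) : v != 0 -> v *m GLval g = d *: v -> d = c.
  by move=> v0 e; exact: eigen_nil v0 e gc.
have rN : (\rank N < 3)%N.
  rewrite ltn_neqAle rank_leq_col andbT; apply/eqP => rN.
  have U : N \in unitmx by rewrite -row_free_unit /row_free rN.
  have : N *m N *m N \in unitmx by rewrite !unitmx_mul U.
  by rewrite Q0 unitmxE det0 unitr0.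
have fixE p : (p *^ g == p) = (val p <= kermx N)%MS.
  have [v v0 ev] := vec_of p; rewrite ev; apply/(fixes_vec _ ev)/sub_kermxP => [[d e]|e].
    by rewrite /N -sub_scal e (eig d v) // subrr.
  by exists c; apply/eqP; rewrite -subr_eq0 sub_scal e.
have lineN l : l *^ g = l -> forall k (V : 'M[F]_(k, 3)), (V <= val l)%MS -> (V *m N <= val l)%MS.
  move=> lg k V Vl; have lA : (val l *m GLval g <= val l)%MS by rewrite -val_subact lg.
  rewrite -sub_scal addmx_sub ?eqmx_opp ?scalemx_sub //.
  exact: submx_trans (submxMr _ Vl) lA.
have Q0' k (V : 'M[F]_(k, 3)) : V *m N *m N *m N = 0.
  by rewrite -!mulmxA (mulmxA N) Q0 mulmx0.
have tri p l : on p l -> p *^ g = p -> l *^ g = l -> unip p l g /\ \det (GLval g) = c ^+ 3.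
  move=> pl /eqP; rewrite fixE => /sub_kermxP pN lg.
  (* If l is contained in lN + p, then lN <= lN^2 <= lN^3 = 0, as N kills p. Otherwise lN + p is a
     proper subspace of l containing p, hence p itself. *)
  have lN : (val l *m N <= val p)%MS.
    have lNl := lineN _ lg _ _ (submx_refl (val l)).
    have pj : (val p <= val l *m N + val p)%MS by exact: addsmxSr.
    have jl : (val l *m N + val p <= val l)%MS by rewrite addsmx_sub; apply/andP.
    case: (boolP (val l <= val l *m N + val p)%MS) => lj; last first.
      have : (\rank (val l *m N + val p)%MS < 2)%N.
        by have := ltn_leqif (mxrank_leqif_sup jl); rewrite rank_subsp => ->.
      rewrite ltnS => h; apply: submx_trans (addsmxSl (val l *m N) (val p)) _.
      by rewrite -(geq_leqif (mxrank_leqif_sup pj)) rank_subsp.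
    have h1 : (val l *m N <= val l *m N *m N)%MS.
      by have := submxMr N lj; rewrite addsmxMr pN addsmx0.
    have h2 : (val l *m N *m N <= val l *m N *m N *m N)%MS by exact: submxMr.
    by move: (submx_trans h1 h2); rewrite Q0' submx0 => /eqP->; rewrite sub0mx.
  have [u u0 eu] := vec_of p; have [o ol op] := other_on pl; have [v v0 ev] := vec_of o.
  have po : p != o by rewrite eq_sym.
  have r2 := rank2_vec po eu ev; have [w UM] := frame_ext r2.
  have el : (val l :=: u + v)%MS.
    by apply: line_sub_eq => //; rewrite addsmx_sub -eu -ev; apply/andP.
  have uA : u *m GLval g = c *: u.
    apply/eqP; rewrite -subr_eq0 sub_scal; apply/eqP/sub_kermxP.
    by rewrite -eu; apply/sub_kermxP.
  have [d vN] : exists d, v *m N = d *: u.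
    apply/sub_rVP; rewrite -eu; apply: submx_trans lN; apply: submxMr.
    by rewrite -ev.
  have vA : v *m GLval g = d *: u + c *: v by rewrite -vN /N -sub_scal subrK.
  have [a [b [f ew]]] := vec3_ex (w *m GLval g *m invmx (row3 u v w)).
  have ew' : w *m GLval g = a *: u + b *: v + f *: w by rewrite -mulmx_row3 -ew mulmxKV.
  have uN : u *m N = 0 by rewrite /N -sub_scal uA subrr.
  have wN : w *m N = a *: u + b *: v + (f - c) *: w.
    by rewrite /N -sub_scal ew' scalerBl addrA.
  have fc : f = c.
    have := Q0' _ w; rewrite wN !(mulmxDl, =^~ scalemxAl, uN, vN, wN, scaler0, mul0mx, add0r, addr0).
    move=> h; have : vec3 ((f - c) * b * d + (f - c) * (f - c) * a) ((f - c) * (f - c) * b)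
       ((f - c) * (f - c) * (f - c)) *m row3 u v w = vec3 0 0 0 *m row3 u v w.
      by rewrite !mulmx_row3 !scale0r !addr0 scalerDl -[RHS]h !(scalerDr, scalerA) !addrA.
    move/(can_inj (mulmxK UM)) => /vec3_inj[_ _ /eqP].
    by rewrite !mulf_eq0 !orbb subr_eq0 => /eqP.
  have det3 : \det (GLval g) = c ^+ 3.
    have M0 : \det (row3 u v w) != 0 by rewrite -unitfE -unitmxE.
    have : row3 u v w *m GLval g = row3 (vec3 c 0 0) (vec3 d c 0) (vec3 a b c) *m row3 u v w.
      by rewrite !row3_mul !mulmx_row3 !scale0r !addr0 uA vA ew' fc.
    move/(congr1 determinant); rewrite !det_mulmx mulrC => /(mulIf M0) ->.
    by rewrite det_row3; ring.
  by split=> //; apply/(unipP _ pl eu el); exists c, d.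
have [u u0 /sub_kermxP uN] : exists2 u : 'rV[F]_3, u != 0 & (u <= kermx N)%MS.
  have : kermx N != 0 by rewrite kermx_eq0 /row_free; apply: contraL rN => /eqP ->.
  by case/rowV0Pn => u h1 h2; exists u.
have [p0 ep0] := point_of u0.
have pf0 : p0 *^ g == p0 by rewrite fixE ep0; apply/sub_kermxP.
have unipE p l : unip p l g = [&& on p l, p *^ g == p & l *^ g == l].
  apply/idP/and3P => [h|[pl /eqP pg /eqP lg]]; last by case: (tri p l).
  by split; [case/andP: h|apply/eqP; exact: unip_fix h|apply/eqP; exact: unip_line h].
have kernE l : kern l g = (val l <= kermx N)%MS.
  have [k1 [k2 [_ [el _]]]] := line_frame l.
  rewrite el addsmx_sub; apply/(kernP _ el)/andP => [[d [e1 e2 _]]|[/sub_kermxP e1 /sub_kermxP e2]].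
    have nz : (k1 != 0) || (k2 != 0).
      rewrite -negb_and; apply/negP => /andP[/eqP z1 /eqP z2].
      by have := rank_subsp l; rewrite el z1 z2 addsmx0 mxrank0.
    have dc : d = c by case/orP: nz => z; [exact: eig z e1|exact: eig z e2].
    by split; apply/sub_kermxP; rewrite /N -sub_scal ?e1 ?e2 dc subrr.
  have e1' : k1 *m GLval g = c *: k1 by apply/eqP; rewrite -subr_eq0 sub_scal e1.
  have e2' : k2 *m GLval g = c *: k2 by apply/eqP; rewrite -subr_eq0 sub_scal e2.
  exists c; split => //.
  have lg : l *^ g = l.
    apply: subsp_inj; rewrite val_subact (eqmxMr _ el) addsmxMr el e1' e2'.
    by rewrite addsmxS // scalemx_sub.
  have [p pl] := on_ex l; have : p *^ g = p.
    apply/eqP; rewrite fixE; apply: submx_trans (pl : (val p <= val l)%MS) _.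
    by rewrite el addsmx_sub; apply/andP; split; apply/sub_kermxP.
  by move=> pg; have [] := tri _ _ pl pg lg.
have scalE : scalar g = (\rank N == 0%N).
  rewrite mxrank_eq0; apply/existsP/eqP => [[d /eqP gd]|N0]; last first.
    by exists c; rewrite -subr_eq0 -/N N0.
  by rewrite /N -(eig d u u0) ?gd ?subrr // mul_mx_scalar.
have nflagE : nflag g = \sum_l \sum_p ind (unip p l g).
  rewrite /nflag; apply: eq_bigr => l _; rewrite /fixl mulr_sumr; apply: eq_bigr => p _.
  by rewrite unipE /stabl !indM; ring.
have nfixE : nfix g * (q - 1) = q ^+ \rank (kermx N) - 1.
  by rewrite -sum_points; congr (_ * _); apply: eq_bigr => p _; rewrite fixE.
have q1 := q1_neq0 F.
split; last by apply/negP; rewrite inE => /forallP/(_ p0); rewrite pf0.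
rewrite sumrB -nflagE -mulr_sumr (eq_bigr _ (fun l _ => congr1 (fun b : bool => ind b) (kernE l))).
rewrite sum_lines_in scalE; move: nfixE; rewrite mxrank_ker.
case: (\rank N) rN => [|[|[|//]]] _ /= h.
- have -> : nfix g = n by apply: (mulIf q1); rewrite h /n; ring.
  by rewrite /n; ring.
- have -> : nfix g = q + 1 by apply: (mulIf q1); rewrite h; ring.
  by ring.
have -> : nfix g = 1 by apply: (mulIf q1); rewrite h; ring.
by ring.
Qed.

(* Third test function: it differs from a combination of the numbers of fixed
   flags and fixed points only at derangements and scalars. *)
Lemma class_identity g : \sum_l unip_test l g =
  nflag g - 3 * nfix g + 3 - 3 * ind (g \in der) - 3 * q ^+ 3 * ind (scalar g).
Proof.
have [gD|gD] := boolP (g \in der).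
  have [-> /negPf->] := identity_der gD.
  have fx p : (p *^ g == p) = false by move: gD; rewrite inE => /forallP/(_ p)/negPf.
  have -> : nfix g = 0 by rewrite /nfix big1 // => p _; rewrite fx.
  have -> : nflag g = 0.
    rewrite /nflag big1 // => l _; rewrite /fixl big1 ?mulr0 // => p _.
    by rewrite fx mulr0.
  by rewrite /=; ring.
have [p /eqP pg] : exists p, p *^ g == p.
  apply/existsP; apply: contraR gD; rewrite negb_exists => /forallP h.
  by rewrite inE; apply/forallP.
have [v v0 ev] := vec_of p; have /(fixes_vec _ ev)[c ec] : p *^ g == p by apply/eqP.
have [Q0|Q0] := eqVneq ((GLval g - c%:M) *m (GLval g - c%:M) *m (GLval g - c%:M)) 0.
  have /(nilpE g c)/identity_nilp[-> _] := Q0; rewrite /=; ring.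
have nn : ~ nilp g c by move/(nilpE g c)/eqP; apply/negP.
have nnd d : ~ nilp g d.
  by move=> gd; apply: nn; rewrite (eigen_nil v0 ec gd).
have [p' [m [h1 h2 h3 h4 h5]]] := fitting_antiflag v0 ec nn.
rewrite (unip_test_eq0 nnd) (antiflag_count h1 h2 h3 h4 h5).
have -> : scalar g = false by case: (boolP (scalar g)) => // /scalar_unip[d /nnd].
rewrite /=; ring.
Qed.

End ClassIdentity.

(** * Singer cycles and the bound on independent sets *)

Section Singer.
Variable F : finFieldType.
Local Notation gT := {'GL_3[F]}.
Local Notation pt := (PGpoint F).
Local Notation ln := (PGline F).
Local Notation der := (der F).
Implicit Types (p o : pt) (l m : ln) (g s x t d : gT).
Let q : rat := #|F|%:R.
Let n : rat := q ^+ 2 + q + 1.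
Let L := line_order F.

Lemma GL_inj : injective (fun x : gT => GLval x).
Proof. exact: val_inj. Qed.

(** Irreducibility of a derangement: fixing no point, it fixes no line either. *)
Lemma der_invariant d k (W : 'M[F]_(k, 3)) : d \in der -> (W *m GLval d <= W)%MS ->
  \rank W = 0%N \/ \rank W = 3%N.
Proof.
move=> dD h; move: (rank_leq_col W); case e : (\rank W) => [|[|[|[|//]]]] _; [by left| | |by right].
  have [p ep] := subsp_of e; have : p *^ d == p by rewrite subact_eqE (eqmxMr _ ep) ep.
  by move: dD; rewrite inE => /forallP/(_ p)/negPf->.
have [l el] := subsp_of e; have : l *^ d == l by rewrite subact_eqE (eqmxMr _ el) el.
by rewrite (negPf (der_no_line l dD)).
Qed.

Lemma ker_invariant (A X : 'M[F]_3) : X *m A = A *m X -> (kermx X *m A <= kermx X)%MS.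
Proof. by move=> h; apply/sub_kermxP; rewrite -mulmxA -h mulmxA mulmx_ker mul0mx. Qed.

Lemma rank0_mx k (W : 'M[F]_(k, 3)) : \rank W = 0%N -> W = 0.
Proof. by move/eqP; rewrite mxrank_eq0 => /eqP. Qed.

Lemma ker3 (X : 'M[F]_3) : \rank (kermx X) = 3%N -> X = 0.
Proof.
move=> r; have : ((1%:M : 'M[F]_3) <= kermx X)%MS by apply: submx_full; rewrite /row_full r.
by move/sub_kermxP; rewrite mul1mx.
Qed.

Lemma cent_comm d x : x \in 'C[d]%g -> GLval x *m GLval d = GLval d *m GLval x.
Proof. by move/cent1P => e; rewrite -!GL_MxE e. Qed.

(** Schur's lemma: the kernel of x - c is invariant under d and nonzero, hence everything. *)
Lemma cent_eigen d x (v : 'rV[F]_3) c : d \in der -> x \in 'C[d]%g -> v != 0 ->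
  v *m GLval x = c *: v -> GLval x = c%:M.
Proof.
move=> dD xC v0 e; have comm : (GLval x - c%:M) *m GLval d = GLval d *m (GLval x - c%:M).
  by rewrite mulmxBl mulmxBr mul_mx_scalar mul_scalar_mx cent_comm.
have vk : (v <= kermx (GLval x - c%:M))%MS by apply/sub_kermxP; rewrite -sub_scal e subrr.
have [/rank0_mx k0|/ker3/eqP] := der_invariant dD (ker_invariant comm).
  by move: vk; rewrite k0 submx0 (negPf v0).
by rewrite subr_eq0 => /eqP.
Qed.

Lemma cent_der d x : d \in der -> x \in 'C[d]%g -> (x \in der) = ~~ scalar x.
Proof.
move=> dD xC; have [/existsP[c /eqP e]|sx] := boolP (scalar x).
  apply/negP => /derP/(_ (delta_mx 0 0) c); case; last by rewrite e mul_mx_scalar.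
  by apply/eqP => /rowP/(_ 0)/eqP; rewrite !mxE !eqxx oner_eq0.
apply/derP => v c v0 e; case/negP: sx; apply/existsP; exists c.
by rewrite (cent_eigen dD xC v0 e).
Qed.

Lemma der_frame d (v : 'rV[F]_3) : d \in der -> v != 0 ->
  row3 v (v *m GLval d) (v *m GLval d *m GLval d) \in unitmx.
Proof.
move=> dD v0; have r2 : \rank (v + v *m GLval d)%MS = 2.
  have [p ep] := point_of v0.
  have e' : (val (p *^ d) :=: v *m GLval d)%MS by apply: eqmx_trans (val_subact _ _) (eqmxMr _ ep).
  apply: rank2_vec ep e'; rewrite eq_sym.
  by move: dD; rewrite inE => /forallP/(_ p).
apply: row3_unit_ext => //; apply/negP => h.
have : ((v + v *m GLval d)%MS *m GLval d <= v + v *m GLval d)%MS.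
  by rewrite addsmxMr addsmx_sub addsmxSr h.
by case/(der_invariant dD); rewrite r2.
Qed.

(** Evaluation at a nonzero vector v is a bijection from the centralizer onto the nonzero vectors.
    It is injective by [cent_eigen], and onto because the quadratic polynomials in d already map v
    to every vector. *)
Lemma card_cent d : d \in der -> #|'C[d]%g|%:R = q ^+ 3 - 1 :> rat.
Proof.
move=> dD; pose v : 'rV[F]_3 := delta_mx 0 0.
have v0 : v != 0 by apply/eqP => /rowP/(_ 0)/eqP; rewrite !mxE !eqxx oner_eq0.
have inj : {in 'C[d]%g &, injective (fun x : gT => v *m GLval x)}.
  move=> x y xC yC e; have : v *m GLval (x * y^-1)%g = 1 *: v.
    by rewrite GL_MxE mulmxA e GL_VxE mulmxK ?GL_unitmx // scale1r.
  move/(cent_eigen dD (groupM xC (groupVr yC)) v0) => e1.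
  suff : (x * y^-1)%g = 1%g by move/eqP; rewrite -eq_mulgV1 => /eqP.
  exact: val_inj.
rewrite -(card_in_imset inj).
have -> : [set v *m GLval x | x : gT in 'C[d]%g] = [set~ 0].
  apply/setP => w; rewrite !inE; apply/imsetP/idP => [[x xC ->]|w0].
    apply: contraNneq v0 => /(congr1 (mulmx^~ (invmx (GLval x)))).
    by rewrite mulmxK ?GL_unitmx // mul0mx => ->.
  have U := der_frame dD v0.
  have [a [b [c e]]] := vec3_ex (w *m invmx (row3 v (v *m GLval d) (v *m GLval d *m GLval d))).
  have ew : w = a *: v + b *: (v *m GLval d) + c *: (v *m GLval d *m GLval d).
    by rewrite -mulmx_row3 -e mulmxKV.
  pose X : 'M[F]_3 := a%:M + b *: GLval d + c *: (GLval d *m GLval d).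
  have vX : v *m X = w.
    by rewrite ew !mulmxDr mul_mx_scalar -!scalemxAr mulmxA.
  have comm : X *m GLval d = GLval d *m X.
    by rewrite /X !mulmxDl !mulmxDr mul_mx_scalar mul_scalar_mx -!scalemxAl -!scalemxAr mulmxA.
  have UX : X \in unitmx.
    rewrite -row_free_unit -kermx_eq0.
    have [/rank0_mx -> //|/ker3 X0] := der_invariant dD (ker_invariant comm).
    by case/eqP: w0; rewrite -vX X0 mulmx0.
  have [x ex] := GL_of UX; exists x; last by rewrite ex vX.
  by apply/cent1P; apply: GL_inj; rewrite !GL_MxE ex.
rewrite cardsC1 card_mx mul1n -subn1 natrB ?natrX //.
by rewrite expn_gt0; apply/orP; left; apply/card_gt0P; exists 0.
Qed.

Lemma scalar_of (c : F) : c != 0 -> {x : gT | GLval x = c%:M}.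
Proof. by move=> c0; apply: GL_of; rewrite unitmxE det_scalar unitfE expf_neq0. Qed.

Lemma sum_scalar : \sum_(x : gT) ind (scalar x) = q - 1.
Proof.
rewrite -sum_nz.
have ex (c : F) : exists x : gT, c != 0 -> GLval x = c%:M.
  have [->|/scalar_of[x e]] := eqVneq c 0; first by exists 1%g.
  by exists x.
have [X XE] := fin_all_exists ex.
have uniq (c d : F) : (c%:M : 'M[F]_3) = d%:M -> c = d.
  by move/matrixP/(_ 0 0); rewrite !mxE eqxx.
rewrite (eq_bigr (fun x => \sum_(c : F | c != 0) ind (x == X c))) => [|x _].
  rewrite exchange_big /= [RHS](eq_bigr (fun c : F => if c != 0 then 1 else 0)).
    by rewrite -big_mkcond; apply: eq_bigr => c _; rewrite sum_ind1.
  by move=> c _; case: ifP.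
have [/existsP[c /eqP e]|sx] := boolP (scalar x).
  have c0 : c != 0.
    have := GL_unitmx x; rewrite e unitmxE det_scalar unitfE.
    by apply: contraNneq => ->; rewrite expr0n.
  rewrite (bigD1 c) //= big1 => [|d /andP[d0 dc]].
    have -> : x = X c by apply: GL_inj; rewrite e XE.
    by rewrite eqxx addr0.
  case: eqP => // h; case/eqP: dc; apply: uniq; rewrite -XE // -h e //.
rewrite big1 // => c c0; case: eqP => // h; case/negP: sx.
by apply/existsP; exists c; rewrite h XE.
Qed.

Lemma scalarM x y : scalar x -> scalar (x * y)%g = scalar y.
Proof.
case/existsP=> c /eqP e; have c0 : c != 0.
  have := GL_unitmx x; rewrite e unitmxE det_scalar unitfE.
  by apply: contraNneq => ->; rewrite expr0n.
apply/existsP/existsP => -[d /eqP h].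
  exists (c^-1 * d); move: h; rewrite GL_MxE e mul_scalar_mx => h.
  by rewrite -scale_scalar_mx -h scalerA mulVf // scale1r.
by exists (c * d); rewrite GL_MxE e h mul_scalar_mx scale_scalar_mx.
Qed.

Section Independent.
Variable S : {set gT}.
Hypothesis indep : forall x y, x \in S -> y \in S -> (x * y^-1)%g \notin der.

(** Two elements of S in one coset differ by an element of the centralizer that is not a
    derangement, that is, by a scalar. *)
Lemma cent_coset_le d g : d \in der ->
  \sum_c ind (c \in 'C[d]%g) * ind ((c * g)%g \in S) <= q - 1.
Proof.
move=> dD.
have [/existsP[c0 /andP[c0C c0g]]|/existsPn h] := boolP [exists c, (c \in 'C[d]%g) && ((c * g)%g \in S)]; last first.
  rewrite big1 ?subr_ge0 ?(ltW (q_gt1 F)) // => c _; by rewrite -indM (negPf (h c)).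
rewrite -sum_scalar [leRHS](reindex_inj (mulIg c0^-1)%g); apply: ler_sum => c _ /=.
rewrite -indM; case: andP => [[cC cg]|_]; last exact: ler0n.
have := indep cg c0g; rewrite invMg mulgA mulgK.
rewrite (cent_der dD) ?groupM ?groupV // negbK => h; by rewrite [ind (scalar _)](_ : _ = 1) // h.
Qed.

Lemma sum_cent_cosets d : d \in der ->
  \sum_g \sum_c ind (c \in 'C[d]%g) * ind ((c * g)%g \in S) = (q ^+ 3 - 1) * \sum_x ind (x \in S).
Proof.
move=> dD; rewrite exchange_big -(card_cent dD) natr_card mulr_suml; apply: eq_bigr => c _ /=.
by rewrite -mulr_sumr; congr (_ * _); rewrite [RHS](reindex_inj (mulgI c)).
Qed.

Lemma der_ex : exists d, d \in der.
Proof.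
apply/existsP; apply: contraT; rewrite negb_exists => /forallP h; exfalso.
have := card_der F; rewrite big1 => [|x _]; last by rewrite (negPf (h x)).
have := n1_neq0 F; have := line_order_neq0 F; rewrite -/q -/n mulr0 => h1 h2 /esym/eqP.
by rewrite mulf_eq0 (negPf h1) (negPf h2).
Qed.

Lemma indep_bound : \sum_x ind (x \in S) <= L.
Proof.
have [d dD] := der_ex; have q1 := q_gt1 F; rewrite -/q in q1.
have h : (q ^+ 3 - 1) * \sum_x ind (x \in S) <= (q - 1) * (n * L).
  rewrite -(sum_cent_cosets dD) -gG_line /gG mulrC -sum_const_rat; apply: ler_sum => g _.
  exact: cent_coset_le.
have e : (q - 1) * (n * L) = (q ^+ 3 - 1) * L by rewrite /n; ring.
by move: h; rewrite e ler_pM2l // subr_gt0 exprn_egt1 // .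
Qed.

Hypothesis card_S : \sum_x ind (x \in S) = L.

Lemma cent_coset_eq d g : d \in der ->
  \sum_c ind (c \in 'C[d]%g) * ind ((c * g)%g \in S) = q - 1.
Proof.
move=> dD; apply/eqP; rewrite eq_sym -subr_eq0.
have : \sum_g (q - 1 - \sum_c ind (c \in 'C[d]%g) * ind ((c * g)%g \in S)) = 0.
  rewrite sumrB sum_cent_cosets // card_S sum_const_rat -/(gG F) gG_line -/q -/n -/L /n; ring.
move/eqP; rewrite psumr_eq0 => [|x _]; last by rewrite subr_ge0 cent_coset_le.
by move/allP/(_ g); rewrite mem_index_enum => /(_ isT).
Qed.

(** In the application S is the full preimage of a subset of PGL_3, hence closed under scalars. *)
Hypothesis scal_S : forall z x, scalar z -> x \in S -> (z * x)%g \in S.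

Lemma scal_SE z x : scalar z -> ((z * x)%g \in S) = (x \in S).
Proof.
move=> sz; apply/idP/idP => [h|]; last exact: scal_S.
have -> : x = (z^-1 * (z * x))%g by rewrite mulKg.
apply: scal_S => //; rewrite -(scalarM z^-1 sz) mulgV.
by apply/existsP; exists 1.
Qed.

(** Sum [cent_coset_eq] over all derangements d and collect the contributions of each c: a scalar
    commutes with all derangements, a derangement with (q^3 - 1) - (q - 1) of them, and any other
    element with none. *)
Lemma der_sum g : 3 * \sum_d ind (d \in der) * ind ((d * g)%g \in S) = L * (1 - ind (g \in S)).
Proof.
pose D := \sum_d ind (d \in der).
have e1 : \sum_d ind (d \in der) * \sum_c ind (c \in 'C[d]%g) * ind ((c * g)%g \in S) = D * (q - 1).
  rewrite /D mulr_suml; apply: eq_bigr => d _; case: (boolP (d \in der)) => dD; last by rewrite !mul0r.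
  by rewrite cent_coset_eq.
have W c : \sum_d ind (d \in der) * ind (c \in 'C[d]%g) =
    D * ind (scalar c) + (q ^+ 3 - q) * ind (c \in der).
  have [sc|sc] := boolP (scalar c).
    have /negPf-> : c \notin der.
      case/existsP: sc => a /eqP e; apply/negP => /derP/(_ (delta_mx 0 0) a); case; last by rewrite e mul_mx_scalar.
      by apply/eqP => /rowP/(_ 0)/eqP; rewrite !mxE !eqxx oner_eq0.
    rewrite mulr0 addr0 mulr1; apply: eq_bigr => d _; suff -> : c \in 'C[d]%g by rewrite mulr1.
    case/existsP: sc => a /eqP e; apply/cent1P; apply: GL_inj.
    by rewrite !GL_MxE e mul_mx_scalar mul_scalar_mx.
  rewrite mulr0 add0r; have [cD|cD] := boolP (c \in der); last first.
    rewrite mulr0 big1 // => d _; rewrite -indM; case: andP => // -[dD cC].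
    by rewrite (cent_der dD cC) sc in cD.
  rewrite mulr1; transitivity (\sum_d (ind (d \in 'C[c]%g) - ind (scalar d))); last first.
    by rewrite sumrB -natr_card card_cent // sum_scalar; ring.
  apply: eq_bigr => d _; rewrite cent1C; case: (boolP (d \in 'C[c]%g)) => dC.
    by rewrite (cent_der cD dC) indN mulr1.
  rewrite mulr0; suff /negPf -> : ~~ scalar d by rewrite subrr.
  apply: contra dC => /existsP[a /eqP e]; apply/cent1P; apply: GL_inj.
  by rewrite !GL_MxE e mul_mx_scalar mul_scalar_mx.
have eD : 3 * D = (n - 1) * L by exact: card_der.
clearbody D.
have e2 : D * (q - 1) = D * ((q - 1) * ind (g \in S)) + (q ^+ 3 - q) * \sum_d ind (d \in der) * ind ((d * g)%g \in S).
  rewrite -e1 (eq_bigr (fun d => \sum_c ind (d \in der) * ind (c \in 'C[d]%g) * ind ((c * g)%g \in S))); last first.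
    by move=> d _; rewrite mulr_sumr; apply: eq_bigr => c _; rewrite mulrA.
  rewrite exchange_big /= -sum_scalar mulr_suml [X in _ = X + _]mulr_sumr [X in _ = _ + X]mulr_sumr -big_split; apply: eq_bigr => c _ /=.
  rewrite -mulr_suml W; have [sc|sc] := boolP (scalar c); last by rewrite (_ : ind false = 0) //; ring.
  by rewrite scal_SE // (_ : ind true = 1) //; ring.
have z : q ^+ 3 - q != 0.
  have := q_gt1 F; rewrite -/q => q1; rewrite gt_eqF // (_ : _ - _ = q * (q - 1) * (q + 1)); last by ring.
  by rewrite !mulr_gt0 ?subr_gt0 ?addr_gt0 // (lt_trans ltr01 q1).
apply: (mulfI z); rewrite mulrCA.
have -> : (q ^+ 3 - q) * \sum_d ind (d \in der) * ind ((d * g)%g \in S) = D * ((q - 1) * (1 - ind (g \in S))).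
  by apply/eqP; rewrite -subr_eq0; apply/eqP; transitivity (D * ((q - 1) * ind (g \in S)) +
    (q ^+ 3 - q) * \sum_d ind (d \in der) * ind ((d * g)%g \in S) - D * (q - 1)); [ring|rewrite -e2 subrr].
by rewrite [LHS]mulrA eD /n; ring.
Qed.

(* Double counting of the triples [(x, s, d)] with [x s = d] a derangement, using
   that S meets [der * g] in a number of elements depending only on [g \in S]. *)
Lemma master (h : gT -> rat) : (forall x, h x^-1%g = h x) ->
  \sum_s ind (s \in S) * (L * h s + 3 * \sum_x h x * ind ((x * s)%g \in der)) = L * \sum_x h x.
Proof.
move=> hV.
have e : \sum_g h g * (3 * \sum_d ind (d \in der) * ind ((d * g)%g \in S)) =
   \sum_g h g * (L * (1 - ind (g \in S))).
  by apply: eq_bigr => g _; rewrite der_sum.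
have e' : \sum_s ind (s \in S) * (3 * \sum_x h x * ind ((x * s)%g \in der)) =
   \sum_g h g * (3 * \sum_d ind (d \in der) * ind ((d * g)%g \in S)).
  transitivity (\sum_s \sum_g 3 * h g * ind ((s * g^-1)%g \in der) * ind (s \in S)).
    apply: eq_bigr => s _; rewrite (reindex_inj invg_inj) mulrCA mulr_sumr mulr_sumr.
    by apply: eq_bigr => g _; rewrite hV derC; ring.
  rewrite exchange_big; apply: eq_bigr => g _; rewrite mulrCA !mulr_sumr.
  rewrite (reindex_inj (mulIg g)); apply: eq_bigr => d _; rewrite mulgK; ring.
rewrite (eq_bigr (fun s => L * (ind (s \in S) * h s) + ind (s \in S) * (3 * \sum_x h x * ind ((x * s)%g \in der)))); last first.
  by move=> s _; ring.
rewrite big_split /= e' e -big_split /= mulr_sumr; apply: eq_bigr => g _; ring.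
Qed.

End Independent.
End Singer.

(** * Average number of fixed points *)

Section FixedPoints.
Variable F : finFieldType.
Local Notation gT := {'GL_3[F]}.
Local Notation pt := (PGpoint F).
Local Notation ln := (PGline F).
Local Notation der := (der F).
Implicit Types (p o : pt) (l m : ln) (g s x t d : gT).
Let q : rat := #|F|%:R.
Let n : rat := q ^+ 2 + q + 1.
Let L := line_order F.
Let c2 : rat := q ^+ 2 * (q - 1) ^+ 3.

(** Used to extract a = b from a known relation u = v: [ring] checks that the relation is K times
    the wanted one. *)
Lemma eq_of_multiple (K a b u v : rat) : K != 0 -> u = v -> K * (a - b) = u - v -> a = b.
Proof.
move=> K0 -> /eqP; rewrite subrr mulf_eq0 (negPf K0) /= subr_eq0.
by move/eqP.
Qed.

Lemma nfixV x : nfix x^-1%g = nfix x.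
Proof. by apply: eq_bigr => p _; rewrite subact_eqV invgK eq_sym. Qed.

Lemma fixlV l x : fixl l x^-1%g = fixl l x.
Proof. by apply: eq_bigr => p _; rewrite subact_eqV invgK [p == _]eq_sym. Qed.

Lemma stablV l x : stabl l x^-1%g = stabl l x.
Proof. by rewrite /stabl subact_eqV invgK eq_sym. Qed.

Lemma nflagV x : nflag x^-1%g = nflag x.
Proof. by apply: eq_bigr => l _; rewrite stablV fixlV. Qed.

Lemma detV x : \det (GLval x^-1%g) = (\det (GLval x))^-1.
Proof. by rewrite GL_VxE det_inv. Qed.

Lemma ncbrtV (b : F) : ncbrt b^-1 = ncbrt b.
Proof.
rewrite !ncbrtE (reindex_inj invr_inj); apply: eq_bigr => z _.
by rewrite exprVn (inj_eq invr_inj).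
Qed.

Lemma unipV p l x : unip p l x^-1%g = unip p l x.
Proof.
suff h y : unip p l y -> unip p l y^-1%g by apply/idP/idP => [/h|/h //]; rewrite invgK.
move=> uy; have py := unip_fix uy; case/andP: uy => pl /existsP[c /and3P[/eqP h1 h2 /eqP h3]].
have c0 : c != 0.
  by have := detGL_neq0 y; rewrite h3; apply: contraNneq => ->; rewrite expr0n.
have UY := GL_unitmx y; rewrite /unip pl; apply/existsP; exists c^-1.
have e1 : val p *m GLval y^-1%g = c^-1 *: val p.
  apply: (can_inj (mulmxK UY)); rewrite GL_VxE mulmxKV // -scalemxAl h1 scalerA mulVf //.
  by rewrite scale1r.
rewrite e1 eqxx detV h3 exprVn eqxx andbT /=.
have -> : val l *m GLval y^-1%g - c^-1 *: val l =
   (- c^-1) *: ((val l *m GLval y - c *: val l) *m GLval y^-1%g).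
  rewrite mulmxBl GL_VxE mulmxK // -scalemxAl scalerBr scalerA mulNr mulVf //.
  by rewrite scaleNr scaleN1r opprK addrC.
apply: scalemx_sub; apply: submx_trans (submxMr _ h2) _.
by rewrite e1 scalemx_sub.
Qed.

Lemma kernV l x : kern l x^-1%g = kern l x.
Proof.
have [p pl] := on_ex l; have [o ol op] := other_on pl.
by rewrite !(kern_unip _ pl ol op) unipV subact_eqV invgK [o == _]eq_sym.
Qed.

Lemma unip_testV l x : unip_test l x^-1%g = unip_test l x.
Proof.
by rewrite /unip_test kernV; congr (_ - _); apply: eq_bigr => p _; rewrite unipV.
Qed.

(** Homologies with axis l spread the determinant uniformly without changing h, and [ncbrt] has mean
    1. *)
Lemma sum_weighted l (h : gT -> rat) : (forall t x, t \in homol l -> h (t * x)%g = h x) ->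
  \sum_x ncbrt (\det (GLval x)) * h x = \sum_x h x.
Proof.
move=> h_inv; have z : q ^+ 2 * (q - 1) != 0 by rewrite mulf_neq0 ?expf_neq0 ?q_neq0 ?q1_neq0.
apply: (mulfI z); rewrite -[X in X * _](sum_homol l) mulr_suml.
rewrite (eq_bigr (fun t => \sum_x h x * (ncbrt (\det (GLval t) * \det (GLval x)) * ind (t \in homol l)))); last first.
  move=> t _; case: (boolP (t \in homol l)) => tH; last first.
    by rewrite mul0r big1 // => x _; rewrite !mulr0.
  rewrite mul1r (reindex_inj (mulgI t)); apply: eq_bigr => x _.
  by rewrite h_inv // GL_MxE det_mulmx (_ : ind true = 1) //; ring.
rewrite exchange_big mulr_sumr; apply: eq_bigr => x _.
rewrite -mulr_sumr mulrC; congr (_ * _).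
rewrite (eq_bigr (fun t => \sum_(c | c != 0) ncbrt (c * \det (GLval x)) *
   ind ((t \in homol l) && (\det (GLval t) == c)))); last first.
  move=> t _; rewrite -[LHS](sum_det t (fun c => ncbrt (c * \det (GLval x)) * ind (t \in homol l))).
  by apply: eq_bigr => c _; rewrite indM; ring.
rewrite exchange_big (eq_bigr (fun c => ncbrt (c * \det (GLval x)) * q ^+ 2)) => [|c c0].
  by rewrite -mulr_suml sum_ncbrt ?detGL_neq0 // mulrC.
by rewrite -mulr_sumr sum_homol_det.
Qed.

Lemma sum_nflag : \sum_(x : gT) nflag x = n * L.
Proof.
rewrite exchange_big (eq_bigr (fun=> L)) => [|l _]; last by rewrite sum_stab_fix.
by rewrite sum_const_rat card_ln.
Qed.

Lemma sum_ncbrt_nflag : \sum_(x : gT) ncbrt (\det (GLval x)) * nflag x = n * L.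
Proof.
under eq_bigr do rewrite mulr_sumr; rewrite exchange_big (eq_bigr (fun=> L)) => [|l _].
  by rewrite sum_const_rat card_ln.
rewrite (@sum_weighted l (fun x => stabl l x * fixl l x)) ?sum_stab_fix // => t x tH.
by rewrite stabl_homol // fixl_homol.
Qed.

Lemma sum_ncbrt_nfix : \sum_(x : gT) ncbrt (\det (GLval x)) * nfix x = n * L.
Proof.
under eq_bigr do rewrite nfix_lines mulr_sumr; rewrite exchange_big (eq_bigr (fun=> L)) => [|l _].
  by rewrite sum_const_rat card_ln.
rewrite -[RHS](sum_stabl l) -[RHS](@sum_weighted l (stabl l)) // => t x tH.
exact: stabl_homol.
Qed.

Variable S : {set gT}.
Hypothesis indep : forall x y, x \in S -> y \in S -> (x * y^-1)%g \notin der.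
Hypothesis card_S : \sum_x ind (x \in S) = L.
Hypothesis scal_S : forall z x, scalar z -> x \in S -> (z * x)%g \in S.
Hypothesis S1 : 1%g \in S.
Hypothesis q_neq2 : q != 2.

Let f s := ind (s \in S).
Let r s := ncbrt (\det (GLval s)).
Let X := \sum_s f s * nfix s.
Let C := \sum_s f s * nflag s.
Let X' := \sum_s f s * r s * nfix s.
Let C' := \sum_s f s * r s * nflag s.
Let s' := \sum_s f s * r s.
Let P := \sum_s f s * \sum_l unip_test l s.

Let expand A B D : \sum_s f s * ((n - r s) * (A + B * nfix s + D * nflag s)) =
  A * (n * L - s') + B * (n * X - X') + D * (n * C - C').
Proof.
rewrite (eq_bigr (fun s => A * (n * f s - f s * r s) + B * (n * (f s * nfix s) - f s * r s * nfix s)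
  + D * (n * (f s * nflag s) - f s * r s * nflag s))) => [|s _]; last by ring.
by rewrite !big_split /= -!mulr_sumr !sumrB -!mulr_sumr card_S.
Qed.

Let expand1 A B D : \sum_s f s * (A + B * nfix s + D * nflag s) = A * L + B * X + D * C.
Proof.
rewrite (eq_bigr (fun s => A * f s + B * (f s * nfix s) + D * (f s * nflag s))) => [|s _]; last by ring.
by rewrite !big_split /= -!mulr_sumr card_S.
Qed.

Let eL : L = q ^+ 3 * (q - 1) ^+ 3 * (q + 1). Proof. by []. Qed.
Let c20 : c2 != 0. Proof. by rewrite mulf_neq0 ?expf_neq0 ?q_neq0 ?q1_neq0. Qed.
Let qq0 : q * (q + 1) != 0.
Proof. by have := q_gt1 F; rewrite -/q => h; rewrite mulf_neq0 // gt_eqF //; lra. Qed.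
Let n0 : n != 0. Proof. exact: n_neq0. Qed.

(** The weight matters: with weight 1 the terms in X cancel because L = (n - 1) c2, and nothing
    would be learnt. *)
Let eq_X' : X' = X + s' - L.
Proof.
have hV x : ncbrt (\det (GLval x^-1%g)) * nfix x^-1%g = ncbrt (\det (GLval x)) * nfix x.
  by rewrite detV ncbrtV nfixV.
have := master indep card_S scal_S hV; rewrite -/L; rewrite sum_ncbrt_nfix.
rewrite (eq_bigr (fun s => L * (f s * r s * nfix s) +
   c2 * (f s * ((n - r s) * (n + (-1) * nfix s + 0 * nflag s))))); last first.
  move=> s _; rewrite (test_nfix s (@balanced_ncbrt F)) -/q -/n -/c2 /r /f; ring.
rewrite big_split /= -!mulr_sumr expand -/X' => h.
apply: (eq_of_multiple (mulf_neq0 c20 n0) h); rewrite eL /c2 /n; ring.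
Qed.

Let eq_C : C = 2 * X - L.
Proof.
have := master indep card_S scal_S nflagV; rewrite -/L; rewrite sum_nflag => /(congr1 ( *%R (q ^+ 2))).
rewrite mulr_sumr (eq_bigr (fun s => q ^+ 2 * L * (f s * nflag s) + q * (q + 1) * c2 *
   (f s * (n * (q ^+ 2 + 1) + (- (q ^+ 2 + 1) - (q + 1) ^+ 2) * nfix s + (q + 1) * nflag s)))); last first.
  move=> s _; have := test_nflag s (@balanced_one F); rewrite -/q -/n -/c2 => e.
  transitivity (f s * (q ^+ 2 * L * nflag s + 3 * q ^+ 2 * \sum_x nflag x * ind ((x * s)%g \in der))).
    by rewrite /f; ring.
  under [X in 3 * q ^+ 2 * X]eq_bigr do rewrite -[nflag _]mul1r.
  by rewrite e /n; ring.
rewrite big_split /= -!mulr_sumr expand1 -/C => h.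
apply: (eq_of_multiple (mulf_neq0 (mulf_neq0 qq0 c20) n0) h); rewrite eL /c2 /n; ring.
Qed.

Let eq_C' : C' = C + s' - L.
Proof.
have hV x : ncbrt (\det (GLval x^-1%g)) * nflag x^-1%g = ncbrt (\det (GLval x)) * nflag x.
  by rewrite detV ncbrtV nflagV.
have := master indep card_S scal_S hV; rewrite -/L; rewrite sum_ncbrt_nflag => /(congr1 ( *%R (q ^+ 2))).
rewrite mulr_sumr (eq_bigr (fun s => q ^+ 2 * L * (f s * r s * nflag s) + c2 *
   (f s * ((n - r s) * (n * (q ^+ 2 + 1) + (- (q ^+ 2 + 1) - (q + 1) ^+ 2) * nfix s + (q + 1) * nflag s))))); last first.
  move=> s _; have := test_nflag s (@balanced_ncbrt F); rewrite -/q -/n -/c2 => e.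
  transitivity (f s * (q ^+ 2 * L * (r s * nflag s) + 3 * q ^+ 2 *
     \sum_x ncbrt (\det (GLval x)) * nflag x * ind ((x * s)%g \in der))).
    by rewrite /f /r; ring.
  by rewrite e /r; ring.
rewrite big_split /= -!mulr_sumr expand -/C' eq_X' eq_C => h.
have qq1 : q + 1 != 0 by move: qq0; rewrite mulf_eq0 negb_or => /andP[].
have K0 := mulf_neq0 (mulf_neq0 (mulf_neq0 qq1 c20) (q1_neq0 F)) n0.
apply: (eq_of_multiple K0 h); rewrite eL /c2 /n; ring.
Qed.

Let not_der s : s \in S -> s \notin der.
Proof. by move=> sS; have := indep sS S1; rewrite invg1 mulg1. Qed.

Let scalar_S s : scalar s -> s \in S.
Proof. by move=> ss; rewrite -[s]mulg1; apply: scal_S. Qed.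

(** [class_identity] summed over S, which contains no derangement, as 1 is in S, and all q - 1
    scalars. *)
Let eq_P : P = C - 3 * X + 3 * L - 3 * q ^+ 3 * (q - 1).
Proof.
rewrite /P (eq_bigr (fun s => f s * (3 + (-3) * nfix s + 1 * nflag s) - 3 * q ^+ 3 * ind (scalar s))).
  by rewrite sumrB -mulr_sumr expand1 sum_scalar; ring.
move=> s _; rewrite class_identity /f; have [sS|sS] := boolP (s \in S).
  by rewrite (negPf (not_der sS)) /=; ring.
have -> : scalar s = false by apply: contraNF sS; exact: scalar_S.
by rewrite /=; ring.
Qed.

Let r1 := ncbrt (1 : F).

(** The unipotent test function lives on elements whose determinant is a cube, where the weight r is
    constantly r1; so weighting [class_identity] by r multiplies the left side by r1. *)
Let eq_P' : r1 * P = C' - 3 * X' + 3 * s' - 3 * q ^+ 3 * r1 * (q - 1).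
Proof.
transitivity (\sum_s (3 * (f s * r s) + (-3) * (f s * r s * nfix s) + f s * r s * nflag s
   - 3 * q ^+ 3 * r1 * ind (scalar s))); last first.
  by rewrite sumrB !big_split /= -!mulr_sumr sum_scalar -/q /C' /X' /s'; ring.
rewrite mulr_sumr; apply: eq_bigr => s _.
have -> : r1 * (f s * \sum_l unip_test l s) = f s * r s * \sum_l unip_test l s.
  rewrite mulrA [r1 * _]mulrC -!mulrA; congr (_ * _); rewrite !mulr_sumr; apply: eq_bigr => l _.
  have [->|/unip_test_det[c c0 e]] := eqVneq (unip_test l s) 0; first by rewrite !mulr0.
  by rewrite /r e -[c ^+ 3]mulr1 ncbrt_cube.
have rs : r s * ind (scalar s) = r1 * ind (scalar s).
  have [/existsP[c /eqP e]|_] := boolP (scalar s); last by rewrite !mulr0.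
  have c0 : c != 0.
    by have := detGL_neq0 s; rewrite e det_scalar; apply: contraNneq => ->; rewrite expr0n.
  by rewrite /r e det_scalar -[c ^+ 3]mulr1 ncbrt_cube.
rewrite class_identity; have [sS|sS] := boolP (s \in S).
  transitivity (f s * r s * (nflag s - 3 * nfix s + 3 - 3 * ind (s \in der))
     - f s * 3 * q ^+ 3 * (r s * ind (scalar s))); first by ring.
  by rewrite rs (negPf (not_der sS)) /f sS /=; ring.
have -> : scalar s = false by apply: contraNF sS; exact: scalar_S.
by rewrite /f (negPf sS) /=; ring.
Qed.

(** The relation for the unipotent test function, with P, X', C, C' eliminated. Together with
    [eq_P'] it determines X and s' unless q = 2, where it is void. *)
Let eq_test : (q - 2) * (q * (q + 1) * (X - 2 * L) + (s' - L)) = 0.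
Proof.
have hV x : \sum_l unip_test l x^-1%g = \sum_l unip_test l x.
  by apply: eq_bigr => l _; rewrite unip_testV.
have := master indep card_S scal_S hV; rewrite -/L.
rewrite [X in _ = L * X]exchange_big [X in _ = L * X](eq_bigr _ (fun l _ => unip_test_sum l)).
rewrite sum_const_rat card_ln -/q -/n.
rewrite (eq_bigr (fun s => L * (f s * \sum_l unip_test l s) + (q - 1) *
   (f s * ((n - r s) * (n * (q ^+ 2 - 3 * q + 1) + ((2 * q - 1) * (q + 1) - (q ^+ 2 - 3 * q + 1)) * nfix s
      + (- (2 * q - 1)) * nflag s))))); last first.
  by move=> s _; rewrite mulrDr test_unip -/q -/n /r /f; ring.
rewrite big_split /= -!mulr_sumr expand -/P eq_P eq_C' eq_X' eq_C => h.
have K0 : - ((q - 1) * q ^+ 3) != 0 by rewrite oppr_eq0 mulf_neq0 ?expf_neq0 ?q_neq0 ?q1_neq0.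
apply: (eq_of_multiple K0 h); rewrite eL /n; ring.
Qed.

Lemma sum_fixed_points : \sum_s ind (s \in S) * nfix s = 2 * L.
Proof.
rewrite -/X; have := eq_test; move/eqP; rewrite mulf_eq0 subr_eq0 (negPf q_neq2) /= => /eqP e1.
(* Comparison of r1 times [eq_P] with [eq_P']. Inserted into the previous relation it leaves (q (q +
   1) + 1 - r1) (X - 2 L) = 0, whose first factor is n - r1. *)
have e2 : s' - L = (1 - r1) * (X - 2 * L).
  have := eq_P'; rewrite eq_P eq_C' eq_X' eq_C => h.
  by apply: (eq_of_multiple (oner_neq0 _) (esym h)); ring.
have K0 : n - r1 != 0.
  rewrite subr_eq0; apply: contraTneq (q_gt1 F) => e.
  have : r1 <= q by rewrite /r1 /ncbrt ler_nat max_card.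
  rewrite -e /n -/q => h; rewrite -leNgt; nra.
apply: (eq_of_multiple K0 e1); rewrite e2 /n; ring.
Qed.

End FixedPoints.

(** * Projection on the permutation module *)

Section DegreeOne.
Variable F : finFieldType.
Local Notation gT := {'GL_3[F]}.
Local Notation pt := (PGpoint F).
Local Notation ln := (PGline F).
Local Notation der := (der F).
Implicit Types (p o a b : pt) (l m : ln) (g s x t d : gT).
Let q : rat := #|F|%:R.
Let n : rat := q ^+ 2 + q + 1.
Let L := line_order F.
Let c2 : rat := q ^+ 2 * (q - 1) ^+ 3.

Variable S : {set gT}.
Hypothesis indep : forall x y, x \in S -> y \in S -> (x * y^-1)%g \notin der.
Hypothesis card_S : \sum_x ind (x \in S) = L.
Hypothesis scal_S : forall z x, scalar z -> x \in S -> (z * x)%g \in S.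
Hypothesis q_neq2 : q != 2.

Definition moves a b : rat := \sum_g ind (g \in S) * ind (a *^ g == b).

(** Up to an affine change, the projection of the indicator of S on the span of the functions
    [a^g = b]; by [weightE] also the total number of fixed points in the translate of S by the
    inverse of g. *)
Definition weight g : rat := \sum_a moves a (a *^ g).

Lemma weightE g : weight g = \sum_s ind (s \in S) * nfix (s * g^-1)%g.
Proof.
rewrite /weight /moves exchange_big; apply: eq_bigr => s _ /=; rewrite /nfix mulr_sumr; apply: eq_bigr => p _.
by rewrite subact_mul -[in RHS](inj_eq (@subact_inj _ _ g)) subactKV.
Qed.

(** The translate of S by the inverse of g contains 1 and inherits all hypotheses, so its average
    number of fixed points is 2. *)
Lemma weight_in g : g \in S -> weight g = 2 * L.
Proof.
move=> gS; rewrite weightE; pose T := (S :* g^-1)%g.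
have TE x : (x \in T) = ((x * g)%g \in S) by rewrite mem_rcoset invgK.
have h := @sum_fixed_points F T _ _ _ _ q_neq2.
rewrite -h ?TE ?mul1g //.
- rewrite [RHS](reindex_inj (mulIg g^-1%g)); apply: eq_bigr => s _.
  by rewrite TE mulgKV.
- move=> x y; rewrite !TE => xS yS; have := indep xS yS.
  by rewrite invMg mulgA mulgK.
- rewrite -[RHS]card_S [LHS](reindex_inj (mulIg g^-1%g)); apply: eq_bigr => s _.
  by rewrite TE mulgKV.
by move=> z x sz; rewrite !TE -mulgA; exact: scal_S.
Qed.

Lemma sum_moves_r a : \sum_b moves a b = L.
Proof.
rewrite /moves exchange_big -card_S; apply: eq_bigr => g _ /=; rewrite -mulr_sumr.
by under eq_bigr do rewrite eq_sym; rewrite sum_ind1 mulr1.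
Qed.

Lemma sum_moves_l b : \sum_a moves a b = L.
Proof.
rewrite /moves exchange_big -card_S; apply: eq_bigr => g _ /=; rewrite -mulr_sumr.
by under eq_bigr do rewrite subact_eqV; rewrite sum_ind1 mulr1.
Qed.

Lemma sum_moves : \sum_a \sum_b moves a b = n * L.
Proof. by rewrite (eq_bigr _ (fun a _ => sum_moves_r a)) sum_const_rat card_pt. Qed.

Lemma weight_sum g : weight g = \sum_a \sum_b moves a b * ind (a *^ g == b).
Proof.
apply: eq_bigr => a _; rewrite -[LHS](sum_ind_eq (a *^ g) (moves a)).
by apply: eq_bigr => b _; rewrite mulrC eq_sym.
Qed.

Lemma eqL : L = (n - 1) * c2.
Proof. by rewrite /L /line_order /c2 /n -/q; ring. Qed.

(** By two-transitivity the inner products of the functions [a^g = b] are only L, c2 or 0. With the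
    constant row and column sums of [moves], the Gram matrix acts on [moves] as a multiple plus a
    constant. *)
Lemma sum_weight_map a b : \sum_g ind (a *^ g == b) * weight g = c2 * (n * moves a b + (n - 2) * L).
Proof.
transitivity (\sum_a' \sum_b' moves a' b' * \sum_g ind (a *^ g == b) * ind (a' *^ g == b')).
  transitivity (\sum_g \sum_a' \sum_b' moves a' b' * (ind (a *^ g == b) * ind (a' *^ g == b'))).
    apply: eq_bigr => g _; rewrite weight_sum mulr_sumr; apply: eq_bigr => a' _.
    by rewrite mulr_sumr; apply: eq_bigr => b' _; ring.
  rewrite exchange_big; apply: eq_bigr => a' _; rewrite exchange_big; apply: eq_bigr => b' _.
  by rewrite mulr_sumr.
transitivity (\sum_a' (ind (a' == a) * (\sum_b' ind (b' == b) * (L * moves a' b'))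
   + ind (a' != a) * \sum_b' ind (b' != b) * (c2 * moves a' b'))).
  apply: eq_bigr => a' _; have [->|na] := eqVneq a' a.
    rewrite mul1r mul0r addr0; apply: eq_bigr => b' _; have [->|nb] := eqVneq b' b.
      rewrite mul1r mulrC; congr (_ * _); rewrite -[RHS](map1 a b); apply: eq_bigr => g _.
      by case: (a *^ g == b); rewrite ?mulr1 ?mulr0.
    rewrite mul0r big1 ?mulr0 // => g _; rewrite -indM; case: andP => // -[/eqP -> /eqP e].
    by rewrite e eqxx in nb.
  rewrite mul0r add0r mul1r; apply: eq_bigr => b' _; have [->|nb] := eqVneq b' b.
    rewrite mul0r big1 ?mulr0 // => g _; rewrite -indM; case: andP => // -[/eqP e1 /eqP e2].
    by case/eqP: na; apply: (@subact_inj _ _ g); rewrite e1 e2.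
  by rewrite mul1r map2 1?eq_sym // mulrC.
rewrite big_split /= sum_ind_eq sum_ind_eq sum_neq /=.
under eq_bigr do rewrite sum_neq -mulr_sumr sum_moves_r.
rewrite sumrB sum_const_rat card_pt -mulr_sumr sum_moves_l sum_neq -mulr_sumr sum_moves_r.
rewrite -/q -/n eqL; ring.
Qed.

Lemma sum_weight : \sum_g weight g = n * L * L.
Proof.
under eq_bigr do rewrite weight_sum.
rewrite exchange_big -sum_moves mulr_suml; apply: eq_bigr => a _.
rewrite exchange_big mulr_suml; apply: eq_bigr => b _.
by rewrite -mulr_sumr map1.
Qed.

Lemma sum_moves2 : \sum_a \sum_b moves a b ^+ 2 = 2 * L ^+ 2.
Proof.
transitivity (\sum_g ind (g \in S) * weight g).
  symmetry; rewrite (eq_bigr (fun g => \sum_a \sum_b moves a b * (ind (g \in S) * ind (a *^ g == b)))) => [|g _].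
    rewrite exchange_big; apply: eq_bigr => a _; rewrite exchange_big; apply: eq_bigr => b _.
    by rewrite -mulr_sumr expr2.
  rewrite weight_sum mulr_sumr; apply: eq_bigr => a _; rewrite mulr_sumr; apply: eq_bigr => b _; ring.
rewrite (eq_bigr (fun g => ind (g \in S) * (2 * L))) => [|g _].
  by rewrite -mulr_suml card_S; ring.
by case: (boolP (g \in S)) => gS; rewrite ?mul0r // weight_in.
Qed.

Lemma sum_weight2 : \sum_g weight g ^+ 2 = c2 * n ^+ 2 * L ^+ 2.
Proof.
transitivity (\sum_a \sum_b moves a b * (c2 * (n * moves a b + (n - 2) * L))).
  rewrite (eq_bigr (fun g => \sum_a \sum_b moves a b * (ind (a *^ g == b) * weight g))) => [|g _].
    rewrite exchange_big; apply: eq_bigr => a _; rewrite exchange_big; apply: eq_bigr => b _.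
    by rewrite -mulr_sumr sum_weight_map.
  rewrite expr2 {1}weight_sum mulr_suml; apply: eq_bigr => a _.
  by rewrite mulr_suml; apply: eq_bigr => b _; rewrite mulrA.
transitivity (\sum_a (c2 * n * \sum_b moves a b ^+ 2 + c2 * (n - 2) * L * L)).
  apply: eq_bigr => a _; rewrite -[X in _ + _ * X](sum_moves_r a) !mulr_sumr -big_split.
  by apply: eq_bigr => b _ /=; ring.
rewrite big_split /= -mulr_sumr sum_moves2 sum_const_rat card_pt -/q -/n; ring.
Qed.

(* The indicator of S coincides with its projection on the span of the
   functions [g |-> (a^g = b)], by the equality case of Bessel's inequality. *)
Lemma indicator_weight g : n * L * ind (g \in S) = (n - 1) * weight g - (n - 2) * L.
Proof.
pose e x := n * L * ind (x \in S) - ((n - 1) * weight x - (n - 2) * L).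
have h : \sum_x e x ^+ 2 = 0.
  transitivity (\sum_x ((n * L) ^+ 2 * ind (x \in S) - 2 * n * L * (n - 1) * (ind (x \in S) * weight x)
     + 2 * n * L * (n - 2) * L * ind (x \in S) + (n - 1) ^+ 2 * weight x ^+ 2
     - 2 * (n - 1) * (n - 2) * L * weight x + (n - 2) ^+ 2 * L ^+ 2)).
    by apply: eq_bigr => x _; rewrite /e; case: (x \in S) => /=; ring.
  rewrite !(sumrB, big_split) /= -!mulr_sumr card_S sum_weight sum_weight2 sum_const_rat.
  rewrite (eq_bigr (fun g => ind (g \in S) * (2 * L))) => [|y _]; last first.
    by case: (boolP (y \in S)) => gS; rewrite ?mul0r // weight_in.
  rewrite -mulr_suml card_S -/(gG F) gG_line -/q -/n -/L eqL /c2 /n; ring.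
move/eqP: h; rewrite psumr_eq0 => [|x _]; last exact: sqr_ge0.
move/allP/(_ g); rewrite mem_index_enum => /(_ isT); rewrite sqrf_eq0 subr_eq0.
by move/eqP.
Qed.

Hypothesis S1 : 1%g \in S.

Lemma weight_der d : d \in der -> (n - 1) * weight d = (n - 2) * L.
Proof.
move=> dD; have := indicator_weight d; have -> : d \in S = false.
  by apply: contraTF dD => dS; have := indep dS S1; rewrite invg1 mulg1.
by rewrite mulr0 => /esym/eqP; rewrite subr_eq0 => /eqP.
Qed.

End DegreeOne.

(** * Derangements with two prescribed images *)

Section DerangementCounts.
Variable F : finFieldType.
Local Notation gT := {'GL_3[F]}.
Local Notation pt := (PGpoint F).
Local Notation ln := (PGline F).
Local Notation der := (der F).
Implicit Types (p o a b : pt) (l m r : ln) (g s x t d : gT).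
Let q : rat := #|F|%:R.
Let n : rat := q ^+ 2 + q + 1.
Let L := line_order F.
Let c2 : rat := q ^+ 2 * (q - 1) ^+ 3.

Let eqL2 : L = q * (q + 1) * c2.
Proof. by rewrite /L /line_order /c2 -/q; ring. Qed.

(** Average over the homologies whose axis l contains p but not p': they preserve the condition p^x
    = p', and every such x moves l. It is generic unless it fixes one of the q other points of l. *)
Lemma der_map1 p p' : p != p' -> 3 * \sum_d ind (d \in der) * ind (p *^ d == p') = L.
Proof.
move=> pp; have q20 : q ^+ 2 != 0 by rewrite expf_neq0 ?q_neq0.
have [l pl p'l] : exists2 l, on p l & ~~ on p' l.
  apply/exists_inP; apply: contraT; rewrite negb_exists_in => /forall_inP h.
  have e : \sum_l ind (on p l) = 1.
    rewrite -[RHS](sum_lines_through2 pp); apply: eq_bigr => l _; case: (boolP (on p l)) => pl; rewrite ?mul0r //.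
    have := h l pl; rewrite negbK => h2; by rewrite h2 mulr1.
  by move: e; rewrite sum_thru; have := q_gt1 F; rewrite -/q => h1 h2; lra.
have inv t x : t \in homol l -> ind (p *^ (t * x)%g == p') = ind (p *^ x == p').
  by move=> tH; rewrite subact_mul (homol_point tH pl).
have := avg_homol (@balanced_one F) inv 1%g; rewrite -/q -/n.
rewrite (eq_bigr (fun d => ind (d \in der) * ind (p *^ d == p'))) => [|x _]; last by rewrite mulg1; ring.
move=> e; apply: (mulfI q20); rewrite mulrA [q ^+ 2 * 3]mulrC e {e}.
rewrite (eq_bigr (fun x => ind (p *^ x == p') - \sum_o ind (o != p) * (ind (on o l) * (ind (p *^ x == p') * ind (o *^ x == o))))).
  rewrite sumrB map1 exchange_big /=.
  rewrite (eq_bigr (fun o => ind (o != p) * (ind (on o l) * c2))) => [|o _].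
    by rewrite sum_neq -mulr_suml sum_on_line pl -/q -/L eqL2 /n /=; ring.
  rewrite -!mulr_sumr; have [->|op] := eqVneq o p; first by rewrite !mul0r.
  case: (boolP (on o l)) => ol; last by rewrite !(mul0r, mulr0).
  rewrite map2 // 1?eq_sym //; apply: contraNneq p'l => <-.
  exact: ol.
move=> x _; rewrite mulg1 genericE; case: (boolP (p *^ x == p')) => px; last first.
  by rewrite mul0r big1 ?subr0 // => o _; rewrite !(mul0r, mulr0).
have -> : l *^ x != l by apply: contra p'l => /eqP lx; rewrite -(eqP px) -lx on_act.
rewrite !mul1r; congr (_ - _); apply: eq_bigr => o _; have [->|op] := eqVneq o p.
  by rewrite (eqP px) eq_sym (negPf pp) /=; ring.
by rewrite !mul1r.
Qed.

Section TwoPoints.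
Variables (p p' a b : pt) (l l' : ln).
Hypotheses (pp : p != p') (ap : a != p) (bp : b != p').
Hypotheses (pl : on p l) (al : on a l) (pl' : on p' l') (bl' : on b l').
Let N := \sum_d ind (d \in der) * (ind (p *^ d == p') * ind (a *^ d == b)).

Let map_line x : p *^ x = p' -> a *^ x = b -> l *^ x = l'.
Proof.
move=> px ax; apply: (@two_points_line _ _ _ p' b) => //; first by rewrite eq_sym.
  by rewrite -px on_act.
by rewrite -ax on_act.
Qed.

Lemma der_map2_same : l = l' -> N = 0.
Proof.
move=> ll; rewrite /N big1 // => d _; rewrite -!indM; case: and3P => // -[dD /eqP h1 /eqP h2].
by have := der_no_line l dD; rewrite (map_line h1 h2) ll eqxx.
Qed.

Lemma der_map2_fix : a = b -> N = 0.
Proof.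
move=> ab; rewrite /N big1 // => d _; rewrite -!indM; case: and3P => // -[dD h1 h2].
by move: dD; rewrite inE => /forallP/(_ a); rewrite {2}ab h2.
Qed.

(** Average over the homologies with axis l = pa. Every x in question maps l to l', so it is generic
    unless it fixes the meet o. It cannot fix o when o is one of p, p', a, b, which explains the two
    values. *)
Lemma der_map2 o : l != l' -> a != b -> on o l -> on o l' ->
  3 * q ^+ 2 * (q - 1) * N = L * (if [|| o == p, o == p', o == a | o == b] then q - 1 else q - 2).
Proof.
move=> ll ab ol ol'; have ll' : l' != l by rewrite eq_sym.
have pa : p != a by rewrite eq_sym.
have pb : p' != b by rewrite eq_sym.
have uo o1 : on o1 l -> on o1 l' -> o1 = o.
  have [o2 [_ _ u]] := line_meet ll => h1 h2.
  by rewrite (u o1) // (u o).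
have inv t x : t \in homol l ->
    ind (p *^ (t * x)%g == p') * ind (a *^ (t * x)%g == b) = ind (p *^ x == p') * ind (a *^ x == b).
  by move=> tH; rewrite !subact_mul (homol_point tH pl) (homol_point tH al).
have := avg_homol (@balanced_one F) inv 1%g; rewrite -/q -/n.
rewrite (eq_bigr (fun d => ind (d \in der) * (ind (p *^ d == p') * ind (a *^ d == b)))) => [|x _]; last by rewrite mulg1; ring.
rewrite -/N => e; have -> : 3 * q ^+ 2 * (q - 1) * N = (q - 1) * (3 * q ^+ 2 * N) by ring.
rewrite e {e}.
rewrite (eq_bigr (fun x => ind (p *^ x == p') * ind (a *^ x == b) -
   ind (p *^ x == p') * ind (a *^ x == b) * ind (o *^ x == o))) => [|x _]; last first.
  rewrite mulg1 genericE; case: (boolP (p *^ x == p')) => px; last by rewrite !mul0r subrr.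
  case: (boolP (a *^ x == b)) => ax; last by rewrite mulr0 !mul0r subrr.
  have lx : l *^ x = l' by apply: map_line; apply/eqP.
  rewrite lx ll' !mul1r; congr (_ - _); rewrite /fixl (bigD1 o) //= ol mul1r big1 ?addr0 // => o1 oo.
  rewrite -indM; case: andP => // -[h1 /eqP h2]; case/eqP: oo; apply: uo => //.
  by rewrite -lx -h2 on_act.
rewrite sumrB map2 //.
have zero : [|| o == p, o == p', o == a | o == b] ->
    \sum_x ind (p *^ x == p') * ind (a *^ x == b) * ind (o *^ x == o) = 0.
  move=> h; rewrite big1 // => x _; rewrite -!indM; case: andP => // -[/andP[/eqP px /eqP ax] /eqP ox].
  case/or4P: h => /eqP h.
  - by case/eqP: pp; rewrite -px -{1}h -ox h.
  - by case/eqP: pp; apply: (@subact_inj _ _ x); rewrite px -{1}h -{1}ox h.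
  - by case/eqP: ab; rewrite -ax -h ox.
  by case/eqP: ab; apply: (@subact_inj _ _ x); rewrite ax -{1}h -{1}ox h.
case: ifPn => [/zero ->|]; first by rewrite subr0 eqL2 -/c2 /n; ring.
rewrite !negb_or => /and4P[op op' oa ob].
by rewrite (map3 pa op oa pl al ol pb op' ob pl' bl' ol') eqL2 -/q /c2 /n; ring.
Qed.

End TwoPoints.

(** Indicator of collinearity, except for the value q + 1 at p = a = b. The form of a sum over lines
    lets [sum_coll] exchange summations. *)
Definition coll p a b : rat := \sum_l ind (on p l) * (ind (on a l) * ind (on b l)).

Lemma coll_line p a b l : a != b -> on a l -> on b l -> coll p a b = ind (on p l).
Proof.
move=> ab al bl; rewrite /coll (bigD1 l) //= al bl big1 => [|l' ll]; first by rewrite /=; ring.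
rewrite -!indM; case: and3P => // -[_ h1 h2]; case/eqP: ll.
exact: two_points_line ab h1 h2 al bl.
Qed.

Lemma coll_diag p a : a != p -> coll p a a = 1.
Proof.
move=> ap; rewrite -(sum_lines_through2 ap); apply: eq_bigr => l _.
by case: (on p l); case: (on a l); rewrite !(mul0r, mul1r, mulr0).
Qed.

(* The number of derangements mapping p to p' and a to b, up to a constant
   factor; r stands for the line joining p and p'. *)
Definition omega p p' r a b : rat :=
  let al := ind (on a r) in let be := ind (on b r) in
  al * be * (ind (a == p) * ind (b == p') * (q ^+ 2 * (q - 1)))
  + al * (1 - be) * (1 - ind (a == p)) * (q - 1)
  + (1 - al) * be * (1 - ind (b == p')) * (q - 1)
  + (1 - al) * (1 - be) * (q - 2 + coll p a b + coll p' a b - q * ind (a == b)).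

Lemma der_map_omega p p' r a b : p != p' -> on p r -> on p' r ->
  3 * q ^+ 2 * (q - 1) * (\sum_d ind (d \in der) * (ind (p *^ d == p') * ind (a *^ d == b)))
  = L * omega p p' r a b.
Proof.
move=> pp pr p'r; rewrite /omega.
have [->|ap] := eqVneq a p; have [->|bp] := eqVneq b p'.
- rewrite pr p'r /= (eq_bigr (fun d => ind (d \in der) * ind (p *^ d == p'))) => [|d _].
    by rewrite -(der_map1 pp) /=; ring.
  by case: (p *^ d == p'); rewrite ?mulr1 ?mulr0.
- rewrite big1 => [|d _]; last first.
    rewrite -!indM; case: and3P => // -[_ /eqP h1 /eqP h2]; case/eqP: bp.
    by rewrite -h2 h1.
  by rewrite pr /=; ring.
- rewrite big1 => [|d _]; last first.
    rewrite -!indM; case: and3P => // -[_ /eqP h1 /eqP h2]; case/eqP: ap.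
    by apply: (@subact_inj _ _ d); rewrite h2 h1.
  by rewrite p'r /=; ring.
have pa : p != a by rewrite eq_sym.
have pb : p' != b by rewrite eq_sym.
have [l [pl al ul]] := line_through pa; have [l' [pl' bl' ul']] := line_through pb.
have [ar|ar] := boolP (on a r); have [br|br] := boolP (on b r).
- rewrite (der_map2_same bp pl al pl' bl') ?mulr0 /=; first by ring.
  by rewrite -(ul r) // -(ul' r).
- have lr : l = r by rewrite (ul r).
  have l'r : l != l' by apply: contraNneq br => e; rewrite -lr e.
  have ab : a != b by apply: contraNneq br => <-.
  rewrite (der_map2 pp ap bp pl al pl' bl' l'r ab (o := p')) ?lr // eqxx orbT /=; ring.
- have lr : l' = r by rewrite (ul' r).
  have l'r : l != l' by apply: contraNneq ar => e; rewrite -lr -e.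
  have ab : a != b by apply: contraNneq ar => ->.
  rewrite (der_map2 pp ap bp pl al pl' bl' l'r ab (o := p)) ?lr // eqxx /=; ring.
have [ab|ab] := eqVneq a b.
  have ap' : a != p' by rewrite ab.
  rewrite (der_map2_fix p p' ab) -ab !coll_diag //=; ring.
have ll' : l != l'.
  apply: contraNneq ar => e; rewrite -(two_points_line pp pl _ pr p'r) //.
  by rewrite e.
have [o [ol ol' uo]] := line_meet ll'.
have [m [am bm um]] := line_through ab.
rewrite (der_map2 pp ap bp pl al pl' bl' ll' ab ol ol') !(coll_line _ ab am bm).
have op : o != p.
  apply: contraNneq br => e; rewrite -(two_points_line pp _ pl' pr p'r) //.
  by rewrite -e.
have op' : o != p'.
  apply: contraNneq ar => e; rewrite -(two_points_line pp pl _ pr p'r) //.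
  by rewrite -e.
rewrite (negPf op) (negPf op') /=.
(* For a and b off r, the exceptional positions of o in [der_map2] are collinearities: o = a means
   that p' is on the line m = ab, and o = b that p is. *)
have ea : (o == a) = on p' m.
  apply/eqP/idP => [e|h].
    by rewrite -(two_points_line _ _ bl' am bm) // -e.
  apply/esym/uo => //; rewrite (two_points_line _ pl' bl' h bm) //.
have eb : (o == b) = on p m.
  apply/eqP/idP => [e|h].
    by rewrite -(two_points_line _ al _ am bm) // -e.
  apply/esym/uo => //; rewrite (two_points_line _ pl al h am) //.
rewrite ea eb; have [h1|h1] := boolP (on p' m); have [h2|h2] := boolP (on p m) => /=; try by ring.
by case/negP: ar; rewrite -(two_points_line pp h2 h1 pr p'r).
Qed.

End DerangementCounts.

(** * Functions orthogonal to derangements *)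

Section OffDiagonal.
Variable F : finFieldType.
Local Notation pt := (PGpoint F).
Local Notation ln := (PGline F).
Implicit Types (p o a b : pt) (l r : ln).
Let q : rat := #|F|%:R.
Let n : rat := q ^+ 2 + q + 1.
Variables (m : pt -> pt -> rat) (N K : rat).
Hypothesis sum_r : forall a, \sum_b m a b = N.
Hypothesis sum_l : forall b, \sum_a m a b = N.
Hypothesis sum_omega : forall p p' r, p != p' -> on p r -> on p' r ->
  \sum_a \sum_b m a b * omega p p' r a b = K.

Let Rr p r := \sum_b ind (on b r) * m p b.
Let Rc p r := \sum_a ind (on a r) * m a p.
Let M r := \sum_a ind (on a r) * Rr a r.
Let E r := \sum_a (1 - ind (on a r)) * m a a.
(** For p on l, inclusion-exclusion gives the sum of m over the pairs of points of l other than
    p. *)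
Let W p l := M l - Rr p l - Rc p l + m p p.
Let G p := \sum_l ind (on p l) * W p l.
Let H p := m p p - G p.

Let M_E r : M r = \sum_b ind (on b r) * Rc b r.
Proof.
rewrite /M /Rr /Rc; under eq_bigr do rewrite mulr_sumr.
rewrite exchange_big; apply: eq_bigr => b _ /=; rewrite mulr_sumr.
by apply: eq_bigr => a _; ring.
Qed.

Let sum_sep (f g : pt -> rat) (h : pt -> pt -> rat) :
  \sum_a \sum_b f a * g b * h a b = \sum_a f a * \sum_b g b * h a b.
Proof. by apply: eq_bigr => a _; rewrite mulr_sumr; apply: eq_bigr => b _; ring. Qed.

(** The lines through p other than r partition the points off r, so the collinear pairs split into
    one block for each such line. *)
Let sum_coll p r : on p r ->
  \sum_a \sum_b m a b * ((1 - ind (on a r)) * (1 - ind (on b r)) * coll p a b) = G p - W p r.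
Proof.
move=> pr; transitivity (\sum_l ind (l != r) * (ind (on p l) * W p l)); last first.
  by rewrite sum_neq pr mul1r.
transitivity (\sum_l ind (on p l) * \sum_a \sum_b
   (ind (on a l) * (1 - ind (on a r))) * (ind (on b l) * (1 - ind (on b r))) * m a b).
  under [RHS]eq_bigr do rewrite mulr_sumr.
  rewrite [RHS]exchange_big; apply: eq_bigr => a _ /=.
  under [RHS]eq_bigr do rewrite mulr_sumr.
  rewrite [RHS]exchange_big; apply: eq_bigr => b _ /=.
  by rewrite /coll !mulr_sumr; apply: eq_bigr => l _; ring.
apply: eq_bigr => l _; have [->|lr] := eqVneq l r.
  rewrite mul0r pr mul1r big1 // => a _; rewrite big1 // => b _.
  by case: (on a r); rewrite /=; ring.
rewrite mul1r; case: (boolP (on p l)) => pl; last by rewrite !mul0r.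
rewrite !mul1r.
have e a : ind (on a l) * (1 - ind (on a r)) = ind (a != p) * ind (on a l).
  have [->|ap] := eqVneq a p; first by rewrite pr mul0r subrr mulr0.
  case: (boolP (on a l)) => al; last by rewrite mul0r mulr0.
  suff /negPf -> : ~~ on a r by rewrite subr0.
  by apply: contra lr => ar; rewrite (two_points_line ap al pl ar pr).
rewrite (eq_bigr (fun a => ind (a != p) * (ind (on a l) * (Rr a l - m a p)))) => [|a _].
  rewrite sum_neq pl /= mul1r /W.
  have -> : \sum_y ind (on y l) * (Rr y l - m y p) = M l - Rc p l.
    by under eq_bigr do rewrite mulrBr; rewrite sumrB.
  ring.
rewrite e (eq_bigr (fun b => ind (a != p) * ind (on a l) * (ind (b != p) * (ind (on b l) * m a b)))) => [|b _].
  rewrite -mulr_sumr sum_neq pl mul1r -/(Rr a l); ring.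
by rewrite e; ring.
Qed.

Let V r := (q - 1) * (2 * q * N - 2 * M r) + (q - 2) * ((n - 2 * q - 2) * N + M r)
  - 2 * M r - q * E r - K.

Let sum_on_r r : \sum_a ind (on a r) * \sum_b m a b = (q + 1) * N.
Proof. by under eq_bigr do rewrite sum_r; rewrite -mulr_suml sum_on_line. Qed.

Let sum_on_c r : \sum_a \sum_b ind (on b r) * m a b = (q + 1) * N.
Proof.
rewrite exchange_big /=; under eq_bigr do rewrite -mulr_sumr sum_l.
by rewrite -mulr_suml sum_on_line.
Qed.

(** The relation [sum_omega] solved for its single entry m p p': everything else depends on line
    sums through p or p', on the points separately, or on r. *)
Let key p p' r : p != p' -> on p r -> on p' r ->
  q ^+ 2 * (q - 1) * m p p' =
  - q * Rr p r - Rc p r - Rr p' r - q * Rc p' r + H p + H p' - V r.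
Proof.
move=> pp pr p'r; have := sum_omega pp pr p'r.
pose al a := ind (on a r).
rewrite (eq_bigr (fun a => \sum_b (
   ind (a == p) * ind (b == p') * (q ^+ 2 * (q - 1) * m a b)
 + (q - 1) * (al a * m a b) - (q - 1) * (al a * al b * m a b)
 - (q - 1) * (ind (a == p) * (m a b - al b * m a b))
 + (q - 1) * (al b * m a b) - (q - 1) * (al a * al b * m a b)
 - (q - 1) * (ind (b == p') * (m a b - al a * m a b))
 + (q - 2) * (m a b - al a * m a b - al b * m a b + al a * al b * m a b)
 + m a b * ((1 - ind (on a r)) * (1 - ind (on b r)) * coll p a b)
 + m a b * ((1 - ind (on a r)) * (1 - ind (on b r)) * coll p' a b)
 - q * (ind (b == a) * ((1 - al a) * m a b))))) => [|a _]; last first.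
  apply: eq_bigr => b _; rewrite /omega /= -/(al a) -/(al b).
  (* The rewriting of [omega] is no polynomial identity in the indicators: it uses that a = p puts a
     on r, and similarly for b = p' and a = b. *)
  have hx : ind (a == p) = 0 \/ ind (a == p) = 1 /\ al a = 1.
    by have [->|] := eqVneq a p; [right; rewrite /al pr | left].
  have hy : ind (b == p') = 0 \/ ind (b == p') = 1 /\ al b = 1.
    by have [->|] := eqVneq b p'; [right; rewrite /al p'r | left].
  have hz : ind (a == b) = 0 \/ ind (a == b) = 1 /\ al a = al b.
    by have [->|] := eqVneq a b; [right | left].
  have hu : al a = 0 \/ al a = 1 by rewrite /al; case: (on a r); [right|left].
  rewrite [b == a]eq_sym; move: hx hy hz hu.
  move: (ind (a == p)) (ind (b == p')) (ind (a == b)) (al a) (al b) => x y z u v hx hy hz hu.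
  case: hu => hu; case: hx => [hx|[hx e1]]; case: hy => [hy|[hy e2]]; case: hz => [hz|[hz e3]];
    subst; try ring; exfalso; lra.
under eq_bigr do rewrite !(sumrB, big_split) /=. rewrite !(sumrB, big_split) /=. 
have pull (c : rat) (f : pt -> pt -> rat) : \sum_a \sum_b c * f a b = c * \sum_a \sum_b f a b.
  by rewrite mulr_sumr; apply: eq_bigr => a _; rewrite mulr_sumr.
have e1 : \sum_a \sum_b ind (a == p) * ind (b == p') * (q ^+ 2 * (q - 1) * m a b) = q ^+ 2 * (q - 1) * m p p'.
  by rewrite sum_sep sum_ind_eq sum_ind_eq.
have e2 : \sum_a \sum_b al a * m a b = (q + 1) * N.
  by rewrite -(sum_on_r r); apply: eq_bigr => a _; rewrite mulr_sumr.
have e3 : \sum_a \sum_b al a * al b * m a b = M r by rewrite sum_sep.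
have e4 : \sum_a \sum_b ind (a == p) * (m a b - al b * m a b) = N - Rr p r.
  under eq_bigr do rewrite -mulr_sumr.
  by rewrite sum_ind_eq sumrB sum_r.
have e5 : \sum_a \sum_b al b * m a b = (q + 1) * N by exact: sum_on_c.
have e7 : \sum_a \sum_b ind (b == p') * (m a b - al a * m a b) = N - Rc p' r.
  under eq_bigr do rewrite (sum_ind_eq p' (fun b => m _ b - al _ * m _ b)).
  by rewrite sumrB sum_l.
have e8 : \sum_a \sum_b (m a b - al a * m a b - al b * m a b + al a * al b * m a b) = (n - 2 * q - 2) * N + M r.
  under eq_bigr do rewrite !(sumrB, big_split) /=.
  rewrite !(sumrB, big_split) /= e2 e3 e5.
  have -> : \sum_a \sum_b m a b = n * N by under eq_bigr do rewrite sum_r; rewrite sum_const_rat card_pt.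
  ring.
have e11 : \sum_a \sum_b ind (b == a) * ((1 - al a) * m a b) = E r.
  by apply: eq_bigr => a _; rewrite (sum_ind_eq a (fun b => (1 - al a) * m a b)).
rewrite !pull e1 e2 e3 e4 e5 e7 e8 e11 !sum_coll // => eK.
rewrite /V -eK /H /W; ring.
Qed.

Let sum_line_but r p (f : pt -> rat) : on p r ->
  \sum_a ind (a != p) * (ind (on a r) * f a) = \sum_a ind (on a r) * f a - f p.
Proof. by move=> pr; rewrite sum_neq pr mul1r. Qed.

Let SH r := \sum_a ind (on a r) * H a.

Let A p := q ^+ 2 * (q - 1) * m p p + (q - 1) * H p.
Let B r := SH r - (q + 1) * M r - q * V r.

Let sum_rest r p (f : pt -> rat) (c : rat) : on p r ->
  \sum_a ind (a != p) * (ind (on a r) * (f a + c)) = \sum_a ind (on a r) * f a - f p + q * c.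
Proof.
move=> pr; rewrite sum_line_but //; under eq_bigr do rewrite mulrDr.
by rewrite big_split /= -mulr_suml sum_on_line -/q; ring.
Qed.

(** Summing [key] over the points of r other than p makes [Rc p r] cancel and gives [Rr p r] the
    coefficient q^3 - 1. The column sums obey the same equation, so both split into a point term and
    a line term. *)
Let row p r : on p r -> (q ^+ 3 - 1) * Rr p r = A p + B r.
Proof.
move=> pr.
have e : \sum_a ind (a != p) * (ind (on a r) * (q ^+ 2 * (q - 1) * m p a)) =
  \sum_a ind (a != p) * (ind (on a r) * (- Rr a r - q * Rc a r + H a
     + (- q * Rr p r - Rc p r + H p - V r))).
  apply: eq_bigr => a _; have [->|ap] := eqVneq a p; first by rewrite !mul0r.
  case: (boolP (on a r)) => ar; last by rewrite !mul0r.
  by rewrite (key _ pr ar) 1?eq_sym //; ring.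
move: e; rewrite sum_rest // sum_line_but //.
have -> : \sum_a ind (on a r) * (q ^+ 2 * (q - 1) * m p a) = q ^+ 2 * (q - 1) * Rr p r.
  by rewrite mulr_sumr; apply: eq_bigr => a _; ring.
have -> : \sum_a ind (on a r) * (- Rr a r - q * Rc a r + H a) = - M r - q * M r + SH r.
  rewrite {2}M_E /M /SH mulr_sumr -!sumrN -!big_split; apply: eq_bigr => a _ /=; ring.
move=> h; apply/eqP; rewrite -subr_eq0 /A /B; apply/eqP; move/eqP: h; rewrite -subr_eq0 => /eqP <-; ring.
Qed.

Let col p r : on p r -> (q ^+ 3 - 1) * Rc p r = A p + B r.
Proof.
move=> pr.
have e : \sum_a ind (a != p) * (ind (on a r) * (q ^+ 2 * (q - 1) * m a p)) =
  \sum_a ind (a != p) * (ind (on a r) * (- q * Rr a r - Rc a r + H a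
     + (- Rr p r - q * Rc p r + H p - V r))).
  apply: eq_bigr => a _; have [->|ap] := eqVneq a p; first by rewrite !mul0r.
  case: (boolP (on a r)) => ar; last by rewrite !mul0r.
  by rewrite (key ap ar pr); ring.
move: e; rewrite sum_rest // sum_line_but //.
have -> : \sum_a ind (on a r) * (q ^+ 2 * (q - 1) * m a p) = q ^+ 2 * (q - 1) * Rc p r.
  by rewrite mulr_sumr; apply: eq_bigr => a _; ring.
have -> : \sum_a ind (on a r) * (- q * Rr a r - Rc a r + H a) = - q * M r - M r + SH r.
  rewrite {2}M_E /M /SH mulr_sumr -!sumrN -!big_split; apply: eq_bigr => a _ /=; ring.
move=> h; apply/eqP; rewrite -subr_eq0 /A /B; apply/eqP; move/eqP: h; rewrite -subr_eq0 => /eqP <-; ring.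
Qed.

Lemma off_diagonal : exists (f : pt -> rat) (g : ln -> rat), forall p p' r, p != p' -> on p r -> on p' r ->
  m p p' = f p + f p' + g r.
Proof.
have q1 := q_gt1 F; have q0 := q_neq0 F; have qq := q1_neq0 F; rewrite -/q in q1 q0 qq.
have k0 : q ^+ 3 - 1 != 0 by rewrite subr_eq0 gt_eqF // exprn_egt1.
exists (fun p => (H p - (q + 1) * (A p / (q ^+ 3 - 1))) / (q ^+ 2 * (q - 1))).
exists (fun r => (- V r - 2 * (q + 1) * (B r / (q ^+ 3 - 1))) / (q ^+ 2 * (q - 1))).
move=> p p' r pp pr p'r; have k1 : q ^+ 2 * (q - 1) != 0 by rewrite mulf_neq0 ?expf_neq0.
apply: (mulfI k1); rewrite (key pp pr p'r).
have div x y : (q ^+ 3 - 1) * x = y -> x = y / (q ^+ 3 - 1) by move=> <-; rewrite mulrAC divff // mul1r.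
rewrite (div _ _ (row pr)) (div _ _ (row p'r)) (div _ _ (col pr)) (div _ _ (col p'r)).
by field; rewrite ?k0 ?q0 ?qq.
Qed.

End OffDiagonal.

(** * The indicator in terms of fixed points and fixed lines *)

Section FixedFlags.
Variable F : finFieldType.
Local Notation gT := {'GL_3[F]}.
Local Notation pt := (PGpoint F).
Local Notation ln := (PGline F).
Local Notation der := (der F).
Implicit Types (p o a b : pt) (l r : ln) (g s x t d : gT).
Let q : rat := #|F|%:R.
Let n : rat := q ^+ 2 + q + 1.
Let L := line_order F.

Variable S : {set gT}.
Hypothesis indep : forall x y, x \in S -> y \in S -> (x * y^-1)%g \notin der.
Hypothesis card_S : \sum_x ind (x \in S) = L.
Hypothesis scal_S : forall z x, scalar z -> x \in S -> (z * x)%g \in S.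
Hypothesis q_neq2 : q != 2.
Hypothesis S1 : 1%g \in S.

(** Since the weight is constant on derangements, its sum over the derangements mapping p to p' is
    known; expanding the weight there produces [omega]. *)
Lemma sum_moves_omega p p' r : p != p' -> on p r -> on p' r ->
  \sum_a \sum_b moves S a b * omega p p' r a b = q ^+ 2 * (q - 1) * (n - 2) * L / (n - 1).
Proof.
move=> pp pr p'r; have n1 := n1_neq0 F; rewrite -/q -/n in n1.
have L0 := line_order_neq0 F; rewrite -/L in L0.
apply: (mulfI n1); rewrite mulrCA divff // mulr1; apply: (mulfI L0).
transitivity (3 * q ^+ 2 * (q - 1) * \sum_d ind (d \in der) * ind (p *^ d == p') * ((n - 1) * weight S d)).
  transitivity ((n - 1) * \sum_a \sum_b moves S a b * (L * omega p p' r a b)).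
    rewrite mulrCA; congr (_ * _); rewrite mulr_sumr; apply: eq_bigr => a _.
    by rewrite mulr_sumr; apply: eq_bigr => b _; ring.
  transitivity ((n - 1) * \sum_a \sum_b \sum_d 3 * q ^+ 2 * (q - 1) *
     (ind (d \in der) * ind (p *^ d == p') * (moves S a b * ind (a *^ d == b)))).
    congr (_ * _); apply: eq_bigr => a _; apply: eq_bigr => b _.
    rewrite -(der_map_omega a b pp pr p'r) -/q !mulr_sumr; apply: eq_bigr => d _; ring.
  under eq_bigr do rewrite exchange_big.
  rewrite exchange_big /= !mulr_sumr; apply: eq_bigr => d _.
  rewrite weight_sum !mulr_sumr; apply: eq_bigr => a _.
  by rewrite !mulr_sumr; apply: eq_bigr => b _; ring.
rewrite (eq_bigr (fun d => (n - 2) * L * (ind (d \in der) * ind (p *^ d == p')))) => [|d _].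
  rewrite -mulr_sumr; have e := der_map1 pp.
  transitivity (q ^+ 2 * (q - 1) * (n - 2) * L * (3 * \sum_d ind (d \in der) * ind (p *^ d == p'))).
    by ring.
  by rewrite e -/L; ring.
case: (boolP (d \in der)) => dD; last by rewrite !mul0r mulr0.
by rewrite (weight_der indep card_S scal_S q_neq2 S1 dD) -/q -/n -/L; ring.
Qed.

(** The terms f a and f (a^g) sum to constants. For the line terms, a moved point a belongs to the
    line r through a and a^g iff a lies on r and on its preimage; each r has 1 + q [r fixed] such
    points. Fixed points are corrected in the first sum. *)
Lemma weight_fixed : exists (c : pt -> rat) (e : ln -> rat) (C : rat), forall g,
  weight S g = C + \sum_a ind (a *^ g == a) * c a + \sum_l stabl l g * e l.
Proof.
have [f [h fh]] := off_diagonal (sum_moves_r card_S) (sum_moves_l card_S) sum_moves_omega.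
pose T a := \sum_r ind (on a r) * h r.
exists (fun a => moves S a a - 2 * f a - T a), (fun l => q * h l), (2 * \sum_a f a + \sum_r h r) => g.
rewrite /weight.
rewrite (eq_bigr (fun a => ind (a *^ g == a) * (moves S a a - 2 * f a - T a) + f a + f (a *^ g)
  + \sum_r h r * (ind (on a r) * ind (on a (r *^ g^-1%g))))) => [|a _]; last first.
  have onV r : on a (r *^ g^-1%g) = on (a *^ g) r by rewrite on_actV invgK.
  have [ag|ag] := eqVneq (a *^ g) a.
    rewrite ag mul1r /T [X in _ + X](eq_bigr (fun r => ind (on a r) * h r)) => [|r _]; first by ring.
    by rewrite onV ag; case: (on a r); rewrite /=; ring.
  rewrite mul0r add0r; have ag' : a != a *^ g by rewrite eq_sym.
  have [r [ar agr ur]] := line_through ag'.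
  rewrite (bigD1 r) //= onV ar agr big1 => [|i ir]; first by rewrite (fh _ _ _ ag' ar agr) /=; ring.
  rewrite onV -indM; case: andP => [[h1 h2]|]; last by rewrite mulr0.
  by case/eqP: ir; exact: ur.
have fg : \sum_a f (a *^ g) = \sum_a f a by rewrite [RHS](reindex_inj (@subact_inj _ _ g)).
rewrite !big_split /= fg exchange_big /=.
have -> : \sum_j \sum_i h j * (ind (on i j) * ind (on i (j *^ g^-1%g))) =
   \sum_r h r + \sum_l stabl l g * (q * h l).
  rewrite -big_split; apply: eq_bigr => r _ /=; rewrite -mulr_sumr sum_meet2 -/q /stabl subact_eqV; ring.
ring.
Qed.

Lemma indicator_fixed : exists (c : pt -> rat) (e : ln -> rat), forall g,
  ind (g \in S) = \sum_a ind (a *^ g == a) * c a + \sum_l stabl l g * e l.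
Proof.
have [c [e [C H]]] := weight_fixed; have n0 := n_neq0 F; have L0 := line_order_neq0 F.
rewrite -/q -/n -/L in n0 L0.
pose K := (n - 1) / (n * L); exists (fun a => K * c a), (fun l => K * e l) => g.
have E x : ind (x \in S) = K * (C + \sum_a ind (a *^ x == a) * c a + \sum_l stabl l x * e l) - (n - 2) / n.
  have nL : n * L != 0 by rewrite mulf_neq0.
  apply: (mulfI nL); rewrite (indicator_weight indep card_S scal_S q_neq2 x) -/q -/n -/L H /K.
  by field; rewrite ?n0 ?L0.
(* At a derangement both sums are empty and the indicator is 0, so the constant term vanishes. *)
have [d dD] := der_ex F; have := E d; have -> : d \in S = false.
  by apply: contraTF dD => dS; have := indep dS S1; rewrite invg1 mulg1.
rewrite big1 => [|a _]; last by move: dD; rewrite inE => /forallP/(_ a)/negPf ->; rewrite mul0r.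
rewrite big1 => [|l _]; last by rewrite /stabl (negPf (der_no_line l dD)) mul0r.
rewrite !addr0 /= => e0; rewrite E.
transitivity (K * \sum_a ind (a *^ g == a) * c a + K * \sum_l stabl l g * e l + (K * C - (n - 2) / n)); first by ring.
rewrite -e0 addr0; congr (_ + _); rewrite mulr_sumr; apply: eq_bigr => i _; ring.
Qed.

End FixedFlags.

(** * Elements with one fixed point and one fixed line *)

Section SoleFixedFlag.
Variable F : finFieldType.
Local Notation gT := {'GL_3[F]}.
Local Notation pt := (PGpoint F).
Local Notation ln := (PGline F).
Local Notation der := (der F).
Implicit Types (p o a b : pt) (l r : ln) (g s x t d : gT).

Lemma sole_fixed_point (u v w : 'rV[F]_3) (C : 'M[F]_3) p : row3 u v w \in unitmx -> C \in unitmx ->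
  (val p :=: u)%MS ->
  (forall x y z : F, (exists k, vec3 x y z *m C = k *: vec3 x y z) <-> y = 0 /\ z = 0) ->
  exists2 g : gT, row3 u v w *m GLval g = C *m row3 u v w & forall a, (a *^ g == a) = (a == p).
Proof.
move=> UM UC ep h; have Ug : invmx (row3 u v w) *m C *m row3 u v w \in unitmx.
  by rewrite !unitmx_mul unitmx_inv UM UC.
have [g eg] := GL_of Ug; have eM : row3 u v w *m GLval g = C *m row3 u v w.
  by rewrite eg -!mulmxA mulKVmx.
exists g => // a; have [x x0 ex] := vec_of a.
have [i [j [k e]]] := vec3_ex (x *m invmx (row3 u v w)).
have ex' : x = vec3 i j k *m row3 u v w by rewrite -e mulmxKV.
have eu : u = vec3 1 0 0 *m row3 u v w by rewrite mulmx_row3 scale1r !scale0r !addr0.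
have ri := can_inj (mulmxK UM).
have xg : x *m GLval g = vec3 i j k *m C *m row3 u v w by rewrite ex' -!mulmxA eM.
apply/(fixes_vec g ex)/idP => [[c ec]|].
  have /h[j0 k0] : exists k', vec3 i j k *m C = k' *: vec3 i j k.
    by exists c; apply: ri; rewrite -xg ec {1}ex' scalemxAl.
  rewrite subsp_eqE ex ep ex' mulmx_row3 j0 k0 !scale0r !addr0.
  exact: scalemx_sub.
rewrite subsp_eqE ex ep => /sub_rVP[c]; rewrite ex' {2}eu scalemxAl => /ri.
rewrite scale_vec3 mulr0 => /vec3_inj[_ j0 k0].
have [c' ec'] := (h i j k).2 (conj j0 k0); exists c'.
by rewrite -ex' xg ec' -scalemxAl -ex'.
Qed.

Lemma sole_fixed_line g p l : (forall a, (a *^ g == a) = (a == p)) -> l *^ g = l ->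
  forall r, (r *^ g == r) = (r == l).
Proof.
move=> h lg r; apply/idP/eqP => [rg|->]; last by rewrite lg.
apply/eqP; apply: contraT => rl; have := nfix_lines g; rewrite /nfix.
rewrite (eq_bigr (fun a => ind (a == p))) => [|a _]; last by rewrite h.
rewrite sum_ind1 (bigD1 l) //= (bigD1 r) //= lg rg eqxx => e.
have : 0 <= \sum_(i | (i != l) && (i != r)) ind (i *^ g == i) by apply: sumr_ge0 => i _; exact: ler0n.
by rewrite /= in e; lra.
Qed.

(* [x^2 - x] takes the same value at 0 and 1, hence is not surjective. *)
Lemma irreducible_quadratic : exists2 c : F, c != 0 & forall y : F, y ^+ 2 - y != c.
Proof.
have /existsP[c /forallP hc] : [exists c : F, [forall y : F, y ^+ 2 - y != c]].
  apply: contraT; rewrite negb_exists => /forallP h; exfalso.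
  have ex (c : F) : exists y : F, y ^+ 2 - y = c.
    by have := h c; rewrite negb_forall => /existsP[y]; rewrite negbK => /eqP; exists y.
  have [f fK] := fin_all_exists ex; have finj : injective f by move=> y z e; rewrite -(fK y) e fK.
  have /codomP[x0 e0] := inj_card_onto finj (leqnn _) 0.
  have /codomP[x1 e1] := inj_card_onto finj (leqnn _) 1.
  have h0 := fK x0; have h1 := fK x1; rewrite -e0 expr0n subr0 in h0; rewrite -e1 expr1n subrr in h1.
  by have /eqP := oner_neq0 F; apply; rewrite e0 e1 -h0 -h1.
by exists c => //; have := hc 0; rewrite expr0n subrr eq_sym.
Qed.

(** If p is on l, a single Jordan block with eigenvalue 1 works. Otherwise take 1 on p and on l a
    block with characteristic polynomial X^2 - X - c, irreducible by the choice of c. The fixed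
    lines need no separate search, being as many as the fixed points. *)
Lemma sole_fixed_flag p l : exists g,
  (forall a, (a *^ g == a) = (a == p)) /\ (forall r, (r *^ g == r) = (r == l)).
Proof.
suff [g h lg] : exists2 g, forall a, (a *^ g == a) = (a == p) & l *^ g = l.
  by exists g; split => //; exact: sole_fixed_line h lg.
have [u u0 eu] := vec_of p.
have [pl|pl] := boolP (on p l).
  have [b bl bp] := other_on pl; have [v v0 ev] := vec_of b.
  have r2 : \rank (u + v)%MS = 2 by apply: rank2_vec eu ev; rewrite eq_sym.
  have el : (val l :=: u + v)%MS by apply: line_sub_eq => //; rewrite addsmx_sub -eu -ev; apply/andP.
  have [w W] := frame_ext r2.
  have UC : row3 (vec3 1 0 0) (vec3 1 1 0) (vec3 0 1 1) \in (unitmx : {pred 'M[F]_3}).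
    by rewrite unitmxE det_row3 (_ : _ + _ = 1) ?unitr1 //; ring.
  have [|g eg h] := sole_fixed_point W UC eu; last first.
    exists g => //; move: eg; rewrite !row3_mul !mulmx_row3 => /row3_inj[e1 e2 _].
    apply/eqP; rewrite subact_eqE (eqmxMr _ el) el addsmxMr addsmx_sub e1 e2.
    by rewrite !scale0r !addr0 !addmx_sub ?scalemx_sub ?addsmxSl ?addsmxSr.
  move=> x y z; rewrite mulmx_row3 !scale_vec3 !add_vec3.
  split=> [[k]|[-> ->]]; last by exists 1; rewrite scale_vec3; congr vec3; ring.
  rewrite scale_vec3 !(mulr0, mulr1, addr0, add0r) => /vec3_inj[e1 e2 e3].
  have zk c : k = 1 -> c = k * c by move=> ->; rewrite mul1r.
  have k1 : z != 0 -> k = 1.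
    by move=> z0; apply: (mulIf z0); rewrite mul1r.
  have k2 : y != 0 -> z = 0 -> k = 1.
    by move=> y0 z0; apply: (mulIf y0); rewrite mul1r -e2 z0 addr0.
  have [z0|z0] := eqVneq z 0; last first.
    by have kk := k1 z0; case/eqP: z0; apply: (addrI y); rewrite e2 -(zk _ kk) addr0.
  split=> //; apply/eqP; apply: contraT => y0.
  by have kk := k2 y0 z0; case/eqP: y0; apply: (addrI x); rewrite e1 -(zk _ kk) addr0.
have [v [w [v' [el _]]]] := line_frame l; have [c c0 hc] := irreducible_quadratic.
have W : row3 u v w \in unitmx.
  have : row3 v w u \in unitmx.
    by apply: row3_unit_ext; rewrite -el ?rank_subsp // -eu.
  by rewrite !row3_unit addsmxA addsmxC.
have UC : row3 (vec3 1 0 0) (vec3 0 0 1) (vec3 0 c 1) \in (unitmx : {pred 'M[F]_3}).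
  by rewrite unitmxE det_row3 (_ : _ + _ = - c) ?unitfE ?oppr_eq0 //; ring.
have [|g eg h] := sole_fixed_point W UC eu; last first.
  exists g => //; move: eg; rewrite !row3_mul !mulmx_row3 => /row3_inj[_ e2 e3].
  apply/eqP; rewrite subact_eqE (eqmxMr _ el) el addsmxMr addsmx_sub e2 e3.
  by rewrite !scale0r !add0r !addmx_sub ?scalemx_sub ?addsmxSl ?addsmxSr.
move=> x y z; rewrite mulmx_row3 !scale_vec3 !add_vec3.
split=> [[k]|[-> ->]]; last by exists 1; rewrite scale_vec3; congr vec3; ring.
rewrite scale_vec3 !(mulr0, mulr1, addr0, add0r) => /vec3_inj[_ e2 e3].
have [z0|z0] := eqVneq z 0.
  by split=> //; move: e3; rewrite z0 addr0 mulr0.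
have := hc k; case: eqP => // hk; case: hk; apply: (mulfI z0); rewrite e2.
have -> : y = k * z - z by rewrite -e3; ring.
ring.
Qed.

End SoleFixedFlag.

Lemma sum_zero_one (T : finType) (f : T -> rat) :
  (forall x, f x = 0 \/ f x = 1) -> \sum_x f x = 1 -> exists x0, forall x, f x = ind (x == x0).
Proof.
move=> f01 s1; have f0 x : 0 <= f x by case: (f01 x) => ->.
have /existsP[x0 /eqP fx0] : [exists x, f x == 1].
  apply: contraT; rewrite negb_exists => /forallP h; move: s1; rewrite big1 => [/eqP //|x _].
  by case: (f01 x) => // e; have := h x; rewrite e eqxx.
exists x0 => x; have [->//|xx] := eqVneq x x0.
case: (f01 x) => // e; move: s1; rewrite (bigD1 x0) //= (bigD1 x) //= fx0 e => s1.
have : 0 <= \sum_(i | (i != x0) && (i != x)) f i by apply: sumr_ge0.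
by lra.
Qed.

(** * Recognizing the stabilizer *)

Section MaximalIndependent.
Variable F : finFieldType.
Local Notation gT := {'GL_3[F]}.
Local Notation pt := (PGpoint F).
Local Notation ln := (PGline F).
Local Notation der := (der F).
Implicit Types (p o a b : pt) (l r : ln) (g s x t d : gT).
Let q : rat := #|F|%:R.
Let L := line_order F.

Variable S : {set gT}.
Hypothesis indep : forall x y, x \in S -> y \in S -> (x * y^-1)%g \notin der.
Hypothesis card_S : \sum_x ind (x \in S) = L.
Hypothesis scal_S : forall z x, scalar z -> x \in S -> (z * x)%g \in S.
Hypothesis q_neq2 : q != 2.
Hypothesis S1 : 1%g \in S.

Lemma stabilizer_of_neq2 :
  (exists p, forall g, (g \in S) = (p *^ g == p)) \/ (exists l, forall g, (g \in S) = (l *^ g == l)).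
Proof.
have [c [e H]] := indicator_fixed indep card_S scal_S q_neq2 S1.
have L0 := line_order_neq0 F; rewrite -/L in L0.
have ce p l : c p + e l = 0 \/ c p + e l = 1.
  have [g [gp gl]] := sole_fixed_flag p l; have := H g.
  under eq_bigr do rewrite gp; rewrite sum_ind_eq.
  under eq_bigr do rewrite /stabl gl; rewrite sum_ind_eq => <-.
  by case: (g \in S); [right|left].
have ind_inj (x y : bool) : ind x = ind y -> x = y by case: x; case: y => // /eqP.
have [/existsP[l /existsP[l' ll]]|] := boolP [exists l, exists l', e l != e l'].
  (* Both c p + e l and c p + e l' are 0 or 1, so two different values of e differ by 1 and every c
     p is minus the smaller one. *)
  right; pose m := if e l < e l' then e l else e l'.
  have cm p : c p = - m.
    rewrite /m; case: (ltrP (e l) (e l')) => h.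
      case: (ce p l) => h1; case: (ce p l') => h2; lra.
    have h' : e l' < e l by rewrite lt_neqAle eq_sym ll.
    case: (ce p l) => h1; case: (ce p l') => h2; lra.
  have [p0 _] := on_ex l.
  have E g : ind (g \in S) = \sum_r stabl r g * (e r - m).
    rewrite H (eq_bigr (fun a => ind (a *^ g == a) * - m)) => [|a _]; last by rewrite cm.
    (* As fixed points and fixed lines are equally many, the constant coefficient moves from points
       to lines. *)
    rewrite -mulr_suml -/(nfix g) nfix_lines mulr_suml -big_split; apply: eq_bigr => r _ /=.
    rewrite /stabl; ring.
  have [||l0 hl] := @sum_zero_one _ (fun r => e r - m).
  - by move=> r; have := ce p0 r; rewrite cm addrC.
  (* S and every line stabilizer have L elements, so the coefficients e r - m sum to 1. *)
  - apply: (mulfI L0); rewrite mulr1 -[RHS]card_S [RHS](eq_bigr _ (fun g _ => E g)) exchange_big mulr_sumr.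
    by apply: eq_bigr => r _; rewrite -mulr_suml sum_stabl.
  exists l0 => g; apply: ind_inj; rewrite E (eq_bigr (fun r => ind (r == l0) * stabl r g)).
    by rewrite sum_ind_eq.
  by move=> r _; rewrite hl mulrC.
rewrite negb_exists => /forallP h; left.
have [l0 _] := @subsp_of F 2 3 (pid_mx 2) (@rank_pid_mx _ 3 3 2 isT isT).
have el l : e l = e l0 by have := h l; rewrite negb_exists => /forallP/(_ l0); rewrite negbK => /eqP.
have E g : ind (g \in S) = \sum_a ind (a *^ g == a) * (c a + e l0).
  rewrite H [X in _ + X](eq_bigr (fun l => ind (l *^ g == l) * e l0)) => [|l _]; last by rewrite el.
  rewrite -mulr_suml -nfix_lines /nfix mulr_suml -big_split; apply: eq_bigr => a _ /=; ring.
have [||p0 hp] := @sum_zero_one _ (fun a => c a + e l0).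
- by move=> a; exact: ce.
- apply: (mulfI L0); rewrite mulr1 -[RHS]card_S [RHS](eq_bigr _ (fun g _ => E g)) exchange_big mulr_sumr.
  by apply: eq_bigr => a _; rewrite -mulr_suml map1.
exists p0 => g; apply: ind_inj; rewrite E (eq_bigr (fun a => ind (a == p0) * ind (a *^ g == a))).
  by rewrite sum_ind_eq.
by move=> a _; rewrite hp mulrC.
Qed.

End MaximalIndependent.

(** * The plane of order 2 *)

Section BinarySearch.
Local Open Scope nat_scope.

(* Vectors over GF(2), and matrices given by their three rows. *)
Definition bvec := (bool * bool * bool)%type.
Definition bmat := (bvec * bvec * bvec)%type.
Implicit Types (u v w : bvec) (x y : bmat) (K T c : seq bmat).

Definition bvec_eq v w : bool :=
  let: (a, b, c) := v in let: (a', b', c') := w in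
  if eqb a a' then if eqb b b' then eqb c c' else false else false.

Definition bvec_add v w : bvec :=
  let: (a, b, c) := v in let: (a', b', c') := w in (addb a a', addb b b', addb c c').

Definition bvec0 : bvec := (false, false, false).

Definition bact v x : bvec :=
  let: (a, b, c) := v in let: (r1, r2, r3) := x in
  bvec_add (if a then r1 else bvec0) (bvec_add (if b then r2 else bvec0) (if c then r3 else bvec0)).

Definition bmul x y : bmat := let: (r1, r2, r3) := x in (bact r1 y, bact r2 y, bact r3 y).

Definition bvec_of (k : nat) : bvec := (odd k, odd k./2, odd k./2./2).
Definition bmat_of (t : nat * nat * nat) : bmat :=
  let: (i, j, k) := t in (bvec_of i, bvec_of j, bvec_of k).

Definition bvecs : seq bvec := Eval compute in [seq bvec_of k | k <- iota 0 8].
Definition bvecs1 : seq bvec := Eval compute in [seq bvec_of k | k <- iota 1 7].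

(** Nonadjacency in the derangement graph: over GF(2) a point is a nonzero vector, and fixing it
    means fixing the vector. *)
Definition compat x y : bool := has (fun v => bvec_eq (bact v x) (bact v y)) bvecs1.

Definition nonsing x : bool := ~~ compat x (bvec0, bvec0, bvec0).

Definition bmats : seq bmat :=
  filter nonsing [seq (ab, r) | ab <- [seq (a, b) | a <- bvecs, b <- bvecs], r <- bvecs].

Definition fixes_point T : bool := has (fun v => all (fun x => bvec_eq (bact v x) v) T) bvecs1.

Definition fixes_line T : bool :=
  has (fun u => has (fun v => 
    if bvec_eq u v then false else
    all (fun x => has (bvec_eq (bact u x)) [:: u; v; bvec_add u v] &&
                  has (bvec_eq (bact v x)) [:: u; v; bvec_add u v]) T) bvecs1) bvecs1.

(* Runs over all ways to pick one element of each clique in [cl] compatible with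
   the elements [c] picked so far. Conditionals replace the boolean connectives,
   whose arguments [vm_compute] would evaluate strictly. *)
Fixpoint search (ms : seq bmat) c (cl : seq (seq bmat)) : bool :=
  if cl is K :: cl' then all (fun x => if all (compat x) c then search ms (x :: c) cl' else true) K
  else let T := filter (fun x => all (compat x) c) ms in if fixes_point T then true else fixes_line T.

Fixpoint pairwise_incompat K : bool :=
  if K is x :: K' then all (fun y => ~~ compat x y) K' && pairwise_incompat K' else true.

Definition singer_coset (dg : (nat * nat * nat) * (nat * nat * nat)) : seq bmat :=
  traject (bmul (bmat_of dg.1)) (bmat_of dg.2) 7.

(* Translates [C g] of Singer cycles [C = <d>], given by [(d, g)] with the rows
   of [d] and [g] read in binary; chosen greedily to keep the search small. *)
Definition singer_cosets : seq (seq bmat) := map singer_coset [:: ((2, 7, 3),(1, 2, 5)); ((2, 4, 5),(1, 7, 5)); ((2, 7, 6),(1, 2, 6)); ((2, 4, 3),(1, 4, 3)); ((2, 4, 5),(1, 2, 5)); ((2, 4, 5),(1, 2, 6)); ((2, 6, 1),(1, 6, 5)); ((2, 4, 3),(1, 7, 2)); ((2, 7, 3),(1, 3, 6)); ((2, 4, 3),(1, 4, 2)); ((2, 7, 3),(1, 3, 5)); ((2, 5, 6),(1, 6, 2)); ((2, 5, 1),(1, 6, 2)); ((2, 7, 3),(1, 4, 2)); ((2, 7, 3),(1, 4, 7)) ].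

Definition bone : bmat := bmat_of (1, 2, 4).

Lemma search_true : search bmats [:: bone] singer_cosets.
Proof. by vm_compute. Qed.

Lemma cosets_incompat : all (fun K => all nonsing K && pairwise_incompat K) singer_cosets.
Proof. by vm_compute. Qed.

Lemma bvec_eqP v w : reflect (v = w) (bvec_eq v w).
Proof.
by case: v => -[[] []] []; case: w => -[[] []] []; constructor.
Qed.

Lemma mem_bvecs v : v \in bvecs.
Proof. by case: v => -[[] []] []. Qed.

Lemma mem_bmats x : (x \in bmats) = nonsing x.
Proof.
rewrite mem_filter andbC; case: x => [[a b] c]; rewrite (allpairs_f _ _ _) ?mem_bvecs //.
by rewrite (allpairs_f _ _ _) ?mem_bvecs.
Qed.

Section Soundness.
Variable P : pred bmat.
Variable ms : seq bmat.
Hypothesis P_sub : forall x, P x -> x \in ms.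
Hypothesis P_compat : forall x y, P x -> P y -> compat x y.

(** In each clique the search visits the branch of an element satisfying P. All elements satisfying
    P are compatible with the choices made, hence survive into the final list T. *)
Lemma search_sound c cl : all P c -> all (has P) cl -> search ms c cl ->
  exists T, (forall x, P x -> x \in T) /\ (fixes_point T || fixes_line T).
Proof.
elim: cl c => [|K cl IH] c Pc /= => [_|/andP[/hasP[x xK Px] Pcl] /allP/(_ x xK)].
  set T := filter _ _ => h; exists T; split => [x Px|]; last exact: h.
  rewrite mem_filter P_sub // andbT.
  by apply/allP => y yc; apply: P_compat => //; exact: (allP Pc).
have -> : all (compat x) c by apply/allP => y yc; apply: P_compat => //; exact: (allP Pc).
by apply: IH; rewrite //= Px.
Qed.

End Soundness.

End BinarySearch.

(** * From matrices over GF(2) to the search *)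

Section Order2.
Variable F : finFieldType.
Hypothesis F2 : #|F| = 2.
Local Notation gT := {'GL_3[F]}.
Local Notation pt := (PGpoint F).
Local Notation ln := (PGline F).
Local Notation der := (der F).
Implicit Types (p o a b : pt) (l r : ln) (g h s t d : gT) (v w : bvec) (x y : bmat).

Lemma F2P (y : F) : y = 0 \/ y = 1.
Proof.
have : y \in [set 0; 1]; last by rewrite !inE => /orP[] /eqP ->; [left|right].
have -> : [set (0 : F); 1] = setT; last by rewrite inE.
by apply/eqP; rewrite eqEcard subsetT cardsT F2 cards2 eq_sym oner_neq0.
Qed.

Lemma F2_11 : 1 + 1 = 0 :> F.
Proof.
case: (F2P (1 + 1)) => // /(canRL (addrK _)); rewrite subrr => /eqP.
by rewrite oner_eq0.
Qed.

Definition vec_bits v : 'rV[F]_3 := let: (a, b, c) := v in vec3 a%:R b%:R c%:R.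

Definition mx_bits x : 'M[F]_3 := let: (r1, r2, r3) := x in
  row3 (vec_bits r1) (vec_bits r2) (vec_bits r3).

Lemma bit_inj (a b : bool) : a%:R = b%:R :> F -> a = b.
Proof. by case: a; case: b => // /eqP; rewrite ?oner_eq0 // eq_sym oner_eq0. Qed.

Lemma vec_bits_inj : injective vec_bits.
Proof. by case=> -[a b] c [[a' b'] c'] /vec3_inj[/bit_inj -> /bit_inj -> /bit_inj ->]. Qed.

Lemma mx_bits_inj : injective mx_bits.
Proof.
by case=> -[a b] c [[a' b'] c'] /row3_inj[/vec_bits_inj -> /vec_bits_inj -> /vec_bits_inj ->].
Qed.

Lemma vec_bits_ex (u : 'rV[F]_3) : exists v, u = vec_bits v.
Proof.
have [i [j [k ->]]] := vec3_ex u.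
by case: (F2P i) => ->; case: (F2P j) => ->; case: (F2P k) => ->;
  [exists (false, false, false)|exists (false, false, true)|exists (false, true, false)
  |exists (false, true, true)|exists (true, false, false)|exists (true, false, true)
  |exists (true, true, false)|exists (true, true, true)].
Qed.

Lemma mx_bits_ex (A : 'M[F]_3) : exists x, A = mx_bits x.
Proof.
have [r1 e1] := vec_bits_ex (row 0 A); have [r2 e2] := vec_bits_ex (row 1 A).
have [r3 e3] := vec_bits_ex (row 2%:R A); exists (r1, r2, r3).
rewrite /= -e1 -e2 -e3 row3E; apply/matrixP => i j; rewrite mxE.
by case: i => -[|[|[|//]]] ? /=; rewrite mxE; congr (A _ _); apply: val_inj.
Qed.

Lemma vec_bits_add v w : vec_bits (bvec_add v w) = vec_bits v + vec_bits w.
Proof.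
case: v => -[a b] c; case: w => -[a' b'] c' /=; rewrite add_vec3.
have E (i j : bool) : (addb i j)%:R = i%:R + j%:R :> F.
  by case: i; case: j; rewrite ?addr0 ?add0r //= F2_11.
by rewrite !E.
Qed.

Lemma vec_bits0 : vec_bits bvec0 = 0.
Proof. by apply/rowP => j; rewrite !mxE; case: j => -[|[|[|//]]]. Qed.

Lemma vec_bits_act v x : vec_bits (bact v x) = vec_bits v *m mx_bits x.
Proof.
case: v => -[a b] c; case: x => -[r1 r2] r3; rewrite /= mulmx_row3 !vec_bits_add addrA.
have E (i : bool) v : vec_bits (if i then v else bvec0) = i%:R *: vec_bits v.
  by case: i; rewrite ?scale1r // scale0r vec_bits0.
by rewrite !E.
Qed.

Lemma mem_bvecs1 v : (v \in bvecs1) = (vec_bits v != 0).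
Proof.
rewrite -vec_bits0 (inj_eq vec_bits_inj).
by case: v => -[[] []] [].
Qed.

Lemma compatP x y : reflect (exists2 u : 'rV[F]_3, u != 0 & u *m mx_bits x = u *m mx_bits y) (compat x y).
Proof.
apply: (iffP hasP) => [[v v1 /bvec_eqP e]|[u u0 e]].
  by exists (vec_bits v); rewrite -?mem_bvecs1 // -!vec_bits_act e.
have [v ev] := vec_bits_ex u; exists v; first by rewrite mem_bvecs1 -ev.
by apply/bvec_eqP/vec_bits_inj; rewrite !vec_bits_act -ev.
Qed.

Lemma nonsingE x : nonsing x = (mx_bits x \in unitmx).
Proof.
have z0 : mx_bits (bvec0, bvec0, bvec0) = 0.
  by rewrite -[LHS]/(row3 _ _ _) vec_bits0 /row3 !(@col_mx0 _ 1).
apply/idP/idP => [h|U].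
  rewrite -row_free_unit -kermx_eq0; apply: contraR h => k0; apply/compatP.
  exists (nz_row (kermx (mx_bits x))); first by rewrite nz_row_eq0.
  by rewrite z0 mulmx0; apply/sub_kermxP; exact: nz_row_sub.
apply/compatP => -[u u0]; rewrite z0 mulmx0 => e; case/eqP: u0.
by apply: (can_inj (mulmxK U)); rewrite e mul0mx.
Qed.

Lemma compat_der x y g h : GLval g = mx_bits x -> GLval h = mx_bits y ->
  compat x y = ((g * h^-1)%g \notin der).
Proof.
move=> ex ey; have U := GL_unitmx h.
apply/compatP/idP => [[u u0 e]|].
  apply/negP => /derP/(_ u 1 u0); apply.
  by rewrite GL_MxE GL_VxE mulmxA ex e -ey mulmxK // scale1r.
rewrite inE negb_forall => /existsP[p]; rewrite negbK; have [u u0 eu] := vec_of p.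
case/(fixes_vec _ eu) => c; rewrite GL_MxE GL_VxE mulmxA => e.
have e' : u *m GLval g = c *: u *m GLval h by rewrite -e mulmxKV.
exists u; rewrite // -ex -ey e'; case: (F2P c) => c1; last by rewrite c1 scale1r.
case/eqP: u0; apply: (can_inj (mulmxK (GL_unitmx g))).
by rewrite e' c1 scale0r !mul0mx.
Qed.

Lemma GL_bits x : nonsing x -> {g : gT | GLval g = mx_bits x}.
Proof. by rewrite nonsingE; exact: GL_of. Qed.

Section Binary.
Let L := line_order F.
Variable S : {set gT}.
Hypothesis indep : forall g h, g \in S -> h \in S -> (g * h^-1)%g \notin der.
Hypothesis card_S : \sum_g ind (g \in S) = L.
Hypothesis S1 : 1%g \in S.

(** Equality case of the clique bound: every right translate of a clique of size n = 7 meets S at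
    most once, and exactly once on average since |S| = |G|/7. *)
Lemma clique_meets (K : {set gT}) : #|K| = 7 ->
  {in K &, forall g h, g != h -> (g * h^-1)%g \in der} -> exists2 g, g \in K & g \in S.
Proof.
move=> K7 Kder; have le1 h : \sum_k ind (k \in K) * ind ((k * h)%g \in S) <= 1.
  have [/existsP[k0 /andP[k0K k0S]]|/existsPn H] := boolP [exists k, (k \in K) && ((k * h)%g \in S)]; last first.
    by rewrite big1 ?ler01 // => k _; rewrite -indM (negPf (H k)).
  rewrite -[leRHS](sum_ind1 k0); apply: ler_sum => k _; rewrite -indM.
  case: andP => [[kK kS]|_]; last exact: ler0n.
  have [//|kk] := eqVneq k k0; have := indep kS k0S.
  by rewrite invMg mulgA mulgK (Kder k k0 kK k0K kk).
have : \sum_h (1 - \sum_k ind (k \in K) * ind ((k * h)%g \in S)) = 0.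
  rewrite sumrB sum_const_rat -/(gG F) exchange_big /=.
  rewrite [X in _ - X](eq_bigr (fun k => ind (k \in K) * L)) => [|k _]; last first.
    by rewrite -mulr_sumr; congr (_ * _); rewrite -card_S [RHS](reindex_inj (mulgI k)).
  by rewrite -mulr_suml -natr_card K7 gG_line F2 -/L; ring.
move/eqP; rewrite psumr_eq0 => [|h _]; last by rewrite subr_ge0.
move/allP/(_ 1%g); rewrite mem_index_enum subr_eq0 => /(_ isT) /eqP e.
have /existsP[k /andP[kK kS]] : [exists k, (k \in K) && (k \in S)]; last by exists k.
apply: contraT => /existsPn H; suff : (1 : rat) = 0 by [].
by rewrite e big1 // => k _; rewrite mulg1 -indM (negPf (H k)).
Qed.

Let P x : bool := [exists g, (g \in S) && (GLval g == mx_bits x)].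

Lemma clique_P K : size K = 7%N -> all nonsing K && pairwise_incompat K -> has P K.
Proof.
move=> K7 /andP[Kn Ki].
have Ku : forall x y, x \in K -> y \in K -> x != y -> ~~ compat x y.
  elim: K Ki {K7 Kn} => //= z K IH /andP[zK Ki] x y; rewrite !inE.
  have sym x' y' : compat x' y' = compat y' x'.
    by apply/compatP/compatP => -[u u0 e]; exists u.
  case/orP=> [/eqP->|xK]; case/orP=> [/eqP->|yK].
  - by rewrite eqxx.
  - by move=> _; exact: (allP zK).
  - by move=> _; rewrite sym; exact: (allP zK).
  exact: IH.
have uK : uniq K.
  elim: K Ki Kn {K7 Ku} => //= z K IH /andP[zK Ki] /andP[zn Kn]; rewrite IH // andbT.
  apply/negP => zK'; have := allP zK _ zK'; apply/negP; rewrite negbK; apply/compatP.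
  by exists (delta_mx 0 0) => //; apply/eqP => /rowP/(_ 0)/eqP; rewrite !mxE !eqxx oner_eq0.
have ex x : exists g : gT, nonsing x -> GLval g = mx_bits x.
  by have [/GL_bits[g e]|_] := boolP (nonsing x); [exists g | exists 1%g].
have [k kE] := fin_all_exists ex; have {}kE x : x \in K -> GLval (k x) = mx_bits x.
  by move=> xK; apply: kE; exact: (allP Kn).
have kinj : {in K &, injective k}.
  by move=> x y xK yK e; apply: mx_bits_inj; rewrite -!kE // e.
have cT : #|[set k x | x in K]| = 7 by rewrite (card_in_imset kinj) (card_uniqP uK).
have [|g] := clique_meets cT.
  move=> _ _ /imsetP[x xK ->] /imsetP[y yK ->] gh.
  rewrite -[_ \in _]negbK -(compat_der (kE x xK) (kE y yK)); apply: Ku => //.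
  by apply: contraNneq gh => ->.
case/imsetP=> x xK -> gS; apply/hasP; exists x => //.
by apply/existsP; exists (k x); rewrite gS kE /=.
Qed.

Lemma stabilizer_of_eq2 :
  (exists p, forall g, (g \in S) = (p *^ g == p)) \/ (exists l, forall g, (g \in S) = (l *^ g == l)).
Proof.
(* The search only places S inside a stabilizer; equality follows as both have L elements. *)
have eqS (Q : pred gT) : (forall g, g \in S -> Q g) -> \sum_g ind (Q g) = L -> forall g, (g \in S) = Q g.
  move=> h sQ g; have : \sum_x (ind (Q x) - ind (x \in S)) = 0 by rewrite sumrB sQ card_S subrr.
  move/eqP; rewrite psumr_eq0 => [|x _]; last first.
    by rewrite subr_ge0; case: (boolP (x \in S)) => [/h ->//|_]; exact: ler0n.
  move/allP/(_ g); rewrite mem_index_enum subr_eq0 => /(_ isT) /eqP.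
  by case: (g \in S); case: (Q g) => // /eqP.
have PS x g : g \in S -> GLval g = mx_bits x -> P x.
  by move=> gS e; apply/existsP; exists g; rewrite gS e eqxx.
have [|x y /existsP[g /andP[gS /eqP gx]] /existsP[h /andP[hS /eqP hy]]|||T [PT]] :=
  @search_sound P bmats _ _ [:: bone] singer_cosets _ _ search_true.
- move=> x /existsP[g /andP[_ /eqP e]].
  by rewrite mem_bmats nonsingE -e GL_unitmx.
- by rewrite (compat_der gx hy) indep.
- rewrite /= andbT; apply: PS S1 _; rewrite GL_1E; apply/matrixP => i j; rewrite /= row3E !mxE.
  by case: i => -[|[|[|//]]] ?; case: j => -[|[|[|//]]] ? /=; rewrite mxE.
- apply/allP => K KK; apply: clique_P; last exact: (allP cosets_incompat).
  by case/mapP: KK => dg _ ->; rewrite size_traject.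
case/orP.
  case/hasP=> v; rewrite mem_bvecs1 => v0 /allP vT; left.
  have [p ep] := point_of v0; exists p; apply: eqS; last exact: map1.
  move=> g gS; have [x gx] := mx_bits_ex (GLval g).
  have /bvec_eqP e := vT x (PT x (PS x g gS gx)).
  by apply/(fixes_vec _ ep); exists 1; rewrite gx -vec_bits_act e scale1r.
case/hasP=> u; rewrite mem_bvecs1 => u0 /hasP[v]; rewrite mem_bvecs1 => v0.
case: bvec_eqP => // uv /allP uvT; right.
have r2 : \rank (vec_bits u + vec_bits v)%MS = 2.
  have [a ea] := point_of u0; have [b eb] := point_of v0; apply: (rank2_vec _ ea eb).
  rewrite subsp_eqE ea eb; apply/negP => /sub_rVP[c]; case: (F2P c) => ->.
    by rewrite scale0r => e; rewrite e eqxx in u0.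
  by rewrite scale1r => /vec_bits_inj.
have [l el] := subsp_of r2; exists l; apply: eqS; last exact: sum_stabl.
move=> g gS; have [x gx] := mx_bits_ex (GLval g).
have /andP[h1 h2] := uvT x (PT x (PS x g gS gx)).
rewrite subact_eqE (eqmxMr _ el) el addsmxMr addsmx_sub gx -!vec_bits_act.
have inl w : has (bvec_eq w) [:: u; v; bvec_add u v] -> (vec_bits w <= vec_bits u + vec_bits v)%MS.
  rewrite /= orbF => /or3P[] /bvec_eqP ->; rewrite ?addsmxSl ?addsmxSr //.
  by rewrite vec_bits_add addmx_sub ?addsmxSl ?addsmxSr.
by apply/andP; split; apply: inl.
Qed.

End Binary.

End Order2.

(** * Passage to PGL *)

Section Projective.
Variable F : finFieldType.
Local Notation gT := {'GL_3[F]}.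
Local Notation pt := (PGpoint F).
Local Notation ln := (PGline F).
Local Notation der := (der F).
Implicit Types (p o a b : pt) (l r : ln) (g h s t d : gT) (y z : {perm pt}) (S U : {set {perm pt}}).
Let L := line_order F.

Definition projperm g : {perm pt} := actperm (subspAction F 1) g.

Lemma projpermE g p : projperm g p = p *^ g. Proof. exact: actpermE. Qed.

Lemma projpermM g h : projperm (g * h)%g = (projperm g * projperm h)%g.
Proof. by apply/permP => p; rewrite permM !projpermE subact_mul. Qed.

Lemma projperm1 : projperm 1%g = 1%g.
Proof. by apply/permP => p; rewrite perm1 projpermE subact_id. Qed.

Lemma projpermV g : projperm g^-1%g = (projperm g)^-1%g.
Proof. by apply/eqP; rewrite eq_sym eq_invg_mul -projpermM mulgV projperm1. Qed.

Lemma PGL3P y : reflect (exists g, y = projperm g) (y \in PGL3 F).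
Proof.
apply: (iffP morphimP) => [[g _ _ ->]|[g ->]]; first by exists g.
by exists g; rewrite ?inE.
Qed.

Lemma projperm_PGL3 g : projperm g \in PGL3 F.
Proof. by apply/PGL3P; exists g. Qed.

Lemma derangementE g : derangement (projperm g) = (g \in der).
Proof.
rewrite /derangement projperm_PGL3 inE; apply: eq_forallb => p.
by rewrite projpermE.
Qed.

(** A line is determined by two of its points, so the action on lines depends only on the
    permutation of points. This makes the existential in [line_stab] independent of the lift. *)
Lemma projperm_line g h l : projperm g = projperm h -> l *^ g = l *^ h.
Proof.
move=> e; have e' p : p *^ g = p *^ h by rewrite -!projpermE e.
have [a al] := on_ex l; have [b bl ba] := other_on al.
apply: (@two_points_line _ _ _ (a *^ g) (b *^ g)); rewrite ?on_act //; last 2 first.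
- by rewrite e' on_act.
- by rewrite e' on_act.
by rewrite (inj_eq (@subact_inj _ _ g)) eq_sym.
Qed.

Lemma projperm_scalar s : scalar s -> projperm s = 1%g.
Proof.
case/existsP=> c /eqP e; apply/permP => p; rewrite projpermE perm1; apply/eqP.
have [v v0 ev] := vec_of p; apply/(fixes_vec _ ev); exists c.
by rewrite e mul_mx_scalar.
Qed.

Lemma mem_point_stab a g : (projperm g \in point_stab a) = (a *^ g == a).
Proof. by rewrite inE projperm_PGL3 projpermE. Qed.

Lemma mem_line_stab l g : (projperm g \in line_stab l) = (l *^ g == l).
Proof.
rewrite inE projperm_PGL3 /=; apply/existsP/idP => [[u /andP[/eqP e]]|lg].
  by rewrite (projperm_line l (e : projperm u = projperm g)).
by exists g; rewrite eqxx.
Qed.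

Lemma same_image_not_der a g h : a *^ g = a *^ h -> (g * h^-1)%g \notin der.
Proof.
move=> e; rewrite inE negb_forall; apply/existsP; exists a.
by rewrite negbK subact_mul e subactK.
Qed.

Lemma same_line_not_der l g h : l *^ g = l *^ h -> (g * h^-1)%g \notin der.
Proof.
move=> e; apply/negP => /(der_no_line l).
by rewrite subact_mul e subactK eqxx.
Qed.

Lemma point_stab_sub a : point_stab a \subset PGL3 F.
Proof. by apply/subsetP => y; rewrite inE => /andP[]. Qed.

Lemma line_stab_sub l : line_stab l \subset PGL3 F.
Proof. by apply/subsetP => y; rewrite inE => /andP[]. Qed.

(** The fibres of [projperm] are translates of its kernel. Sizes in PGL_3 are thus compared in GL_3
    up to a common positive factor. *)
Lemma sum_projperm S : S \subset PGL3 F ->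
  \sum_g ind (projperm g \in S) = (\sum_g ind (projperm g == 1%g)) * #|S|%:R.
Proof.
move=> sS; rewrite natr_card mulr_sumr.
rewrite (eq_bigr (fun g => \sum_y ind (y == projperm g) * ind (y \in S))) => [|g _]; last by rewrite sum_ind_eq.
rewrite exchange_big; apply: eq_bigr => y _ /=; rewrite -mulr_suml.
case: (boolP (y \in S)) => yS; last by rewrite !mulr0.
have /PGL3P[h ->] := subsetP sS y yS; congr (_ * _).
rewrite (reindex_inj (mulIg h)); apply: eq_bigr => g _; congr ((_ : bool)%:R).
by rewrite projpermM eq_mulgV1 invMg mulKVg -eq_invg1 invgK.
Qed.

Lemma sum_kernel_gt0 : 0 < \sum_g ind (projperm g == 1%g).
Proof.
rewrite (bigD1 1%g) //= projperm1 eqxx; apply: ltr_wpDr => //.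
by apply: sumr_ge0 => g _; exact: ler0n.
Qed.

Lemma indep_setP S : reflect (S \subset PGL3 F /\
  forall g h, projperm g \in S -> projperm h \in S -> (g * h^-1)%g \notin der) (indep_set S).
Proof.
apply: (iffP andP) => -[sS H]; split => //.
  move=> g h gS hS; move/forall_inP: H => /(_ _ gS)/forall_inP/(_ _ hS).
  by rewrite -projpermV -projpermM derangementE.
apply/forall_inP => y yS; apply/forall_inP => z zS.
have /PGL3P[g ey] := subsetP sS y yS; have /PGL3P[h ez] := subsetP sS z zS.
by rewrite ey ez -projpermV -projpermM derangementE H -?ey -?ez.
Qed.

Lemma sum_projperm_le S : indep_set S -> \sum_g ind (projperm g \in S) <= L.
Proof.
case/indep_setP=> sS H; rewrite (eq_bigr (fun g => ind (g \in [set g | projperm g \in S]))).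
  by apply: indep_bound => g h; rewrite [g \in _]inE [h \in _]inE; exact: H.
by move=> g _; rewrite inE.
Qed.

(** The bound L is attained by a point stabilizer, so being of maximal size means reaching it. *)
Lemma max_indep_setP S : reflect (indep_set S /\ \sum_g ind (projperm g \in S) = L) (max_indep_set S).
Proof.
have k0 := sum_kernel_gt0.
have card_le (T : {set {perm pt}}) : T \subset PGL3 F -> S \subset PGL3 F ->
    (#|T| <= #|S|)%N = (\sum_g ind (projperm g \in T) <= \sum_g ind (projperm g \in S)).
  by move=> sT sS; rewrite !sum_projperm // ler_pM2l // ler_nat.
apply: (iffP andP) => -[iS H]; split => //; have [sS _] := indep_setP _ iS.
  apply/eqP; rewrite eq_le sum_projperm_le //=.
  have [a _] := @subsp_of F 1 3 (pid_mx 1) (@rank_pid_mx _ 3 3 1 isT isT).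
  have <- : \sum_g ind (projperm g \in point_stab a) = L.
    by rewrite -[RHS](map1 a a); apply: eq_bigr => g _; rewrite mem_point_stab.
  rewrite -card_le ?point_stab_sub //; move/forallP: H => /(_ (point_stab a))/implyP; apply.
  apply/indep_setP; split=> [|g h]; first exact: point_stab_sub.
  by rewrite !mem_point_stab => /eqP ga /eqP ha; apply: (@same_image_not_der a); rewrite ga ha.
apply/forallP => T; apply/implyP => iT; have [sT _] := indep_setP _ iT.
by rewrite card_le // H sum_projperm_le.
Qed.

Lemma max_indep_rcoset U y : y \in PGL3 F -> U \subset PGL3 F ->
  (forall g h, projperm g \in U -> projperm h \in U -> (g * h^-1)%g \notin der) ->
  \sum_g ind (projperm g \in U) = L -> max_indep_set (U :* y)%g.
Proof.
case/PGL3P=> t -> sU H s; have E g : (projperm g \in U :* projperm t)%g = (projperm (g * t^-1)%g \in U).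
  by rewrite mem_rcoset -projpermV -projpermM.
apply/max_indep_setP; split; last first.
  rewrite -s (reindex_inj (mulIg t)); apply: eq_bigr => g _; by rewrite E mulgK.
apply/indep_setP; split.
  apply/subsetP => z; rewrite mem_rcoset => /(subsetP sU) /PGL3P[g e].
  by apply/PGL3P; exists (g * t)%g; rewrite projpermM -e mulgKV.
by move=> g h; rewrite !E => gU hU; have := H _ _ gU hU; rewrite invMg invgK mulgA mulgKV.
Qed.

Lemma max_indep_coset S : max_indep_set S -> exists2 y, y \in PGL3 F &
  (exists a, S = (point_stab a :* y)%g) \/ (exists l, S = (line_stab l :* y)%g).
Proof.
case/max_indep_setP=> /indep_setP[sS H] s.
have /existsP[t tS] : [exists g, projperm g \in S].
  apply: contraT => /existsPn h; have /eqP := line_order_neq0 F; case.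
  by rewrite -/L -s big1 // => g _; rewrite (negPf (h g)).
(* The preimage of S is translated by an element of it, so that T contains 1 as the preceding
   results require. *)
pose T := [set g | projperm (g * t)%g \in S].
have indep g h : g \in T -> h \in T -> (g * h^-1)%g \notin der.
  by rewrite [g \in _]inE [h \in _]inE => gT hT; have := H _ _ gT hT; rewrite invMg mulgA mulgK.
have card_T : \sum_g ind (g \in T) = L.
  rewrite -s [RHS](reindex_inj (mulIg t)); apply: eq_bigr => g _; by rewrite inE.
have T1 : 1%g \in T by rewrite inE mul1g.
have scal_T d g : scalar d -> g \in T -> (d * g)%g \in T.
  by move=> /projperm_scalar e; rewrite !inE -mulgA (projpermM d) e mul1g.
have {}E U : U \subset PGL3 F -> (forall g, (g \in T) = (projperm g \in U)) -> S = (U :* projperm t)%g.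
  move=> sU e; apply/setP => y; rewrite mem_rcoset; apply/idP/idP => [yS|].
    have /PGL3P[g ey] := subsetP sS y yS.
    by rewrite ey -projpermV -projpermM -e inE mulgKV -ey.
  move=> yU; have /PGL3P[g ey] := subsetP sU _ yU; move: yU; rewrite ey -e inE projpermM -ey.
  by rewrite mulgKV.
have [[a ha]|[l hl]] : (exists p, forall g, (g \in T) = (p *^ g == p)) \/
    (exists l, forall g, (g \in T) = (l *^ g == l)).
- have [F2|F2] := eqVneq #|F| 2%N; first exact: stabilizer_of_eq2.
  by apply: stabilizer_of_neq2 => //; rewrite (eqr_nat _ _ 2).
- exists (projperm t); first exact: projperm_PGL3.
  by left; exists a; apply: E => [|g]; rewrite ?point_stab_sub // mem_point_stab.
exists (projperm t); first exact: projperm_PGL3.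
by right; exists l; apply: E => [|g]; rewrite ?line_stab_sub // mem_line_stab.
Qed.

End Projective.

Theorem mainTheorem1 (F : finFieldType) (S : {set {perm PGpoint F}}) :
  max_indep_set S <->
  exists2 x, x \in PGL3 F &
    ((exists a : PGpoint F, S = (point_stab a :* x)%g) \/
     (exists l : PGline F, S = (line_stab l :* x)%g)).
Proof.
split=> [|[x xG [[a ->]|[l ->]]]]; first exact: max_indep_coset.
- apply: max_indep_rcoset xG (point_stab_sub a) _ _ => [g h|].
    by rewrite !mem_point_stab => /eqP ga /eqP ha; apply: (@same_image_not_der _ a); rewrite ga ha.
  by under eq_bigr do rewrite mem_point_stab; exact: map1.
apply: max_indep_rcoset xG (line_stab_sub l) _ _ => [g h|].
  by rewrite !mem_line_stab => /eqP gl /eqP hl; apply: (@same_line_not_der _ l); rewrite gl hl.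
by under eq_bigr do rewrite mem_line_stab; exact: sum_stabl.
Qed.
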